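(* Let $p>1$, let $\omega\subset\mathbb{R}^{n-1}$ be a bounded Lipschitz domain, and let $g_\pm\in\operatorname{Lip}(\omega)$ be Lipschitz functions with $g_-(x')<g_+(x')$ for all $x'\in\omega$; put $g=g_+-g_-$. For $\varepsilon>0$ let $\Omega_\varepsilon=\{(x',x_n): x'\in\omega,\ \varepsilon g_-(x')<x_n<\varepsilon g_+(x')\}$. Let $X_\varepsilon=L^2(\Omega_\varepsilon)$ be equipped with the inner product $(u,v)_{X_\varepsilon}=\frac1\varepsilon\int_{\Omega_\varepsilon}uv$, and let $X_0=L^2(\omega)$ be equipped with the weighted inner product $(v,w)_{X_0}=\int_\omega g\,v\,w$. Let $\mathcal{E}_\varepsilon\colon X_\varepsilon\to[0,\infty]$ be $\mathcal{E}_\varepsilon(u)=\frac1{\varepsilon p}\int_{\Omega_\varepsilon}|\nabla u|^p$ if $u\in L^2(\Omega_\varepsilon)\cap W^{1,p}(\Omega_\varepsilon)$ and $\mathcal{E}_\varepsilon(u)=\infty$ if $u\in L^2(\Omega_\varepsilon)\setminus W^{1,p}(\Omega_\varepsilon)$, and let $\mathcal{E}_0\colon X_0\to[0,\infty]$ be $\mathcal{E}_0(v)=\frac1p\int_\omega g|\nabla'v|^p$ if $v\in L^2(\omega)\cap W^{1,p}(\omega)$ and $\mathcal{E}_0(v)=\infty$ if $v\in L^2(\omega)\setminus W^{1,p}(\omega)$, where $\nabla'=(\partial_{x_1},\dots,\partial_{x_{n-1}})$. Let $L_\varepsilon\colon X_\varepsilon\to X_0$ be $$L_\varepsilon u(x')=\frac1{\varepsilon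 g(x')}\int_{\varepsilon g_-(x')}^{\varepsilon g_+(x')}u(x',x_n)\,\mathrm{d}x_n.$$ Then the gradient flow $S_\varepsilon$ of $\mathcal{E}_\varepsilon$ uniformly converges to the gradient flow $S_0$ of $\mathcal{E}_0$ along $L_\varepsilon$ as $\varepsilon\to0^+$.
   Context: Strong convergence along $L_\varepsilon$: for $w\in X_0$, $w^\varepsilon\in X_\varepsilon$, $w^\varepsilon$ converge strongly to $w$ along $L_\varepsilon$ if $\|w^\varepsilon\|_{X_\varepsilon}\to\|w\|_{X_0}$ and $L_\varepsilon w^\varepsilon\to w$ in $X_0$ as $\varepsilon\to0^+$. Gradient flow: for a convex, lower semicontinuous $\mathcal{E}\colon X\to[0,\infty]$ on a Hilbert space $X$, with $D(\mathcal{E})=\{\mathcal{E}<\infty\}$, for every $u_0\in\overline{D(\mathcal{E})}$ and $T>0$ there is exactly one $u\in C([0,T],X)\cap W^{1,1}_{loc}(]0,T],X)$ with $u_t\in-\partial\mathcal{E}(u)$ for a.e. $t\in]0,T[$ and $u(0)=u_0$; the map $S\colon u_0\mapsto u$ is the gradient flow of $\mathcal{E}$ (the subdifferential is taken with respect to the inner product of $X$). Uniform convergence of flows: $S_\varepsilon$ uniformly converge to $S_0$ along $L_\varepsilon$ if $L_\varepsilon S_\varepsilon u_0^\varepsilon\to S_0u_0$ in $C([0,T],X_0)$ and $\|S_\varepsilon u_0^\varepsilon\|_{X_\varepsilon}\to\|S_0u_0\|_{X_0}$ in $C([0,T])$ whenever $u_0\in\overline{D(\mathcal{E}_0)}$,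 $u_0^\varepsilon\in\overline{D(\mathcal{E}_\varepsilon)}$ for $\varepsilon>0$, and $u_0^\varepsilon$ converge strongly to $u_0$ along $L_\varepsilon$. Here $T>0$ is arbitrary.
   Formalization: X_0 with the weighted inner product is required to be complete (a Hilbert space), i.e. g is bounded below by a positive constant on ω; if g tends to 0 at the boundary, X_0 is not complete and L_ε does not map into L²(ω), so the gradient flow is not defined. *)

(* Defs.v *)
From HB Require Import structures.
From mathcomp Require Import all_boot all_order all_algebra.
From mathcomp Require Import all_classical all_reals all_analysis.
Set Implicit Arguments.
Unset Strict Implicit.
Unset Printing Implicit Defensive.
Import Order.TTheory GRing.Theory Num.Theory.
Import numFieldNormedType.Exports.
Local Open Scope classical_set_scope.
Local Open Scope ring_scope.

(* Borel sigma-algebra of R^n, generated by the coordinate functions. *)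
Section rV_measurable.
Context (R : realType) (n : nat).

Definition rV_measurable : set (set 'rV[R]_n) :=
  g_sigma_preimage (fun (i : 'I_n) (x : 'rV[R]_n) => x ord0 i : measurableTypeR R).

Let rV_measurable0 : rV_measurable set0.
Proof. exact: sigma_algebra0. Qed.

Let rV_measurableC A : rV_measurable A -> rV_measurable (~` A).
Proof. exact: sigma_algebraC. Qed.

Let rV_measurable_bigcup (F : (set 'rV[R]_n)^nat) :
  (forall i, rV_measurable (F i)) -> rV_measurable (\bigcup_i F i).
Proof. exact: sigma_algebra_bigcup. Qed.

HB.instance Definition _ := @isMeasurable.Build default_measure_display
  'rV[R]_n rV_measurable rV_measurable0 rV_measurableC rV_measurable_bigcup.

End rV_measurable.

(* The point (x', t) of R^n x R = R^(n+1); the inverse projections are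
   [col' ord_max] and the last coordinate. *)
Definition rV_rcons (T : Type) (n : nat) (x : 'rV[T]_n) (t : T) : 'rV[T]_n.+1 :=
  \row_(i < n.+1) oapp (x ord0) t (unlift ord_max i).

Lemma measurable_rV_coord (R : realType) n (i : 'I_n) :
  measurable_fun setT (fun x : 'rV[R]_n => x ord0 i : measurableTypeR R).
Proof.
move=> _ Y mY; rewrite setTI; apply: sub_sigma_algebra => /=.
rewrite -bigcup_seq/=; exists i => /=; first by rewrite mem_index_enum.
by exists Y => //; rewrite setTI.
Qed.

Lemma measurable_fun_rVP d (T : measurableType d) (R : realType) n
    (f : T -> 'rV[R]_n) :
  (forall i, measurable_fun setT (fun x => f x ord0 i : measurableTypeR R)) ->
  measurable_fun setT f.
Proof.
move=> mf; apply: measurability; first by [].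
move=> A; rewrite -bigcup_seq => -[B [i _ [C mC <-]] <-].
by rewrite !setTI; have := mf i measurableT C mC; rewrite setTI.
Qed.

Lemma measurable_rV_rcons (R : realType) n :
  measurable_fun setT
    (fun z : 'rV[R]_n * measurableTypeR R => rV_rcons z.1 (z.2 : R)).
Proof.
apply: measurable_fun_rVP => i.
case: (unliftP ord_max i) => [j ->|->].
  rewrite [X in measurable_fun _ X](_ : _ =
      (fun x : 'rV[R]_n => x ord0 j : measurableTypeR R) \o fst).
    exact: (measurableT_comp (measurable_rV_coord j)).
  by apply/funext => z; rewrite /= mxE liftK.
rewrite [X in measurable_fun _ X](_ : _ = snd)//.
by apply/funext => z; rewrite /= mxE unlift_none.
Qed.

Fixpoint lebesgue_rV {R : realType} (n : nat) : set 'rV[R]_n -> \bar R :=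
  match n with
  | 0 => dirac (0 : 'rV[R]_0)
  | n'.+1 => pushforward (@lebesgue_rV R n' \x lebesgue_measure)%E
               (fun z : 'rV[R]_n' * measurableTypeR R => rV_rcons z.1 (z.2 : R))
  end.

Section lebesgue_rV_measure.
Context (R : realType) (n : nat).

Let lebesgue_rV_is_measure :
  exists m : {measure set 'rV[R]_n -> \bar R},
    (m : set 'rV[R]_n -> \bar R) = @lebesgue_rV R n.
Proof.
elim: n => [|k [m mE]] /=; first by eexists.
rewrite -mE.
exists (measure_function_pushforward__canonical__measure_function_Measure
  (m \x (@lebesgue_measure R))%E (@measurable_rV_rcons R k)).
by [].
Qed.

Let lebesgue_rV0 : @lebesgue_rV R n set0 = 0%E.
Proof. by have [m <-] := lebesgue_rV_is_measure; exact: measure0. Qed.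

Let lebesgue_rV_ge0 A : (0 <= @lebesgue_rV R n A)%E.
Proof. by have [m <-] := lebesgue_rV_is_measure; exact: measure_ge0. Qed.

Let lebesgue_rV_sigma_additive : semi_sigma_additive (@lebesgue_rV R n).
Proof.
by have [m <-] := lebesgue_rV_is_measure; exact: measure_semi_sigma_additive.
Qed.

HB.instance Definition _ := isMeasure.Build _ _ _ (@lebesgue_rV R n)
  lebesgue_rV0 lebesgue_rV_ge0 lebesgue_rV_sigma_additive.

End lebesgue_rV_measure.
Arguments lebesgue_rV {R n}.

(* Continuity and existence of all iterated directional derivatives; on a
   finite-dimensional space this is C^infinity. *)
Definition smooth (R : realType) (V : normedModType R) (f : V -> R) :=
  forall vs : seq V,
    let h := foldr (fun v (h : V -> R) => 'D_v h) f vs in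
    continuous h /\ forall x v, derivable h x v.

Definition test_function (R : realType) (V : normedModType R) (Om : set V)
    (phi : V -> R) :=
  smooth phi /\
  exists K, [/\ compact K, K `<=` Om & forall x, ~ K x -> phi x = 0].

Section Sobolev.
Context (R : realType) (n : nat).
Implicit Types (Om : set 'rV[R]_n) (p : R) (u : 'rV[R]_n -> R).

(* Functions are defined on all of R^n; only their values on [Om] matter. *)
Definition Lp Om p : set ('rV[R]_n -> R) :=
  [set u | u \_ Om \in Lfun lebesgue_rV p%:E].

(* The library norm on row vectors is the sup norm. *)
Definition enorm (x : 'rV[R]_n) : R := Num.sqrt (\sum_i x ord0 i ^+ 2).

(* The components of [w] are the weak partial derivatives of [u] in [Om], and
   they are in L^p([Om]). *)
Definition weak_gradient Om p u (w : 'rV[R]_n -> 'rV[R]_n) :=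
  forall i : 'I_n, Lp Om p (fun x => w x ord0 i) /\
    forall phi, test_function Om phi ->
      \int[lebesgue_rV]_(x in Om) (u x * 'D_(delta_mx ord0 i) phi x) =
      - \int[lebesgue_rV]_(x in Om) (w x ord0 i * phi x).

Definition W1p Om p : set ('rV[R]_n -> R) :=
  [set u | Lp Om p u /\ exists w, weak_gradient Om p u w].

Definition grad Om p u : 'rV[R]_n -> 'rV[R]_n :=
  xget (fun=> 0) [set w | weak_gradient Om p u w].

End Sobolev.

(* A linear space [V], a subset [X] of it and a form which is meant to be a
   positive semidefinite inner product on [X].  The space it stands for is the
   quotient of [X] by the vectors of norm 0: for L^2 spaces, [X] consists of
   functions and the vectors of norm 0 are the functions equal to 0 a.e. *)
Record ipSpace (R : realType) := IpSpace {
  ip_vec :> lmodType R;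
  ip_mem : set ip_vec;
  ip : ip_vec -> ip_vec -> R
}.
Arguments ip_mem {R} _ _.
Arguments ip {R} _ _ _.

Section ipSpace.
Context (R : realType).
Implicit Types (X : ipSpace R).

Definition ipnorm X (u : X) : R := Num.sqrt (ip X u u).

Definition ip_complete X :=
  forall u : nat -> X, (forall k, ip_mem X (u k)) ->
    (forall e, 0 < e -> exists N, forall j k, (N <= j)%N -> (N <= k)%N ->
       ipnorm (u j - u k) < e) ->
    exists2 l, ip_mem X l & ipnorm (u k - l) @[k --> \oo] --> 0.

Definition is_hilbert X :=
  [/\ ip_mem X 0 /\
      (forall (a : R) u v, ip_mem X u -> ip_mem X v -> ip_mem X (a *: u + v)),
      (forall u v, ip_mem X u -> ip_mem X v -> ip X u v = ip X v u),
      (forall (a : R) u v w, ip_mem X u -> ip_mem X v -> ip_mem X w ->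
         ip X (a *: u + v) w = a * ip X u w + ip X v w),
      (forall u, ip_mem X u -> 0 <= ip X u u) &
      ip_complete X].

Record stepFun X := StepFun {
  step_size : nat;
  step_set : 'I_step_size -> set (measurableTypeR R);
  step_val : 'I_step_size -> X;
  step_setP : forall i, measurable (step_set i) /\
                        (lebesgue_measure (step_set i) < +oo)%E;
  step_valP : forall i, ip_mem X (step_val i)
}.

Definition step_fun X (s : stepFun X) (t : R) : X :=
  \sum_i (\1_(@step_set X s i) t : R) *: step_val i.

Definition step_integral X (D : set (measurableTypeR R)) (s : stepFun X) : X :=
  \sum_i fine (lebesgue_measure (@step_set X s i `&` D)) *: step_val i.

(* [f] is Bochner integrable on [D] with integral [I]: it is an L^1 limit of step
   functions whose integrals converge to [I]. *)
Definition bochner_integral X (D : set (measurableTypeR R)) (f : R -> X)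
    (I : X) :=
  [/\ forall t, D t -> ip_mem X (f t),
      ip_mem X I &
      exists s : nat -> stepFun X,
      [/\ forall k, measurable_fun D (fun t => ipnorm (f t - step_fun (s k) t)),
          (\int[lebesgue_measure]_(t in D)
             (ipnorm (f t - step_fun (s k) t))%:E)%E @[k --> \oo] --> 0%E &
          ipnorm (I - step_integral D (s k)) @[k --> \oo] --> 0]].

Definition bochner_integrable X (D : set (measurableTypeR R)) (f : R -> X) :=
  exists I, bochner_integral D f I.

(* [u] belongs to W^{1,1}_loc(]0, T], X), with weak derivative [v]. *)
Definition W11loc X (T : R) (u v : R -> X) :=
  forall a, 0 < a < T ->
  [/\ bochner_integrable `]a, T[ u,
      bochner_integrable `]a, T[ v &
      forall phi : R -> R, test_function (`]a, T[ : set R) phi ->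
        exists2 I, bochner_integral `]a, T[ (fun t => derive1 phi t *: u t) I &
                   bochner_integral `]a, T[ (fun t => phi t *: v t) (- I)].

Definition domain X (E : X -> \bar R) : set X :=
  [set u | ip_mem X u /\ (E u < +oo)%E].

Definition domain_closure X (E : X -> \bar R) : set X :=
  [set u | ip_mem X u /\
     forall e, 0 < e -> exists2 w, domain E w & ipnorm (w - u) < e].

Definition subdiff X (E : X -> \bar R) (u : X) : set X :=
  [set f | [/\ ip_mem X u, ip_mem X f &
     forall w, ip_mem X w -> (E u + (ip X f (w - u))%:E <= E w)%E]].

Definition flow_solution X (E : X -> \bar R) (T : R) (u0 : X) (u : R -> X) :=
  [/\ forall t, 0 <= t <= T -> ip_mem X (u t),
      forall t, 0 <= t <= T ->
        ipnorm (u s - u t) @[s --> within `[0, T] (nbhs t)] --> 0,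
      ipnorm (u 0 - u0) = 0 &
      exists2 v, W11loc T u v &
        {ae lebesgue_measure, forall t : R, 0 < t < T ->
           subdiff E (u t) (- v t)}].

(* Gradient flows are only defined on a complete space [X]. This is not
   automatic for a weighted L^2 space, see [limit_space] below. Convexity and
   lower semicontinuity of [E] are not needed to state the equation. *)
Definition gradient_flow X (E : X -> \bar R) (T : R) (S : X -> R -> X) :=
  is_hilbert X /\
  forall u0, domain_closure E u0 -> flow_solution E T u0 (S u0).

Definition strong_cvg (X0 : ipSpace R) (X : R -> ipSpace R)
    (L : forall e, X e -> X0) (we : forall e, X e) (w : X0) :=
  ipnorm (we e) @[e --> 0^'+] --> ipnorm w /\
  ipnorm (L e (we e) - w) @[e --> 0^'+] --> 0.

Definition flows_uniformly_cvg (X0 : ipSpace R) (X : R -> ipSpace R)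
    (L : forall e, X e -> X0) (E0 : X0 -> \bar R) (E : forall e, X e -> \bar R)
    (T : R) (S0 : X0 -> R -> X0) (S : forall e, X e -> R -> X e) :=
  forall (u0 : X0) (ue : forall e, X e),
    domain_closure E0 u0 ->
    (forall e, 0 < e -> domain_closure (@E e) (ue e)) ->
    strong_cvg L ue u0 ->
    {uniform `[0, T],
      (fun e t => ipnorm (L e (S e (ue e) t) - S0 u0 t)) @ 0^'+ --> cst (0 : R)}
    /\
    {uniform `[0, T],
      (fun e t => ipnorm (S e (ue e) t)) @ 0^'+ --> (fun t => ipnorm (S0 u0 t))}.

End ipSpace.

(* Near each boundary point and after an orthogonal change of coordinates, the
   domain is the strict epigraph of a Lipschitz function of all coordinates but
   the last. *)
Definition lipschitz_boundary (R : realType) (n : nat) (Om : set 'rV[R]_n.+1) :=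
  forall x0, (closure Om `\` Om) x0 ->
  exists (Q : 'M[R]_n.+1) (ga : 'rV[R]_n -> R),
    [/\ Q *m Q^T = 1%:M,
        [lipschitz ga y | y in setT] &
        \forall x \near x0,
          Om x <-> ga (col' ord_max (x *m Q)) < (x *m Q) ord0 ord_max].

Definition lipschitz_domain (R : realType) (n : nat) (Om : set 'rV[R]_n.+1) :=
  [/\ open Om, connected Om, Om !=set0, bounded_set Om &
      lipschitz_boundary Om].

Section thin_domain.
Context (R : realType) (n : nat) (om : set 'rV[R]_n) (gm gp : 'rV[R]_n -> R)
  (p : R).

Let g x := gp x - gm x.

Definition thin_domain (e : R) : set 'rV[R]_n.+1 :=
  [set x | let x' := col' ord_max x in
     om x' /\ e * gm x' < x ord0 ord_max < e * gp x'].

Definition thin_space (e : R) : ipSpace R :=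
  @IpSpace R ('rV[R]_n.+1 -> R) (Lp (thin_domain e) 2)
    (fun u v => e^-1 * \int[lebesgue_rV]_(x in thin_domain e) (u x * v x)).

(* [ip_complete limit_space] means that the weighted norm is equivalent to that
   of L^2([om]), i.e. that [g] is bounded away from 0 on [om]. *)
Definition limit_space : ipSpace R :=
  @IpSpace R ('rV[R]_n -> R) (Lp om 2)
    (fun v w => \int[lebesgue_rV]_(x in om) (g x * v x * w x)).

Definition thin_energy (e : R) (u : thin_space e) : \bar R :=
  if u \in W1p (thin_domain e) p then
    (((e * p)^-1)%:E * \int[lebesgue_rV]_(x in thin_domain e)
       (enorm (grad (thin_domain e) p u x) `^ p)%:E)%E
  else +oo%E.

Definition limit_energy (v : limit_space) : \bar R :=
  if v \in W1p om p then
    ((p^-1)%:E * \int[lebesgue_rV]_(x in om)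
       (g x * enorm (grad om p v x) `^ p)%:E)%E
  else +oo%E.

Definition thin_average (e : R) (u : thin_space e) : limit_space :=
  fun x' => (e * g x')^-1 *
    \int[lebesgue_measure]_(t in `]e * gm x', e * gp x'[) u (rV_rcons x' t).

End thin_domain.

(* Main.v *)
From HB Require Import structures.
Require Import Defs.
From mathcomp Require Import all_boot all_order all_algebra.
From mathcomp Require Import all_classical all_reals all_analysis.
From mathcomp Require Import measurable_realfun ring lra zify.
Set Implicit Arguments.
Unset Strict Implicit.
Unset Printing Implicit Defensive.
Import Order.TTheory GRing.Theory Num.Theory.
Import numFieldNormedType.Exports.
Local Open Scope classical_set_scope.
Local Open Scope ring_scope.

(** For [v] on [om] let [lift v] be the function [fun z => v (col' ord_max z)] on the
thin domain, constant along the fibres.  Then [lift] is an isometry of [X_0] into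
[X_e] ([ext_isometry]), and the average [L_e] is its adjoint ([av_adjoint]).  The
two energies are linked by
  - [E_e (lift v) <= E_0 v] ([ext_energy]),
  - [E_0 (L_e u) <= (1 + C * e) `^ (p / 2) * E_e u] for [e <= 1]
    ([average_energy]).

Let [u] and [v] be the flows of [E_e] and [E_0], and
[la = (1 + C * e) `^ (p / 2) - 1].  Test the subdifferential inequality of [- u']
with [lift v] and with [0], that of [- v'] with [L_e u], and add the three with
weights [1], [la], [1].  The two energy inequalities cancel all energies, and
  (u' - lift v', u - lift v) + la (u', u) <= 0
at almost every time ([subdiff_dissip]).  Hence
[|u - lift v|^2 + la |u|^2] is nonincreasing ([energyQ_le0]).  Its initial value
tends to [0]: adjointness gives
  |u_e - lift u_0|^2 = |u_e|^2 - 2 (L_e u_e, u_0) + |u_0|^2,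
which is controlled by the two conditions of strong convergence
([lift_dist_sqr_le]), and [la] tends to [0].  Since [L_e] is a contraction and
[lift] an isometry, [|L_e u - v|] and the difference of [|u|] and [|v|] are at most
[|u - lift v|], uniformly in time ([flows_dist]).

The energy of [lift v] is an application of Fubini.  The energy of [L_e u] is where
the geometry enters.  With [k = 1 / g] and [a = - gm / g], the function
[s = x_n k / e + a] maps every fibre onto ]0, 1[.  The vector field with components
[k phi] in direction [i] and [- (x_n d_i k + e d_i a) phi] in direction [n] is
tangent to the level sets of [s], so that multiplying it by a cutoff [chi (s)]
produces test functions, and its divergence is [k d_i phi chi (s)]
([shear_divergence]).  Letting the cutoff tend to [1] yields
  d_i (L_e u) = L_e (d_i u - g (x_n d_i k + e d_i a) d_n u),
a perturbation of relative size [e] of [d_i u], and Jensen's inequality along the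
fibres concludes.

Test functions are smooth while [k] and [a] are Lipschitz.  A Lipschitz function is a
uniform limit of smooth functions with bounded derivatives
([lipschitz_smooth_approx]).  The derivatives of approximants of precision [1 / m]
form convex sets which decrease with [m]; elements of almost minimal norm in [X_0]
form a Cauchy sequence, and converge almost everywhere along it
([smooth_approx_derivative_ae]).  The passage to the limit is dominated convergence.

All these estimates use a positive lower bound of [g].  It comes from the
completeness of [X_0]: otherwise the sets where [g] is below [16 ^ -k] carry
functions whose series converges in the weighted norm but not in L^2
([weight_bounded_below]).

In time, the derivative of a flow is a Bochner integrable weak derivative, known
through step functions which approximate it in L^1.  Over a short time interval
increments are paired with nearly constant vectors ([primitive_estimate]), and local
monotonicity up to a small slope gives global monotonicity ([energyQ_interior]). *)

(** * The Lebesgue measure of R^n *)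

Section rV_measure.
Context {R : realType}.

Definition rV_box n (l r : 'I_n -> R) : set 'rV[R]_n :=
  [set x | forall i, l i < x ord0 i < r i].

Lemma measurable_rV_box n (l r : 'I_n -> R) : measurable (rV_box l r).
Proof.
have -> : rV_box l r = \bigcap_(i in [set: 'I_n])
    ((fun x : 'rV[R]_n => x ord0 i : measurableTypeR R) @^-1` `]l i, r i[).
  apply/seteqP; split=> x /= H i; first by move=> _ /=; rewrite in_itv/=.
  by have := H i I; rewrite /= in_itv.
apply: fin_bigcap_measurable; first exact: finite_finset.
move=> i _; rewrite -[X in measurable X]setTI.
by apply: measurable_rV_coord => //; exact: measurable_itv.
Qed.

Lemma rV_ballP n (x y : 'rV[R]_n) (e : R) :
  ball x e y <-> 0 < e /\ forall i, `|x ord0 i - y ord0 i| < e.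
Proof.
split.
  move=> [e0 H]; split => // i; exact: (H ord0 i).
move=> [e0 H]; split=> // i j; rewrite (ord1 i); exact: H.
Qed.

(** Rational boxes are a countable base; this form also serves to cover the
    exceptional sets of the fundamental lemma. *)
Lemma rV_open_countable_box n (U : set 'rV[R]_n) : open U ->
  U = \bigcup_(q in [set q : ('rV[rat]_n * nat)%type |
        rV_box (fun i => ratr (q.1 ord0 i) - q.2.+1%:R^-1)
               (fun i => ratr (q.1 ord0 i) + q.2.+1%:R^-1) `<=` U])
      rV_box (fun i => ratr (q.1 ord0 i) - q.2.+1%:R^-1)
             (fun i => ratr (q.1 ord0 i) + q.2.+1%:R^-1).
Proof.
move=> oU; apply/seteqP; split => [x Ux|x [q /= + xq]]; last exact.
have /nbhs_ballP[e /= e0 xeU] : nbhs x U by exact: open_nbhs_nbhs.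
have [k ke] : exists k : nat, k.+1%:R^-1 < e / 2.
  have e20 : 0 < e / 2 by lra.
  by have [k _ /(_ k) H] := near_infty_natSinv_lt (PosNum e20); exists k; apply: H => /=.
have k0 : 0 < k.+1%:R^-1 :> R by rewrite invr_gt0.
set d : R := k.+1%:R^-1 in ke k0 *.
have /choice[q qP] : forall i : 'I_n, exists q : rat,
    ratr q \in `]x ord0 i - d, x ord0 i + d[.
  by move=> i; apply: rat_in_itvoo; lra.
have {}qP i : `|ratr (q i) - x ord0 i| < d.
  by have := qP i; rewrite in_itv/= ltr_norml => /andP[? ?]; apply/andP; split; lra.
exists (\row_i q i, k) => /=.
  move=> y /= yq; apply: xeU; apply/rV_ballP; split => // i.
  have := yq i; have := qP i; rewrite /= mxE -/d !ltr_norml => /andP[? ?] /andP[? ?].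
  by apply/andP; split; lra.
move=> i; have := qP i; rewrite /= mxE -/d !ltr_norml => /andP[? ?].
by apply/andP; split; lra.
Qed.

Lemma open_measurable_rV n (U : set 'rV[R]_n) : open U -> measurable U.
Proof.
move=> oU; rewrite (rV_open_countable_box oU) bigcup_mkcond.
apply: countable_bigcupT_measurable => [|q]; first exact: countableP.
by case: ifP => _ //; exact: measurable_rV_box.
Qed.

Lemma continuous_measurable_rV n (f : 'rV[R]_n -> R) :
  continuous f -> measurable_fun setT (f : _ -> measurableTypeR R).
Proof.
move=> cf; apply: (measurability _ (RGenOInfty.measurableE R)) => _ [_ [a ->] <-].
rewrite setTI; apply: open_measurable_rV; by apply: open_comp => // x _; exact: cf.
Qed.

Lemma open_continuous_measurable_rV n (U : set 'rV[R]_n) (f : 'rV[R]_n -> R) :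
  open U -> {in U, continuous f} -> measurable_fun U (f : _ -> measurableTypeR R).
Proof.
move=> oU cf; apply: (measurability _ (RGenOInfty.measurableE R)) => _ [_ [a ->] <-].
apply: open_measurable_rV; rewrite openE => x [Ux /= fx].
have nf : nbhs x (f @^-1` `]a, +oo[).
  by apply: cf; [exact/mem_set|apply: open_nbhs_nbhs; split => //; exact: interval_open].
have nU : nbhs x U by exact: open_nbhs_nbhs.
by apply: filterI.
Qed.

Lemma measurable_col' n :
  measurable_fun setT (fun x : 'rV[R]_n.+1 => col' ord_max x : 'rV[R]_n).
Proof.
apply: measurable_fun_rVP => i.
rewrite (_ : (fun x => _) =
  (fun x : 'rV[R]_n.+1 => x ord0 (lift ord_max i) : measurableTypeR R)).
  exact: measurable_rV_coord.
by apply/funext => x; rewrite mxE.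
Qed.

Lemma col'_rcons n (x : 'rV[R]_n) t : col' ord_max (rV_rcons x t) = x.
Proof. by apply/rowP => i; rewrite !mxE liftK. Qed.

Lemma rcons_last n (x : 'rV[R]_n) t : rV_rcons x t ord0 ord_max = t.
Proof. by rewrite mxE unlift_none. Qed.

Lemma rcons_lift n (x : 'rV[R]_n) t i : rV_rcons x t ord0 (lift ord_max i) = x ord0 i.
Proof. by rewrite mxE liftK. Qed.

Lemma lebesgue_rVS n (A : set 'rV[R]_n.+1) : lebesgue_rV A =
  pushforward (@lebesgue_rV R n \x lebesgue_measure)%E
               (fun z : 'rV[R]_n * measurableTypeR R => rV_rcons z.1 (z.2 : R)) A.
Proof. by []. Qed.

Lemma lebesgue_rV_box n (l r : 'I_n -> R) : (forall i, l i < r i) ->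
  lebesgue_rV (rV_box l r) = (\prod_i (r i - l i))%:E.
Proof.
elim: n l r => [|n IH] l r lr.
  rewrite big_ord0 /= /dirac indicE mem_set//; by case.
rewrite lebesgue_rVS /pushforward.
rewrite [X in (_ \x _)%E X](_ : _ =
   rV_box (fun i => l (lift ord_max i)) (fun i => r (lift ord_max i)) `*`
   `]l ord_max, r ord_max[); last first.
  apply/seteqP; split => [[x t] /= H|[x t] /= [H1 H2] i].
    split => [i|]; first by have := H (lift ord_max i); rewrite rcons_lift.
    by have := H ord_max; rewrite rcons_last in_itv.
  case: (unliftP ord_max i) => [j ->|->]; first by rewrite rcons_lift.
  by rewrite rcons_last; move: H2; rewrite in_itv.
rewrite product_measure1E//; last exact: measurable_rV_box.
rewrite [X in (X * _)%E](IH (fun i => l (lift ord_max i)) (fun i => r (lift ord_max i))); last by move=> i; exact: lr.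
rewrite [X in (_ * X)%E]lebesgue_measure_itv/= lte_fin lr -EFinD -EFinM big_ord_recr/=.
congr ((_ * _)%:E).
by apply: eq_bigr => i _; have -> : widen_ord (leqnSn n) i = lift ord_max i by apply: val_inj; rewrite /= /bump leqNgt ltn_ord add0n.
Qed.

Lemma lebesgue_rV_bounded n (A : set 'rV[R]_n) (M : R) : measurable A ->
  (forall x, A x -> forall i, `|x ord0 i| <= M) -> (lebesgue_rV A < +oo)%E.
Proof.
move=> mA AM.
(* The box is open, and [M] may be negative. *)
pose M' := `|M| + 1.
apply: (@le_lt_trans _ _ (lebesgue_rV (rV_box (fun=> - M') (fun=> M') : set 'rV[R]_n))).
  apply: le_measure; rewrite ?inE//; first exact: measurable_rV_box.
  move=> x Ax i; have := AM x Ax i; rewrite ler_norml /M' => /andP[? ?].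
  by have := ler_norm M => ?; apply/andP; split; lra.
by rewrite lebesgue_rV_box ?ltry// => i; rewrite /M'; have := normr_ge0 M; lra.
Qed.

Lemma lebesgue_rV_sigma_finite n : sigma_finite setT (@lebesgue_rV R n).
Proof.
exists (fun k => rV_box (fun=> - k%:R) (fun=> k%:R) : set 'rV[R]_n).
  apply/seteqP; split => // x _.
  exists (Num.truncn (\sum_i `|x ord0 i|)).+1 => // i.
  rewrite -ltr_norml; apply: (le_lt_trans _ (truncnS_gt _)).
  by rewrite (bigD1 i)//= lerDl sumr_ge0.
move=> k; split; first exact: measurable_rV_box.
apply: (@lebesgue_rV_bounded _ _ k%:R); first exact: measurable_rV_box.
by move=> x /= H i; rewrite ltW// ltr_norml.
Qed.

HB.instance Definition _ n := @Measure_isSigmaFinite.Build _ _ _ (@lebesgue_rV R n)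
  (@lebesgue_rV_sigma_finite n).

Lemma open_lebesgue_rV_gt0 n (U : set 'rV[R]_n) : open U -> U !=set0 ->
  (0 < lebesgue_rV U)%E.
Proof.
move=> oU [x Ux].
have /nbhs_ballP[e /= e0 xeU] : nbhs x U by exact: open_nbhs_nbhs.
apply: (@lt_le_trans _ _ (lebesgue_rV
   (rV_box (fun i => x ord0 i - e) (fun i => x ord0 i + e)))).
  rewrite lebesgue_rV_box => [|i]; last by lra.
  by rewrite lte_fin prodr_gt0// => i _; lra.
apply: le_measure; rewrite ?inE; [exact: measurable_rV_box|exact: open_measurable_rV|].
move=> y /= H; apply: xeU; apply/rV_ballP; split=> // i.
by rewrite distrC ltr_distl.
Qed.

End rV_measure.

(** * Integration along the last coordinate *)

Section rV_fubini.
Context {R : realType} (n : nat).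
Local Notation mu := (@lebesgue_rV R n).
Local Notation mu1 := (@lebesgue_rV R n.+1).
Local Notation leb := (@lebesgue_measure R).
Local Notation rc := (fun z : 'rV[R]_n * measurableTypeR R => rV_rcons z.1 (z.2 : R)).
Local Open Scope ereal_scope.

Lemma rV_integralE (f : 'rV[R]_n.+1 -> \bar R) :
  \int[mu1]_x f x = \int[pushforward (mu \x leb) rc]_x f x.
Proof. by []. Qed.

(** The measure on the larger space is a pushforward of a product measure, so
    Tonelli and Fubini are inherited from products. *)
Lemma rV_tonelli (f : 'rV[R]_n.+1 -> \bar R) :
  measurable_fun setT f -> (forall x, 0 <= f x) ->
  \int[mu1]_x f x = \int[mu]_x \int[leb]_t f (rV_rcons x t).
Proof.
move=> mf f0; rewrite rV_integralE ge0_integral_pushforward//; last exact: measurable_rV_rcons.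
rewrite preimage_setT fubini_tonelli1//; last by move=> z; exact: f0.
by apply: measurableT_comp => //; exact: measurable_rV_rcons.
Qed.

Lemma rV_integrable_rcons (f : 'rV[R]_n.+1 -> \bar R) :
  mu1.-integrable setT f -> (mu \x leb).-integrable setT (f \o rc).
Proof.
move=> /integrableP[mf lf]; apply/integrableP; split.
  by apply: measurableT_comp => //; exact: measurable_rV_rcons.
move: lf; rewrite rV_integralE ge0_integral_pushforward//; last exact: measurableT_comp.
exact: measurable_rV_rcons.
Qed.

Lemma rV_fubini12 (f : 'rV[R]_n.+1 -> \bar R) : mu1.-integrable setT f ->
  \int[mu1]_x f x = \int[mu]_x \int[leb]_t f (rV_rcons x t).
Proof.
move=> fi; have fi' := rV_integrable_rcons fi.
rewrite rV_integralE integral_pushforward//; [|exact: measurable_rV_rcons|by case/integrableP : fi].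
by rewrite preimage_setT -integral12_prod_meas1.
Qed.

Lemma rV_fubini21 (f : 'rV[R]_n.+1 -> \bar R) : mu1.-integrable setT f ->
  \int[mu1]_x f x = \int[leb]_t \int[mu]_x f (rV_rcons x t).
Proof.
move=> fi; have fi' := rV_integrable_rcons fi.
rewrite rV_integralE integral_pushforward//; [|exact: measurable_rV_rcons|by case/integrableP : fi].
by rewrite preimage_setT -integral21_prod_meas1.
Qed.

Lemma rV_fubini_ae (f : 'rV[R]_n.+1 -> \bar R) : mu1.-integrable setT f ->
  {ae mu, forall x, leb.-integrable setT (fun t => f (rV_rcons x t))}.
Proof. by move=> /rV_integrable_rcons/ae_integrable1. Qed.

Lemma rV_fubini_integrable (f : 'rV[R]_n.+1 -> \bar R) : mu1.-integrable setT f ->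
  mu.-integrable setT (fun x => \int[leb]_t f (rV_rcons x t)).
Proof. by move=> /rV_integrable_rcons/integrable_fubini_F. Qed.

End rV_fubini.

Section slices.
Context {R : realType} (n : nat) (om : set 'rV[R]_n) (a b : 'rV[R]_n -> R).
Local Notation mu := (@lebesgue_rV R n).
Local Notation mu1 := (@lebesgue_rV R n.+1).
Local Notation leb := (@lebesgue_measure R).
Hypothesis oom : open om.
Hypothesis ca : {in om, continuous a}.
Hypothesis cb : {in om, continuous b}.

(** The thin domains are of this form, with the graphs scaled by [e]. *)
Definition between : set 'rV[R]_n.+1 :=
  [set x | om (col' ord_max x) /\ a (col' ord_max x) < x ord0 ord_max < b (col' ord_max x)].

Lemma continuous_col' : continuous (fun x : 'rV[R]_n.+1 => col' ord_max x : 'rV[R]_n).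
Proof.
move=> x A /nbhs_ballP[e /= e0 eA]; apply/nbhs_ballP; exists e => //= y /(rV_ballP x y)[_ H].
apply: eA.
by apply/rV_ballP; split => // i; rewrite !mxE.
Qed.

Lemma continuous_rcons_last (x : 'rV[R]_n) : continuous (fun t : R => rV_rcons x t : 'rV[R]_n.+1).
Proof.
move=> t; apply/cvg_ballP => e e0; apply/nbhs_ballP; exists e => // s ts.
apply/rV_ballP; split => // i; case: (unliftP ord_max i) => [j ->|->].
  by rewrite !rcons_lift subrr normr0.
by rewrite !rcons_last; exact: ts.
Qed.

Lemma continuous_rcons_init (t : R) : continuous (fun x : 'rV[R]_n => rV_rcons x t : 'rV[R]_n.+1).
Proof.
move=> x A /nbhs_ballP[e /= e0 eA]; apply/nbhs_ballP; exists e => //= y /(rV_ballP x y)[_ H].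
apply: eA.
apply/rV_ballP; split => // i; case: (unliftP ord_max i) => [j ->|->].
  by rewrite !rcons_lift.
by rewrite !rcons_last subrr normr0.
Qed.

Lemma between_open : open between.
Proof.
rewrite openE => x [ox /andP[xa xb]].
have cx := @continuous_col' x.
have cl := @coord_continuous R 1 n.+1 ord0 ord_max x.
have n1 : \forall y \near x, om (col' ord_max y).
  by apply: cx; exact: open_nbhs_nbhs.
have cax : a (col' ord_max y) @[y --> x] --> a (col' ord_max x).
  by apply: (@continuous_comp _ _ _ (fun y : 'rV[R]_n.+1 => col' ord_max y) a) => //; apply: ca; exact/mem_set.
have cbx : b (col' ord_max y) @[y --> x] --> b (col' ord_max x).
  by apply: (@continuous_comp _ _ _ (fun y : 'rV[R]_n.+1 => col' ord_max y) b) => //; apply: cb; exact/mem_set.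
have n2 : \forall y \near x, 0 < (y : 'rV[R]_n.+1) ord0 ord_max - a (col' ord_max y).
  by apply: (cvgr_gt _ (cvgB cl cax)); rewrite subr_gt0.
have n3 : \forall y \near x, 0 < b (col' ord_max y) - (y : 'rV[R]_n.+1) ord0 ord_max.
  by apply: (cvgr_gt _ (cvgB cbx cl)); rewrite subr_gt0.
rewrite /interior/=; near=> y; split; first by near: y.
by apply/andP; split; rewrite -subr_gt0; near: y.
Unshelve. all: by end_near.
Qed.

Lemma between_rcons x t : between (rV_rcons x t) <-> om x /\ a x < t < b x.
Proof. by rewrite /between/= col'_rcons rcons_last. Qed.

Lemma in_between x t : om x -> (rV_rcons x t \in between) = (t \in `]a x, b x[%classic).
Proof.
move=> ox; apply/idP/idP => /set_mem.
  by move=> /between_rcons[_ H]; apply/mem_set; rewrite /= in_itv.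
by rewrite /= in_itv/= => H; apply/mem_set/between_rcons.
Qed.

Lemma measurable_between : measurable between.
Proof. by apply: open_measurable_rV; exact: between_open. Qed.

Local Open Scope ereal_scope.
Lemma patch_between (f : 'rV[R]_n.+1 -> \bar R) x :
   \int[leb]_t (f \_ between) (rV_rcons x t) =
   ((fun x => \int[leb]_(t in `]a x, b x[) f (rV_rcons x t)) \_ om) x.
Proof.
rewrite patchE; case: ifPn => [/set_mem ox|/negP ox].
  rewrite [RHS]integral_mkcond; apply: eq_integral => t _.
  by rewrite !patchE in_between.
apply: integral0_eq => t _; rewrite patchE ifF//.
by apply/negbTE/negP => /set_mem/between_rcons[ox' _]; apply: ox; exact/mem_set.
Qed.

Lemma between_tonelli (f : 'rV[R]_n.+1 -> \bar R) :
  measurable_fun between f -> (forall x, between x -> 0 <= f x) ->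
  \int[mu1]_(x in between) f x = \int[mu]_(x in om) \int[leb]_(t in `]a x, b x[) f (rV_rcons x t).
Proof.
move=> mf f0; rewrite integral_mkcond rV_tonelli; last 2 first.
- by apply/(measurable_restrictT _ measurable_between).
- by move=> x; rewrite patchE; case: ifP => // /set_mem; exact: f0.
rewrite [RHS]integral_mkcond; apply: eq_integral => x _; exact: patch_between.
Qed.

Lemma between_integrable_ae (f : 'rV[R]_n.+1 -> \bar R) : mu1.-integrable between f ->
  {ae mu, forall x, om x -> leb.-integrable `]a x, b x[ (fun t => f (rV_rcons x t))}.
Proof.
move=> /(integrable_mkcond _ measurable_between)/rV_fubini_ae; apply: filterS => x + ox.
rewrite [in X in _ -> X]integrable_mkcond; last exact: measurable_itv.
apply: eq_integrable => // t _; by rewrite !patchE in_between.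
Qed.

Lemma between_fubini (f : 'rV[R]_n.+1 -> \bar R) : mu1.-integrable between f ->
  \int[mu1]_(x in between) f x = \int[mu]_(x in om) \int[leb]_(t in `]a x, b x[) f (rV_rcons x t).
Proof.
move=> /(integrable_mkcond _ measurable_between) fi.
rewrite [LHS]integral_mkcond rV_fubini12// [RHS]integral_mkcond; apply: eq_integral => x _; exact: patch_between.
Qed.

Lemma between_fubini_integrable (f : 'rV[R]_n.+1 -> \bar R) : mu1.-integrable between f ->
  mu.-integrable om (fun x => \int[leb]_(t in `]a x, b x[) f (rV_rcons x t)).
Proof.
move=> /(integrable_mkcond _ measurable_between)/rV_fubini_integrable.
rewrite [in X in _ -> X]integrable_mkcond; last exact: open_measurable_rV.
by apply: eq_integrable => // x _; rewrite patch_between.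
Qed.

End slices.

(** * Calculus of smooth functions *)

Section smooth_theory.
Context {R : realType}.

(** Smoothness is a statement about all iterated derivatives; it suffices to
    find a class closed under one derivative. Every smoothness proof below goes
    through this principle. *)
Lemma smooth_coind (V : normedModType R) (P : (V -> R) -> Prop) :
  (forall f, P f -> continuous f /\ forall x v, derivable f x v) ->
  (forall f v, P f -> P ('D_v f)) ->
  forall f, P f -> smooth f.
Proof.
move=> P1 P2 f Pf vs h; apply: P1; rewrite /h {h}.
by elim: vs => //= v vs IH; exact: P2.
Qed.

Lemma smooth_continuous (V : normedModType R) (f : V -> R) : smooth f -> continuous f.
Proof. by move=> /(_ [::])[]. Qed.

Lemma smooth_derivable (V : normedModType R) (f : V -> R) x v : smooth f -> derivable f x v.
Proof. by move=> /(_ [::])[]. Qed.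

Lemma smooth_derive (V : normedModType R) (f : V -> R) v : smooth f -> smooth ('D_v f).
Proof. by move=> sf vs; have := sf (rcons vs v); rewrite foldr_rcons. Qed.

Lemma smooth_cst (V : normedModType R) (c : R) : smooth (fun _ : V => c).
Proof.
apply: (@smooth_coind V (fun f => exists c, f = fun=> c)); last by exists c.
- move=> f [{}c ->]; split => [|x v]; [exact: cst_continuous|exact: derivable_cst].
- by move=> f v [{}c ->]; exists 0; apply/funext => x; exact: derive_cst.
Qed.

(** A directional derivative is the derivative at 0 along a line, which reduces
    the chain rule to the one-variable one. *)
Lemma derive_along_line (V : normedModType R) (f : V -> R) x v : 'D_1 (fun h : R => f (h *: v + x)) 0 = 'D_v f x.
Proof.
rewrite /derive; set g1 := fun h => h^-1 *: _; set g2 := fun h => h^-1 *: _.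
suff -> : g1 = g2 by [].
by rewrite funeqE /g1 /g2 => h /=; rewrite addr0 scale0r add0r [_%:A]mulr1.
Qed.

Lemma is_derive_dir_comp (V : normedModType R) (chi : R -> R) (f : V -> R) x v :
  derivable chi (f x) 1 -> derivable f x v ->
  is_derive x v (chi \o f) ('D_1 chi (f x) * 'D_v f x).
Proof.
move=> dchi df.
pose g (h : R) := f (h *: v + x).
have dg : derivable g 0 1 := (derivable1P f x v).1 df.
have g0 : g 0 = f x by rewrite /g scale0r add0r.
have gD : 'D_1 g 0 = 'D_v f x.
  exact: derive_along_line.
have dchi' : derivable chi (g 0) 1 by rewrite g0.
have H : is_derive (0:R) 1 (chi \o g) ('D_1 chi (g 0) * 'D_1 g 0).
  apply: is_derive1_comp; last exact: (derivableP dg).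
  exact: (derivableP dchi').
have d1 : derivable (chi \o f) x v by apply: (derivable1P (chi \o f) x v).2; case: H.
apply: DeriveDef => //.
rewrite -gD -g0; case: H => _ <-.
by rewrite -(derive_along_line (chi \o f) x v).
Qed.

(** A syntactic class closed under derivatives: sums, products, inverses and
    compositions cannot be proved smooth one at a time by [smooth_coind],
    because the derivative of a product is a sum of products. *)
Inductive smooth_expr (V : normedModType R) : (V -> R) -> Prop :=
| expr_smooth f : smooth f -> smooth_expr f
| expr_add f g : smooth_expr f -> smooth_expr g -> smooth_expr (fun x => f x + g x)
| expr_mul f g : smooth_expr f -> smooth_expr g -> smooth_expr (fun x => f x * g x)
| expr_inv f : smooth_expr f -> (forall x, f x != 0) -> smooth_expr (fun x => (f x)^-1)
| expr_comp chi f : smooth chi -> smooth_expr f -> smooth_expr (fun x => chi (f x)).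

Lemma smooth_expr_diff (V : normedModType R) (f : V -> R) : smooth_expr f ->
  [/\ continuous f, forall x v, derivable f x v & forall v, smooth_expr ('D_v f)].
Proof.
elim => {f}.
- move=> f sf; split; [exact: smooth_continuous|move=> *; exact: smooth_derivable|].
  by move=> v; apply/expr_smooth/smooth_derive.
- move=> f g gf [cf df Df] gg [cg dg Dg]; split.
  + by move=> x; apply: continuousD; [exact: cf|exact: cg].
  + by move=> x v; apply: (derivableD (df x v) (dg x v)).
  + move=> v; rewrite (_ : 'D_v _ = fun x => 'D_v f x + 'D_v g x); first exact: expr_add.
    by apply/funext => x; rewrite (deriveD (df x v) (dg x v)).
- move=> f g gf [cf df Df] gg [cg dg Dg]; split.
  + by move=> x; apply: continuousM; [exact: cf|exact: cg].
  + by move=> x v; apply: (derivableM (df x v) (dg x v)).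
  + move=> v; rewrite (_ : 'D_v _ = fun x => f x * 'D_v g x + g x * 'D_v f x).
      by apply: expr_add; apply: expr_mul.
    by apply/funext => x; rewrite (deriveM (df x v) (dg x v)).
- move=> f gf [cf df Df] f0; split.
  + by move=> x; apply: continuousV; [exact: f0|exact: cf].
  + by move=> x v; apply: derivableV.
  + move=> v; rewrite (_ : 'D_v _ = fun x => ((fun=> -1) x * ((f x)^-1 * (f x)^-1)) * 'D_v f x).
      apply: expr_mul => //; apply: expr_mul; first exact/expr_smooth/smooth_cst.
      by apply: expr_mul; apply: expr_inv.
    by apply/funext => x; rewrite deriveV// expr2 invfM mulN1r.
- move=> chi f schi gf [cf df Df]; split.
  + move=> x; apply: (@continuous_comp _ _ _ f chi); first exact: cf.
    exact: smooth_continuous.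
  + by move=> x v; case: (is_derive_dir_comp (@smooth_derivable _ _ (f x) 1 schi) (df x v)).
  + move=> v; rewrite (_ : 'D_v _ = fun x => ('D_1 chi) (f x) * 'D_v f x).
      have sd : smooth ('D_1 chi) by exact: smooth_derive.
      exact: (expr_mul (expr_comp sd gf) (Df v)).
    apply/funext => x.
    by case: (is_derive_dir_comp (@smooth_derivable _ _ (f x) 1 schi) (df x v)).
Qed.

Lemma smooth_expr_smooth (V : normedModType R) (f : V -> R) : smooth_expr f -> smooth f.
Proof.
apply: smooth_coind => {f} f; first by move=> /smooth_expr_diff[].
by move=> v /smooth_expr_diff[].
Qed.

Lemma smoothD (V : normedModType R) (f g : V -> R) : smooth f -> smooth g -> smooth (fun x => f x + g x).
Proof. by move=> sf sg; apply/smooth_expr_smooth/expr_add; exact: expr_smooth. Qed.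
Lemma smoothM (V : normedModType R) (f g : V -> R) : smooth f -> smooth g -> smooth (fun x => f x * g x).
Proof. by move=> sf sg; apply/smooth_expr_smooth/expr_mul; exact: expr_smooth. Qed.
Lemma smoothV (V : normedModType R) (f : V -> R) : smooth f -> (forall x, f x != 0) -> smooth (fun x => (f x)^-1).
Proof. by move=> sf f0; apply/smooth_expr_smooth/expr_inv => //; exact: expr_smooth. Qed.
Lemma smooth_comp (V : normedModType R) chi (f : V -> R) : smooth chi -> smooth f -> smooth (fun x => chi (f x)).
Proof. by move=> sc sf; apply/smooth_expr_smooth/expr_comp => //; exact: expr_smooth. Qed.
Lemma smoothN (V : normedModType R) (f : V -> R) : smooth f -> smooth (fun x => - f x).
Proof.
move=> sf; rewrite (_ : (fun _ => _) = fun x => (fun=> -1) x * f x).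
  by apply: smoothM => //; exact: smooth_cst.
by apply/funext => x; rewrite mulN1r.
Qed.
Lemma smooth_sum (V : normedModType R) I (s : seq I) (f : I -> V -> R) :
  (forall i, smooth (f i)) -> smooth (fun x => \sum_(i <- s) f i x).
Proof.
move=> sf; elim: s => [|i s IH].
  by rewrite (_ : (fun _ => _) = fun=> 0); [exact: smooth_cst|apply/funext => x; rewrite big_nil].
rewrite (_ : (fun _ => _) = fun x => f i x + \sum_(j <- s) f j x); last by apply/funext => x; rewrite big_cons.
by apply: smoothD.
Qed.
Lemma smooth_prod (V : normedModType R) I (s : seq I) (f : I -> V -> R) :
  (forall i, smooth (f i)) -> smooth (fun x => \prod_(i <- s) f i x).
Proof.
move=> sf; elim: s => [|i s IH].
  by rewrite (_ : (fun _ => _) = fun=> 1); [exact: smooth_cst|apply/funext => x; rewrite big_nil].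
rewrite (_ : (fun _ => _) = fun x => f i x * \prod_(j <- s) f j x); last by apply/funext => x; rewrite big_cons.
by apply: smoothM.
Qed.

(** [L] is the linear part of [A]. Stating the hypothesis on the single line
    used covers coordinates, projections, slices and dilations alike. *)
Lemma derive_affine (V W : normedModType R) (A L : V -> W) (f : W -> R) x v :
  (forall h : R, A (h *: v + x) = h *: L v + A x) ->
  (derivable f (A x) (L v) -> derivable (f \o A) x v) /\ 'D_v (f \o A) x = 'D_(L v) f (A x).
Proof.
move=> AL; suff E : (fun h : R => h^-1 *: ((f \o A \o shift x) (h *: v) - (f \o A) x)) =
    (fun h : R => h^-1 *: ((f \o shift (A x)) (h *: L v) - f (A x))).
  by rewrite /derivable /derive E.
by apply/funext => h /=; rewrite AL.
Qed.

Lemma smooth_affine (V W : normedModType R) (A L : V -> W) (f : W -> R) :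
  continuous A -> (forall (h : R) v x, A (h *: v + x) = h *: L v + A x) ->
  smooth f -> smooth (f \o A).
Proof.
move=> cA AL sf.
apply: (@smooth_coind V (fun g => exists2 f, smooth f & g = f \o A)); last by exists f.
- move=> _ [{sf}f sf ->]; split.
    by move=> x; apply: continuous_comp; [exact: cA|exact: smooth_continuous].
  move=> x v; apply: (derive_affine f (fun h => AL h v x)).1; exact: smooth_derivable.
- move=> _ v [{sf}f sf ->]; exists ('D_(L v) f); first exact: smooth_derive.
  apply/funext => x; exact: (derive_affine f (fun h => AL h v x)).2.
Qed.

Lemma smooth_id : smooth (fun x : R => x).
Proof.
apply: (@smooth_coind _ (fun f : R -> R => f = id \/ exists c, f = fun=> c)); last by left.
- move=> f [->|[{}c ->]]; split; [|exact: derivable_id|exact: cst_continuous|move=> *; exact: derivable_cst].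
  by move=> x; exact: cvg_id.
- move=> f v [->|[{}c ->]]; right.
    by exists v; apply/funext => x; exact: derive_id.
  by exists 0; apply/funext => x; exact: derive_cst.
Qed.

Lemma smooth_coord n (i : 'I_n) : smooth (fun x : 'rV[R]_n => x ord0 i).
Proof.
apply: (@smooth_affine _ _ (fun x : 'rV[R]_n => x ord0 i) (fun x => x ord0 i) (fun x : R => x)).
- exact: coord_continuous.
- by move=> h v x; rewrite !mxE.
- exact: smooth_id.
Qed.

Lemma derive_coord n (i : 'I_n) (x v : 'rV[R]_n) : 'D_v (fun x : 'rV[R]_n => x ord0 i) x = v ord0 i.
Proof.
rewrite (derive_affine (A := fun x : 'rV[R]_n => x ord0 i) (L := fun x => x ord0 i) (fun x : R => x) (x:=x) (v:=v) _).2.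
  by rewrite derive_id.
by move=> h; rewrite !mxE.
Qed.

Lemma smooth_col' n (f : 'rV[R]_n -> R) : smooth f -> smooth (fun x : 'rV[R]_n.+1 => f (col' ord_max x)).
Proof.
apply: (@smooth_affine _ _ (fun x : 'rV[R]_n.+1 => col' ord_max x) (fun x => col' ord_max x)).
- exact: continuous_col'.
- by move=> h v x; apply/rowP => i; rewrite !mxE.
Qed.

Lemma derive_col' n (f : 'rV[R]_n -> R) x v :
  'D_v (fun x : 'rV[R]_n.+1 => f (col' ord_max x)) x = 'D_(col' ord_max v) f (col' ord_max x).
Proof.
rewrite (derive_affine (A := fun x : 'rV[R]_n.+1 => col' ord_max x) (L := fun x => col' ord_max x) f (x:=x) (v:=v) _).2//.
by move=> h; apply/rowP => i; rewrite !mxE.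
Qed.

Lemma rcons_affine n (h : R) (v x : 'rV[R]_n) s t :
  rV_rcons (h *: v + x) (h * s + t) = h *: rV_rcons v s + rV_rcons x t.
Proof.
apply/rowP => i; rewrite 2!mxE; case: (unliftP ord_max i) => [j ->|->].
  by rewrite /= !mxE liftK.
by rewrite /= !mxE unlift_none.
Qed.

Lemma smooth_rcons_init n (f : 'rV[R]_n.+1 -> R) t : smooth f -> smooth (fun x : 'rV[R]_n => f (rV_rcons x t)).
Proof.
apply: (@smooth_affine _ _ (fun x : 'rV[R]_n => rV_rcons x t) (fun x => rV_rcons x 0)).
- exact: continuous_rcons_init.
- by move=> h v x; rewrite -rcons_affine mulr0 add0r.
Qed.

Lemma derive_rcons_init n (f : 'rV[R]_n.+1 -> R) t x v :
  'D_v (fun x : 'rV[R]_n => f (rV_rcons x t)) x = 'D_(rV_rcons v 0) f (rV_rcons x t).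
Proof.
rewrite (derive_affine (A := fun x : 'rV[R]_n => rV_rcons x t) (L := fun x => rV_rcons x 0) f (x:=x) (v:=v) _).2//.
by move=> h; rewrite -rcons_affine mulr0 add0r.
Qed.

Lemma smooth_rcons_last n (f : 'rV[R]_n.+1 -> R) x : smooth f -> smooth (fun t : R => f (rV_rcons x t)).
Proof.
apply: (@smooth_affine _ _ (fun t : R => rV_rcons x t) (fun s => rV_rcons 0 s)).
- exact: continuous_rcons_last.
- by move=> h v t; rewrite -rcons_affine scaler0 add0r.
Qed.

Lemma derive_rcons_last n (f : 'rV[R]_n.+1 -> R) x t v :
  'D_v (fun t : R => f (rV_rcons x t)) t = 'D_(rV_rcons 0 v) f (rV_rcons x t).
Proof.
rewrite (derive_affine (A := fun t : R => rV_rcons x t) (L := fun s => rV_rcons 0 s) f (x:=t) (v:=v) _).2//.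
by move=> h; rewrite -rcons_affine scaler0 add0r.
Qed.

Lemma rcons_delta_lift n (i : 'I_n) : rV_rcons (delta_mx ord0 i : 'rV[R]_n) 0 = delta_mx ord0 (lift ord_max i).
Proof.
apply/rowP => j; rewrite mxE; case: unliftP => [k ->|->] /=; rewrite !mxE/=.
  by rewrite (inj_eq lift_inj).
by rewrite (negbTE (neq_lift _ _)).
Qed.

Lemma rcons_delta_last n : rV_rcons (0 : 'rV[R]_n) 1 = delta_mx ord0 ord_max.
Proof.
apply/rowP => j; rewrite mxE; case: unliftP => [k ->|->] /=; rewrite !mxE/=.
  by rewrite eq_sym (negbTE (neq_lift _ _)).
by rewrite eqxx.
Qed.

End smooth_theory.

(** * A smooth step and test functions *)

Section bump.
Context {R : realType}.

(** The functions [t ^ -k * exp (- 1 / t)] of [t > 0]; their linear span is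
    closed under derivation. *)
Definition flat (k : nat) (t : R) : R := if 0 < t then t^-1 ^+ k * expR (- t^-1) else 0.

(** A Taylor term of the exponential beats the power of [1 / t]; the square on
    the right makes the derivative at 0 vanish. *)
Lemma flat_le k t : `|flat k t| <= (k.+2)`!%:R * t ^+ 2.
Proof.
rewrite /flat; case: ifPn => [t0|_]; last by rewrite normr0 mulr_ge0// sqr_ge0.
have s0 : 0 < t^-1 by rewrite invr_gt0.
rewrite ger0_norm; last by rewrite mulr_ge0 ?expR_ge0// exprn_ge0// ltW.
rewrite expRN ler_pdivrMr ?expR_gt0//.
have H := expR_ge1Dxn k.+1 (ltW s0).
have f0 : 0 < (k.+2)`!%:R :> R by rewrite ltr0n fact_gt0.
have {}H : t^-1 ^+ k.+2 / (k.+2)`!%:R <= expR t^-1 by apply: le_trans H; rewrite lerDr.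
rewrite ler_pdivrMr// in H.
have -> : t^-1 ^+ k = t^-1 ^+ k.+2 * t ^+ 2.
  rewrite -[k.+2]addn2 exprD -mulrA -exprMn mulVf ?expr1n ?mulr1//.
  by rewrite gt_eqF.
apply: le_trans (_ : (expR t^-1 * (k.+2)`!%:R) * t ^+ 2 <= _).
  by rewrite ler_wpM2r// sqr_ge0.
by rewrite le_eqVlt; apply/orP; left; apply/eqP; ring.
Qed.

Lemma is_derive_flat k (t : R) :
  is_derive t 1 (flat k) (- k%:R * flat k.+1 t + flat k.+2 t).
Proof.
have [t0|t0|->] := ltgtP t 0.
- have nt : \forall y \near t, (fun=> 0) y = flat k y.
    near=> y; rewrite /flat ifF//; apply/negbTE; rewrite -leNgt ltW//.
    by near: y; exact: lt_nbhsl.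
  apply: (near_eq_is_derive nt).
  rewrite /flat !ifF; try by apply/negbTE; rewrite -leNgt ltW.
  by rewrite mulr0 addr0; exact: is_derive_cst.
- have nt : \forall y \near t, (fun y : R => y^-1 ^+ k * expR (- y^-1)) y = flat k y.
    near=> y; rewrite /flat ifT//.
    by near: y; exact: lt_nbhsr.
  apply: (near_eq_is_derive nt).
  rewrite /flat t0.
  have tn0 : t != 0 by rewrite gt_eqF.
  have dV : is_derive t 1 (fun y : R => y^-1) (- t ^- 2).
    have := @is_deriveV R id t 1 1 tn0 (is_derive_id t 1).
    by move=> H; apply: (is_derive_eq H); rewrite scaler1 //= [_%:A]mulr1.
  have dX := is_deriveX k dV.
  have dE : is_derive t 1 (expR \o (fun y : R => - y^-1)) (expR (- t^-1) * (- - t ^- 2)).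
    have dN : is_derive t 1 (fun y : R => - y^-1) (- - t ^- 2) by exact: (is_deriveN dV).
    exact: (@is_derive1_comp R expR (fun y : R => - y^-1) t _ _ (is_derive_expR (- t^-1)) dN).
  rewrite (_ : (fun y : R => _) =
      ((fun y : R => y^-1) ^+ k : R -> R) * (expR \o (fun y : R => - y^-1))); last first.
    by apply/funext => y; rewrite mulrfctE exprfctE.
  have H := is_deriveM dX dE; apply: (is_derive_eq H) => /=.
  rewrite /GRing.scale /= exprfctE.
  rewrite -exprVn; move: (t^-1) (expR _) => s E.
  by case: k {nt dX H} => [|k] /=; rewrite !exprS !expr0; ring.
have f0 j : flat j 0 = 0 by rewrite /flat ltxx.
rewrite !f0 mulr0 addr0.
(* At 0 the difference quotient is squeezed by the quadratic bound. *)
have C : h^-1 *: ((flat k \o shift 0) (h *: 1) - flat k 0) @[h --> (0:R)^'] --> (0:R).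
  apply: (@squeeze_cvgr _ _ _ _ (fun h : R => - ((k.+2)`!%:R * `|h|)) (fun h => (k.+2)`!%:R * `|h|)).
  - near=> h; rewrite -ler_norml /= addr0 f0 subr0 [h%:A]mulr1 normrZ.
    have h0 : h != 0 by near: h; exact: nbhs_dnbhs_neq.
    have := flat_le k h; rewrite -[X in _ * X]real_normK ?num_real// => H.
    by rewrite normfV ler_pdivrMl ?normr_gt0// (le_trans H)// expr2 mulrCA.
  - rewrite -[X in _ --> X]oppr0; apply: cvgN; rewrite -[X in _ --> X](mulr0 (k.+2)`!%:R).
    apply: cvgMr; rewrite -[X in _ --> X](normr0 R); apply: cvg_norm; exact: nbhs_dnbhs.
  - rewrite -[X in _ --> X](mulr0 (k.+2)`!%:R).
    apply: cvgMr; rewrite -[X in _ --> X](normr0 R); apply: cvg_norm; exact: nbhs_dnbhs.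
apply: DeriveDef; first by apply/cvg_ex; exists 0.
exact/cvg_lim.
Unshelve. all: by end_near.
Qed.

(** Smoothness quantifies over all directions, also on the line. *)
Lemma derivable_dirR (f : R -> R) (x v : R) : derivable f x 1 ->
  derivable f x v /\ 'D_v f x = v * 'D_1 f x.
Proof.
move=> /derivable1_diffP df; split; first exact: diff_derivable.
by rewrite !deriveE// -[X in 'd f x X = _]mulr1 [LHS]linearZ.
Qed.

(** Not closed under products, but large enough to contain all derivatives of
    [flat 0]. *)
Inductive flat_span : (R -> R) -> Prop :=
| flat_base k : flat_span (flat k)
| flat_add f g : flat_span f -> flat_span g -> flat_span (fun x => f x + g x)
| flat_scale c f : flat_span f -> flat_span (fun x => c * f x).

Lemma flat_span_derive f : flat_span f ->
  exists2 df, flat_span df & forall x : R, is_derive x 1 f (df x).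
Proof.
elim => {f} [k|f g _ [df sf Df] _ [dg sg Dg]|c f _ [df sf Df]].
- exists (fun x => - k%:R * flat k.+1 x + flat k.+2 x); last exact: is_derive_flat.
  by apply: flat_add; [apply: flat_scale|]; apply: flat_base.
- exists (fun x => df x + dg x); first exact: flat_add.
  by move=> x; apply: (is_deriveD (Df x) (Dg x)).
- exists (fun x => c * df x); first exact: flat_scale.
  by move=> x; apply: (is_deriveZ c (Df x)).
Qed.

Lemma smooth_flat : smooth (flat 0).
Proof.
apply: (@smooth_coind _ _ flat_span); last exact: flat_base.
- move=> f /flat_span_derive[df _ Df]; split => [x|x v].
    by apply: differentiable_continuous; apply/derivable1_diffP; case: (Df x).
  by case: (Df x) => d1 _; exact: (derivable_dirR _ d1).1.
- move=> f v /flat_span_derive[df sf Df].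
  rewrite (_ : 'D_v f = fun x => v * df x); first exact: flat_scale.
  apply/funext => x; case: (Df x) => d1 dE.
  by rewrite (derivable_dirR v d1).2 dE.
Qed.

Definition step (t : R) : R := flat 0 t / (flat 0 t + flat 0 (1 - t)).

Lemma flat0_ge0 t : 0 <= flat 0 t.
Proof. by rewrite /flat expr0 mul1r; case: ifP => // _; exact: expR_ge0. Qed.

Lemma flat0_gt0 t : 0 < t -> 0 < flat 0 t.
Proof. by move=> t0; rewrite /flat t0 expr0 mul1r expR_gt0. Qed.

(** One of the two arguments is positive, since they add up to 1. *)
Lemma step_den t : 0 < flat 0 t + flat 0 (1 - t).
Proof.
have [t0|t0] := ltP 0 t.
  by rewrite ltr_pwDl ?flat0_ge0 ?flat0_gt0.
by rewrite ltr_wpDl ?flat0_ge0 ?flat0_gt0//; lra.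
Qed.

Lemma smooth_step : smooth step.
Proof.
have s1 : smooth (fun t : R => flat 0 (1 - t)).
  apply: smooth_comp; first exact: smooth_flat.
  by apply: smoothD; [exact: smooth_cst|apply: smoothN; exact: smooth_id].
apply: smoothM; first exact: smooth_flat.
apply: smoothV; last by move=> x; rewrite gt_eqF// step_den.
by apply: smoothD; [exact: smooth_flat|exact: s1].
Qed.

Lemma step_le0 t : t <= 0 -> step t = 0.
Proof. by move=> t0; rewrite /step {1}/flat ifF ?mul0r//; apply/negbTE; rewrite -leNgt. Qed.

Lemma step_ge1 t : 1 <= t -> step t = 1.
Proof.
move=> t1; rewrite /step (_ : flat 0 (1 - t) = 0).
  by rewrite addr0 divff// gt_eqF// flat0_gt0//; lra.
by rewrite /flat ifF//; apply/negbTE; rewrite -leNgt; lra.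
Qed.

Lemma step_ge0 t : 0 <= step t.
Proof. by rewrite /step divr_ge0 ?flat0_ge0// ltW// step_den. Qed.

Lemma step_le1 t : step t <= 1.
Proof. by rewrite /step ler_pdivrMr ?step_den// mul1r lerDl flat0_ge0. Qed.

(** Outside [0, 1] the step is locally constant. *)
Lemma derive_step_bounded : exists2 M, 0 <= M & forall t, `|'D_1 step t| <= M.
Proof.
have cD : continuous (fun t => `|'D_1 step t| : R).
  have sD : smooth ('D_1 step) by apply: smooth_derive; exact: smooth_step.
  by move=> t; apply: cvg_norm; exact: (smooth_continuous sD).
have [c _ Hc] := @EVT_max R (fun t => `|'D_1 step t|) 0 1 ler01 (continuous_subspaceT cD).
exists `|'D_1 step c|; first exact: normr_ge0.
move=> t.
have [t01|] := boolP (t \in `[0, 1]); first exact: Hc.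
rewrite in_itv/= negb_and -!ltNge => /orP[t0|t1].
  rewrite (@near_eq_derive _ _ _ step (fun=> 0)) ?derive_cst ?normr0//.
  by near=> y; apply: step_le0; rewrite ltW//; near: y; exact: lt_nbhsl.
rewrite (@near_eq_derive _ _ _ step (fun=> 1)) ?derive_cst ?normr0//.
by near=> y; apply: step_ge1; rewrite ltW//; near: y; exact: lt_nbhsr.
Unshelve. all: by end_near.
Qed.

End bump.

Section test_functions.
Context {R : realType} (V : normedModType R).

Lemma test_bounded (Om : set V) (phi : V -> R) : test_function Om phi ->
  exists M, forall x, `|phi x| <= M.
Proof.
move=> [sphi [K [cK KOm phiK]]].
have : compact (phi @` K).
  apply: continuous_compact => //; apply: continuous_subspaceT; exact: smooth_continuous.
move=> /compact_bounded[M [_ MP]].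
exists (Num.max 0 (M + 1)) => x.
have [Kx|nKx] := pselect (K x).
  apply: le_trans (MP (M + 1) _ _ _) _; first by rewrite ltrDl.
  - by exists x.
  - by rewrite le_max lexx orbT.
by rewrite phiK// normr0 le_max lexx.
Qed.

Lemma test_supp_derive (K : set V) (phi : V -> R) v : compact K ->
  (forall x, ~ K x -> phi x = 0) -> forall x, ~ K x -> 'D_v phi x = 0.
Proof.
move=> cK phiK x nKx.
rewrite (@near_eq_derive _ _ _ phi (fun=> 0)) ?derive_cst//.
have oK : open (~` K) by apply: closed_openC; apply: compact_closed => //; exact: norm_hausdorff.
have : nbhs x (~` K) by exact: open_nbhs_nbhs.
by apply: filterS => y; exact: phiK.
Qed.

Lemma test_derive (Om : set V) (phi : V -> R) v : test_function Om phi ->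
  test_function Om ('D_v phi).
Proof.
move=> [sphi [K [cK KOm phiK]]]; split; first exact: smooth_derive.
by exists K; split => //; exact: test_supp_derive.
Qed.

End test_functions.

(** * The fundamental lemma of the calculus of variations *)

Section integrable_util.
Context d (T : measurableType d) (R : realType) (mu : {measure set T -> \bar R}).

Lemma integrable_mulr_bounded (D : set T) (f h : T -> R) (M : R) : measurable D ->
  mu.-integrable D (EFin \o f) -> measurable_fun D h -> (forall x, D x -> `|h x| <= M) ->
  mu.-integrable D (fun x => (f x * h x)%:E).
Proof.
move=> mD fi mh hM.
apply: (@le_integrable _ _ _ mu D mD _ (fun x => (M%:E * (f x)%:E)%E)).
- apply/measurable_EFinP; apply: measurable_funM => //.
  by apply/measurable_EFinP; case/integrableP : fi.
- move=> x Dx /=; rewrite lee_fin !normrM mulrC ler_wpM2r//.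
  by apply: le_trans (hM x Dx) (ler_norm _).
- exact: integrableZl.
Qed.

End integrable_util.

Section box_bump.
Context {R : realType}.

(** Converges as [j] grows to the indicator function of ]l, r[, with support at
    distance [1 / (j + 1)] from the end points. *)
Definition ibump (l r : R) (j : nat) (t : R) : R :=
  step (j.+1%:R * (t - l) - 1) * step (j.+1%:R * (r - t) - 1).

Lemma smooth_ibump l r j : smooth (ibump l r j).
Proof.
have sl : smooth (fun t : R => j.+1%:R * (t - l) - 1).
  apply: smoothD; last exact: smooth_cst.
  apply: smoothM; first exact: smooth_cst.
  by apply: smoothD; [exact: smooth_id|exact: smooth_cst].
have sr : smooth (fun t : R => j.+1%:R * (r - t) - 1).
  apply: smoothD; last exact: smooth_cst.
  apply: smoothM; first exact: smooth_cst.
  apply: smoothD; first exact: smooth_cst.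
  apply: smoothN; exact: smooth_id.
exact: (smoothM (smooth_comp smooth_step sl) (smooth_comp smooth_step sr)).
Qed.

Lemma ibump_ge0 l r j t : 0 <= ibump l r j t.
Proof. by rewrite /ibump mulr_ge0 ?step_ge0. Qed.

Lemma ibump_le1 l r j t : ibump l r j t <= 1.
Proof. by rewrite /ibump mulr_ile1 ?step_ge0 ?step_le1. Qed.

Lemma ibump_supp l r j t : ~~ (l + j.+1%:R^-1 <= t <= r - j.+1%:R^-1) -> ibump l r j t = 0.
Proof.
have j0 : 0 < j.+1%:R :> R by [].
rewrite negb_and -!ltNge => /orP[H|H]; rewrite /ibump.
- rewrite [step _]step_le0 ?mul0r// subr_le0 -ler_pdivlMl// mulr1 lerBlDr; apply: ltW.
  by rewrite addrC.
- rewrite [X in _ * X]step_le0 ?mulr0// subr_le0 -ler_pdivlMl// mulr1 lerBlDr.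
  by rewrite ltW// addrC -ltrBlDr.
Qed.

Lemma ibump_eventually1 l r t : l < t < r -> \forall j \near \oo, ibump l r j t = 1.
Proof.
move=> /andP[lt tr].
have H (d : R) : 0 < d -> \forall j \near \oo, step (j.+1%:R * d - 1) = 1.
  move=> d0; near=> j; apply: step_ge1.
  rewrite lerBrDr -ler_pdivrMr// -natr1.
  have : (1 + 1) / d <= j%:R by near: j; exact: nbhs_infty_ger.
  by move=> /le_trans; apply; rewrite lerDl.
near=> j; rewrite /ibump (_ : step _ = 1) ?mul1r; near: j; apply: H; lra.
Unshelve. all: by end_near.
Qed.

Definition box_bump n (l r : 'I_n -> R) (j : nat) (x : 'rV[R]_n) : R :=
  \prod_i ibump (l i) (r i) j (x ord0 i).

Lemma box_bump_ge0 n (l r : 'I_n -> R) j x : 0 <= box_bump l r j x.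
Proof. by apply: prodr_ge0 => i _; exact: ibump_ge0. Qed.

Lemma box_bump_le1 n (l r : 'I_n -> R) j x : box_bump l r j x <= 1.
Proof. by apply: prodr_ile1 => i _; rewrite ibump_ge0 ibump_le1. Qed.

Lemma box_bump_out n (l r : 'I_n -> R) j x : ~ rV_box l r x -> box_bump l r j x = 0.
Proof.
move=> nx; apply: contrapT => /eqP/prodf_neq0 H; apply: nx => i.
have := H i isT; apply: contra_neqT => lr.
apply: ibump_supp; apply: contra lr => /andP[lx xr].
have j0 : 0 < j.+1%:R^-1 :> R by rewrite invr_gt0.
apply/andP; split; first by apply: lt_le_trans lx; rewrite ltrDl.
by apply: le_lt_trans xr _; rewrite gtrBl.
Qed.

Lemma box_bump_cvg n (l r : 'I_n -> R) x : rV_box l r x -> \forall j \near \oo, box_bump l r j x = 1.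
Proof.
move=> xb.
have : \forall j \near \oo, forall i, ibump (l i) (r i) j (x ord0 i) = 1.
  by apply: filter_forall => i; exact: ibump_eventually1.
by apply: filterS => j H; rewrite /box_bump big1.
Qed.

Lemma test_box_bump n (Om : set 'rV[R]_n) (l r : 'I_n -> R) j : rV_box l r `<=` Om ->
  test_function Om (box_bump l r j).
Proof.
move=> lrOm; split.
  apply: smooth_prod => i; apply: smooth_comp; [exact: smooth_ibump|exact: smooth_coord].
have j0 : 0 < j.+1%:R^-1 :> R by rewrite invr_gt0.
exists [set x : 'rV[R]_n | forall i, `[l i + j.+1%:R^-1, r i - j.+1%:R^-1]%classic (x ord0 i)]; split.
- apply: (@rV_compact _ n (fun i => `[l i + j.+1%:R^-1, r i - j.+1%:R^-1]%classic)) => i; exact: segment_compact.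
- move=> x /= H; apply: lrOm => i; have := H i; rewrite in_itv/= => /andP[lx xr].
  apply/andP; split; first by apply: lt_le_trans lx; rewrite ltrDl.
  by apply: le_lt_trans xr _; rewrite gtrBl.
- move=> x /= H; apply: contrapT => /eqP/prodf_neq0 K; apply: H => i.
  have := K i isT; rewrite in_itv/=; apply: contra_neqT.
  exact: ibump_supp.
Qed.

End box_bump.

Section fundamental.
Context {R : realType} (n : nat).
Local Notation mu := (@lebesgue_rV R n).

Definition boxes : set (set 'rV[R]_n) := [set A | exists l r, A = rV_box l r].

(** A half space is a countable union of open boxes. *)
Lemma measurable_boxesE : (@measurable _ 'rV[R]_n) = <<s boxes >>.
Proof.
apply/seteqP; split; last first.
  apply: smallest_sub; first exact: sigma_algebra_measurable.
  by move=> _ [l [r ->]]; exact: measurable_rV_box.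
have mid : measurable_fun setT (fun x : g_sigma_algebraType boxes => x : 'rV[R]_n).
  apply: measurable_fun_rVP => i.
  apply: (measurability _ (RGenOInfty.measurableE R)) => _ [_ [a ->] <-].
  rewrite setTI (_ : _ @^-1` _ = \bigcup_k (rV_box (fun j : 'I_n => if j == i then a else - k%:R) (fun=> k%:R))).
    apply: bigcupT_measurable => k; apply: sub_sigma_algebra.
    by exists (fun j : 'I_n => if j == i then a else - k%:R), (fun=> k%:R).
  apply/seteqP; split => [x /=|x [k _ /(_ i)]]; last first.
    by rewrite eqxx /= in_itv/= => /andP[-> _].
  rewrite in_itv/= andbT => ax.
  exists (Num.truncn (\sum_i `|x ord0 i|)).+1 => // j.
  have : `|x ord0 j| < (Num.truncn (\sum_i `|x ord0 i|)).+1%:R.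
    apply: (le_lt_trans _ (truncnS_gt _)).
    by rewrite (bigD1 j)//= lerDl sumr_ge0.
  rewrite ltr_norml => /andP[H1 H2]; rewrite H2 andbT.
  by case: eqP => [->|_].
by move=> A mA; have := mid measurableT A mA; rewrite setTI.
Qed.

Lemma boxes_setI : setI_closed boxes.
Proof.
move=> _ _ [l1 [r1 ->]] [l2 [r2 ->]].
exists (fun i => Num.max (l1 i) (l2 i)), (fun i => Num.min (r1 i) (r2 i)).
apply/seteqP; split => [x [H1 H2] i|x H]; last split => i.
- by rewrite gt_max lt_min; have /andP[-> ->] := H1 i; have /andP[-> ->] := H2 i.
- by have := H i; rewrite gt_max lt_min => /andP[/andP[-> _] /andP[-> _]].
- by have := H i; rewrite gt_max lt_min => /andP[/andP[_ ->] /andP[_ ->]].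
Qed.

Variables (Om : set 'rV[R]_n) (f : 'rV[R]_n -> R).
Hypothesis oOm : open Om.
Hypothesis fi : mu.-integrable Om (EFin \o f).
Hypothesis f0 : forall phi, test_function Om phi -> \int[mu]_(x in Om) (f x * phi x) = 0.

Let mOm : measurable Om. Proof. exact: open_measurable_rV. Qed.

Lemma integrable_test phi : test_function Om phi -> mu.-integrable Om (fun x => (f x * phi x)%:E).
Proof.
move=> tphi; have [M phiM] := test_bounded tphi.
have mphi : measurable_fun Om phi.
  by apply: measurable_funTS; apply: continuous_measurable_rV; exact: (smooth_continuous tphi.1).
by apply: (integrable_mulr_bounded mOm fi mphi (M := M)) => x _; exact: phiM.
Qed.

(** Products of one-dimensional bumps converge to the indicator function of the
    box. *)
Lemma box_integral0 l r : rV_box l r `<=` Om -> (\int[mu]_(x in rV_box l r) (f x)%:E = 0)%E.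
Proof.
move=> lrOm.
have t j := test_box_bump j lrOm.
have mf : measurable_fun Om f by apply/measurable_EFinP; case/integrableP : fi.
have [|||||_ _ H] := @dominated_convergence _ _ _ mu Om mOm
  (fun j x => (f x * box_bump l r j x)%:E) ((EFin \o f) \_ (rV_box l r)) (fun x => `|(f x)%:E|%E).
- by move=> j; case/integrableP : (integrable_test (t j)).
- apply/(measurable_restrict (EFin \o f) (measurable_rV_box l r) mOm).
  apply: (measurable_funS mOm (@subIsetl _ _ _)); exact/measurable_EFinP.
- apply: aeW => x Ox; rewrite patchE; case: ifPn => [/set_mem xb|/negP xb].
    apply: cvg_near_cst; have := box_bump_cvg xb; apply: filterS => j ->.
    by rewrite mulr1.
  apply: cvg_near_cst; near=> j; rewrite box_bump_out ?mulr0//.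
  by move=> xb'; apply: xb; exact/mem_set.
- exact: (integrable_abse fi).
- apply: aeW => x j Ox; rewrite /= lee_fin normrM [X in _ * X]ger0_norm ?box_bump_ge0//.
  by rewrite ler_piMr// box_bump_le1.
have E j : (\int[mu]_(x in Om) (f x * box_bump l r j x)%:E = 0)%E.
  have := f0 (t j); rewrite /Rintegral => H0.
  by rewrite -[LHS]fineK ?H0// integrable_fin_num//; exact: (integrable_test (t j)).
have : (\int[mu]_(x in Om) ((EFin \o f) \_ (rV_box l r)) x = 0)%E.
  apply/esym; apply: (cvg_unique _ _ H) => //.
  by rewrite (_ : [sequence _]_j = cst 0%E); [exact: cvg_cst|apply/funext => j; exact: E].
by rewrite -integral_mkcondr setIidr.
Unshelve. all: by end_near.
Qed.

(** Boxes are stable under intersection and generate the measurable sets, so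
    that the integral of [f] vanishes on all measurable subsets of the box. *)
Lemma fundamental_lemma_box l r : rV_box l r `<=` Om -> ae_eq mu (rV_box l r) f (cst 0).
Proof.
move=> lrOm; set Q := rV_box l r.
have mQ : measurable Q by exact: measurable_rV_box.
have fQ : mu.-integrable Q (EFin \o f) by apply: integrableS fi.
have P S : measurable S -> (\int[mu]_(x in Q `&` S) (f x)%:E = 0)%E.
  rewrite measurable_boxesE; move: S.
  apply: (@dynkin_induction _ _ boxes (fun S => (\int[mu]_(x in Q `&` S) (f x)%:E = 0)%E)).
  - exact: measurable_boxesE.
  - exact: boxes_setI.
  - by rewrite setIT; exact: box_integral0.
  - move=> B bB; have [] : boxes (Q `&` B) by apply: boxes_setI => //; exists l, r.
    move=> l' [r' E]; rewrite E; apply: box_integral0; rewrite -E.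
    by apply: subset_trans lrOm; exact: subIsetl.
  - move=> S mS S0.
    have := box_integral0 lrOm; rewrite -/Q -{1}(setIT Q) -(setUv S) setIUr integral_setU.
    - by rewrite S0 add0e.
    - exact: measurableI.
    - by apply: measurableI => //; exact: measurableC.
    - rewrite -setIUr setUv setIT; by case/integrableP : fQ.
    - by apply/disj_setPS => x [[_ Sx] [_ nSx]].
  - move=> F mF tF F0; rewrite setI_bigcupr integral_bigcup//.
    + by rewrite eseries0// => i _ _; exact: F0.
    + by apply: trivIset_setIl.
    + by move=> k; exact: measurableI.
    + rewrite -setI_bigcupr; apply: integrableS fQ => //.
      by apply: measurableI => //; exact: bigcupT_measurable.
have H : ae_eq mu Q (EFin \o f) (cst 0%E).
  apply: (integral_ae_eq mQ fQ); first exact: measurable_cst.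
  by move=> E EQ mE; rewrite integral0 -(setIidr EQ) P.
by apply: filterS H => x H /H[].
Qed.

Lemma fundamental_lemma : ae_eq mu Om f (cst 0).
Proof.
pose Q (q : 'rV[rat]_n * nat) : set 'rV[R]_n := rV_box (fun i => ratr (q.1 ord0 i) - q.2.+1%:R^-1)
               (fun i => ratr (q.1 ord0 i) + q.2.+1%:R^-1).
(* Countably many boxes cover the domain, each with a negligible exceptional
   set. *)
pose F k := if unpickle k is Some q then [set x | `[< Q q `<=` Om >] /\ Q q x /\ f x != 0] else set0.
have nF k : mu.-negligible (F k).
  rewrite /F; case: unpickle => [q|]; last exact: negligible_set0.
  have [qO|qO] := asboolP (Q q `<=` Om); last first.
    by apply: negligibleS (negligible_set0 mu) => x [].
  have := fundamental_lemma_box qO; apply: negligibleS => x /= [_ [Qx fx]] H.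
  by move/eqP: fx; apply; exact: H.
apply: negligibleS (negligible_bigcup nF) => x /= H.
have [Ox fx] : Om x /\ f x != 0.
  by apply: contrapT => K; apply: H => Ox; apply/eqP; apply: contrapT => /negP fx; apply: K.
have := Ox; rewrite {1}(rV_open_countable_box oOm) => -[q qO Qx].
exists (pickle q) => //; rewrite /F pickleK; split; [exact/asboolP|by []].
Qed.

End fundamental.

Section Lp_facts.
Context {R : realType} (n : nat).
Local Notation mu := (@lebesgue_rV R n).
Implicit Types (Om : set 'rV[R]_n) (p : R) (u : 'rV[R]_n -> R).

(** The definition of [Lp] goes through the restriction by zero and its L^p
    norm; every later use needs only measurability and a finite integral. *)
Lemma LpP Om p u : measurable Om -> 0 < p ->
  Lp Om p u <-> measurable_fun Om u /\ (\int[mu]_(x in Om) (`|u x| `^ p)%:E < +oo)%E.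
Proof.
move=> mOm p0.
have pn0 : p != 0 by rewrite gt_eqF.
have E : (\int[mu]_x (`|(EFin \o (u \_ Om)) x| `^ p) = \int[mu]_(x in Om) (`|u x| `^ p)%:E)%E.
  rewrite [RHS]integral_mkcond; apply: eq_integral => x _; rewrite /= !patchE.
  by case: ifP => _ //=; rewrite normr0 powR0.
rewrite /Lp /=; split.
  rewrite inE /= => /andP[]; rewrite inE/= => mu'; rewrite inE /= /finite_norm => nu.
  split; first by apply/(measurable_restrictT _ mOm).
  by rewrite -E -powR_Lnorm// poweR_lty.
move=> [mu' iu]; rewrite inE /=; apply/andP; split; rewrite inE /=.
  by apply/(measurable_restrictT _ mOm).
rewrite /finite_norm; apply: (lty_poweRy pn0).
by have := powR_Lnorm mu (EFin \o (u \_ Om)) pn0; rewrite E => ->.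
Qed.

Lemma powR_ge_lin (p a : R) : 1 <= p -> 0 <= a -> a <= 1 + a `^ p.
Proof.
move=> p1 a0; have [a1|a1] := leP a 1.
  by apply: le_trans a1 _; rewrite lerDl powR_ge0.
apply: (@le_trans _ _ (a `^ p)); last by rewrite lerDr.
by rewrite -{1}(powRr1 a0) ler_powR// ltW.
Qed.

Lemma Lp_integrable Om p u : measurable Om -> (mu Om < +oo)%E -> 1 <= p ->
  Lp Om p u -> mu.-integrable Om (EFin \o u).
Proof.
move=> mOm fOm p1 /(LpP _ mOm (lt_le_trans ltr01 p1))[mu' iu].
apply/integrableP; split; first exact/measurable_EFinP.
have mp : measurable_fun Om (fun x => (`|u x| `^ p)%:E).
  apply/measurable_EFinP; apply: (measurableT_comp (measurable_powR p)); exact: measurableT_comp.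
apply: (@le_lt_trans _ _ (\int[mu]_(x in Om) ((1:R)%:E + (`|u x| `^ p)%:E))%E).
  apply: ge0_le_integral => //.
  - by apply/measurable_EFinP; exact: measurableT_comp.
  - exact: emeasurable_funD.
  - by move=> x Ox; rewrite /= lee_fin powR_ge_lin.
rewrite ge0_integralD//.
by rewrite integral_cst// mul1e lte_add_pinfty.
Qed.

(** [grad] is an arbitrary weak gradient, so energies are computed through any
    other one. *)
Lemma weak_gradient_unique Om p u w1 w2 : open Om -> (mu Om < +oo)%E -> 1 <= p ->
  weak_gradient Om p u w1 -> weak_gradient Om p u w2 -> ae_eq mu Om w1 w2.
Proof.
move=> oOm fOm p1 W1 W2.
have mOm : measurable Om by exact: open_measurable_rV.
have H i : ae_eq mu Om (fun x => w1 x ord0 i - w2 x ord0 i) (cst 0).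
  have [l1 d1] := W1 i; have [l2 d2] := W2 i.
  have i1 := Lp_integrable mOm fOm p1 l1; have i2 := Lp_integrable mOm fOm p1 l2.
  apply: fundamental_lemma => //.
    exact: (integrableB mOm i1 i2).
  move=> phi tphi; have := d1 _ tphi; rewrite (d2 _ tphi) => /oppr_inj E.
  under eq_Rintegral do rewrite mulrBl.
  rewrite RintegralB//; first by rewrite E subrr.
    exact: (integrable_test oOm i1 tphi).
  exact: (integrable_test oOm i2 tphi).
have : \forall x \ae mu, forall i, Om x -> w1 x ord0 i - w2 x ord0 i = 0.
  by apply: filter_forall => i; exact: H.
apply: filterS => x Hx Ox; apply/rowP => i; apply/eqP; rewrite -subr_eq0; apply/eqP.
exact: Hx.
Qed.

End Lp_facts.

(** * Semi-inner product spaces and step functions *)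

Lemma indic_integrable d (T : measurableType d) (R : realType) (mu : {measure set T -> \bar R})
    (A D : set T) : measurable D -> measurable A -> (mu A < +oo)%E ->
  mu.-integrable D (fun x => (\1_A x : R)%:E).
Proof.
move=> mD mA fA; apply/integrableP; split.
  by apply/measurable_EFinP; apply: measurable_funTS; exact: measurable_indic.
under eq_integral do rewrite gee0_abs ?lee_fin//.
rewrite integral_indic//; apply: le_lt_trans fA.
by apply: le_measure; rewrite ?inE//; exact: measurableI.
Qed.

Section hilbert.
Context {R : realType} (X : ipSpace R) (HX : is_hilbert X).
Local Notation mem := (ip_mem X).

Lemma mem0 : mem 0. Proof. by case: HX => [[]]. Qed.
Lemma memZD (a : R) u v : mem u -> mem v -> mem (a *: u + v).
Proof. by case: HX => [[_ H] _ _ _ _]; exact: H. Qed.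
Lemma memD u v : mem u -> mem v -> mem (u + v).
Proof. by move=> mu mv; rewrite -[u]scale1r; exact: memZD. Qed.
Lemma memZ (a : R) u : mem u -> mem (a *: u).
Proof. by move=> mu; rewrite -[_ *: _]addr0; apply: memZD => //; exact: mem0. Qed.
Lemma memN u : mem u -> mem (- u).
Proof. by move=> mu; rewrite -scaleN1r; exact: memZ. Qed.
Lemma memB u v : mem u -> mem v -> mem (u - v).
Proof. by move=> mu mv; apply: memD => //; exact: memN. Qed.
Lemma mem_sum I (s : seq I) (f : I -> X) : (forall i, mem (f i)) -> mem (\sum_(i <- s) f i).
Proof.
move=> mf; elim: s => [|i s IH]; first by rewrite big_nil; exact: mem0.
by rewrite big_cons; apply: memD.
Qed.

Lemma ipC u v : mem u -> mem v -> ip X u v = ip X v u.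
Proof. by case: HX => _ H _ _ _; exact: H. Qed.
Lemma ipZDl (a : R) u v w : mem u -> mem v -> mem w ->
  ip X (a *: u + v) w = a * ip X u w + ip X v w.
Proof. by case: HX => _ _ H _ _; exact: H. Qed.
Lemma ip_ge0 u : mem u -> 0 <= ip X u u.
Proof. by case: HX => _ _ _ H _; exact: H. Qed.
Lemma ipDl u v w : mem u -> mem v -> mem w -> ip X (u + v) w = ip X u w + ip X v w.
Proof. by move=> mu mv mw; rewrite -{1}[u]scale1r ipZDl// mul1r. Qed.
Lemma ip0l w : mem w -> ip X 0 w = 0.
Proof.
move=> mw; have := ipDl mem0 mem0 mw; rewrite addr0 => /esym/eqP.
by rewrite -subr_eq0 addrK => /eqP.
Qed.
Lemma ipZl (a : R) u w : mem u -> mem w -> ip X (a *: u) w = a * ip X u w.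
Proof.
by move=> mu mw; rewrite -[a *: u]addr0 ipZDl// ?ip0l ?addr0//; exact: mem0.
Qed.
Lemma ipNl u w : mem u -> mem w -> ip X (- u) w = - ip X u w.
Proof. by move=> mu mw; rewrite -scaleN1r ipZl// mulN1r. Qed.
Lemma ipBl u v w : mem u -> mem v -> mem w -> ip X (u - v) w = ip X u w - ip X v w.
Proof. by move=> mu mv mw; rewrite ipDl ?ipNl//; exact: memN. Qed.
Lemma ipDr u v w : mem u -> mem v -> mem w -> ip X w (u + v) = ip X w u + ip X w v.
Proof. by move=> mu mv mw; rewrite ipC ?ipDl//; [congr (_ + _); exact: ipC|exact: memD]. Qed.
Lemma ipZr (a : R) u w : mem u -> mem w -> ip X w (a *: u) = a * ip X w u.
Proof. by move=> mu mw; rewrite ipC ?ipZl//; [congr (_ * _); exact: ipC|exact: memZ]. Qed.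
Lemma ipNr u w : mem u -> mem w -> ip X w (- u) = - ip X w u.
Proof. by move=> mu mw; rewrite -scaleN1r ipZr// mulN1r. Qed.
Lemma ipBr u v w : mem u -> mem v -> mem w -> ip X w (u - v) = ip X w u - ip X w v.
Proof. by move=> mu mv mw; rewrite ipDr ?ipNr//; exact: memN. Qed.

Lemma ip_suml I (s : seq I) (f : I -> X) w : (forall i, mem (f i)) -> mem w ->
  ip X (\sum_(i <- s) f i) w = \sum_(i <- s) ip X (f i) w.
Proof.
move=> mf mw; elim: s => [|i s IH]; first by rewrite !big_nil ip0l.
by rewrite !big_cons ipDl ?IH//; exact: mem_sum.
Qed.

Lemma ipnorm_ge0 (u : X) : 0 <= ipnorm u. Proof. exact: sqrtr_ge0. Qed.
Lemma ipnorm_sqr u : mem u -> ipnorm u ^+ 2 = ip X u u.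
Proof. by move=> mu; rewrite sqr_sqrtr// ip_ge0. Qed.

Lemma ip_sqrD u v : mem u -> mem v ->
  ip X (u + v) (u + v) = ip X u u + 2 * ip X u v + ip X v v.
Proof.
move=> mu mv; have muv := memD mu mv.
by rewrite ipDl// !ipDr// (ipC mv mu); ring.
Qed.
Lemma ip_sqrB u v : mem u -> mem v ->
  ip X (u - v) (u - v) = ip X u u - 2 * ip X u v + ip X v v.
Proof.
move=> mu mv; rewrite ip_sqrD//; last exact: memN.
by rewrite !ipNr ?ipNl//; [ring|exact: memN].
Qed.

(** The form is only semidefinite: when [(u, u) = 0] the usual optimal
    parameter does not exist, and letting the parameter be large in the right
    direction shows [(u, v) = 0]. *)
Lemma cauchy_schwarz u v : mem u -> mem v -> `|ip X u v| <= ipnorm u * ipnorm v.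
Proof.
move=> mu mv.
rewrite -(ler_pXn2r (n := 2)) ?nnegrE ?mulr_ge0 ?ipnorm_ge0//.
rewrite exprMn !ipnorm_sqr// real_normK ?num_real//.
have H (a : R) : 0 <= a ^+ 2 * ip X u u + 2 * a * ip X u v + ip X v v.
  have := ip_ge0 (memZD a mu mv).
  have mau := memZ a mu.
  rewrite ip_sqrD// !ipZl// ipZr//.
  by move=> /le_trans; apply; rewrite le_eqVlt; apply/orP; left; apply/eqP; ring.
(* The parameter is chosen so that the quadratic polynomial takes the value -1.
   *)
have [u0|u0] := eqVneq (ip X u u) 0.
  rewrite u0 mul0r; have [->|b0] := eqVneq (ip X u v) 0; first by rewrite expr0n.
  have := H (- (ip X v v + 1) / (2 * ip X u v)).
  rewrite u0 mulr0 add0r.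
  have -> : 2 * (- (ip X v v + 1) / (2 * ip X u v)) * ip X u v = - (ip X v v + 1).
    by field.
  by rewrite opprD addrC addrA addrN add0r ler0N1.
have u1 : 0 < ip X u u by rewrite lt_def u0 ip_ge0.
have := H (- ip X u v / ip X u u) => {}H.
have {H} : 0 <= ip X u u * ((- ip X u v / ip X u u) ^+ 2 * ip X u u +
    2 * (- ip X u v / ip X u u) * ip X u v + ip X v v) by rewrite mulr_ge0// ltW.
rewrite (_ : _ * _ = ip X u u * ip X v v - ip X u v ^+ 2); last by field.
by rewrite subr_ge0.
Qed.

Lemma ipnormD u v : mem u -> mem v -> ipnorm (u + v) <= ipnorm u + ipnorm v.
Proof.
move=> mu mv; rewrite -(ler_pXn2r (n := 2)) ?nnegrE ?addr_ge0 ?ipnorm_ge0//.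
rewrite ipnorm_sqr; last exact: memD.
rewrite ip_sqrD// sqrrD !ipnorm_sqr// lerD2r lerD2l -[_ * _ *+ 2]mulr_natl ler_pM2l//.
exact: le_trans (ler_norm _) (cauchy_schwarz mu mv).
Qed.
Lemma ipnormZ (a : R) u : mem u -> ipnorm (a *: u) = `|a| * ipnorm u.
Proof.
move=> mu; apply/eqP; rewrite -(eqrXn2 (n := 2)) ?mulr_ge0 ?ipnorm_ge0//.
have mau := memZ a mu.
rewrite exprMn !ipnorm_sqr// ipZl// ipZr// real_normK ?num_real//.
by apply/eqP; ring.
Qed.
Lemma ipnormN u : mem u -> ipnorm (- u) = ipnorm u.
Proof. by move=> mu; rewrite -scaleN1r ipnormZ// normrN1 mul1r. Qed.
Lemma ipnormC u v : mem u -> mem v -> ipnorm (u - v) = ipnorm (v - u).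
Proof. by move=> mu mv; rewrite -ipnormN ?opprB//; exact: memB. Qed.
Lemma ipnormB u v : mem u -> mem v -> ipnorm (u - v) <= ipnorm u + ipnorm v.
Proof. by move=> mu mv; rewrite -(ipnormN mv); apply: ipnormD => //; exact: memN. Qed.
Lemma ipnorm_dist u v : mem u -> mem v -> `|ipnorm u - ipnorm v| <= ipnorm (u - v).
Proof.
move=> mu mv; rewrite ler_norml; apply/andP; split.
  rewrite lerBrDr addrC lerBlDl (ipnormC mu mv).
  by have := ipnormD mu (memB mv mu); rewrite addrC subrK addrC.
by rewrite lerBlDl; have := ipnormD mv (memB mu mv); rewrite addrC subrK.
Qed.

Lemma mem_step (s : stepFun X) t : mem (step_fun s t).
Proof. by apply: mem_sum => i; apply: memZ; exact: step_valP. Qed.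

Lemma ip_stepE (s : stepFun X) z t : mem z ->
  ip X (step_fun s t) z = \sum_i (\1_(@step_set _ _ s i) t : R) * ip X (step_val i) z.
Proof.
move=> mz; rewrite ip_suml//; last by move=> i; apply: memZ; exact: step_valP.
by apply: eq_bigr => i _; rewrite ipZl//; exact: step_valP.
Qed.

(** A crude bound of the norm of all values, uniform in time. *)
Definition step_bound (s : stepFun X) : R := \sum_i ipnorm (@step_val _ _ s i).

Lemma step_bound_ge0 s : 0 <= step_bound s.
Proof. by apply: sumr_ge0 => i _; exact: ipnorm_ge0. Qed.

Lemma ip_step_le (s : stepFun X) z t : mem z -> `|ip X (step_fun s t) z| <= step_bound s * ipnorm z.
Proof.
move=> mz; rewrite ip_stepE// mulr_suml; apply: le_trans (ler_norm_sum _ _ _) _.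
apply: ler_sum => i _; rewrite normrM ger0_norm; last by rewrite indicE; case: (_ \in _).
apply: le_trans (_ : `|ip X (step_val i) z| <= _).
  by rewrite ler_piMl// indicE; case: (_ \in _).
by apply: cauchy_schwarz => //; exact: step_valP.
Qed.

Lemma measurable_ip_step (s : stepFun X) (D : set (measurableTypeR R)) (z : R -> X) :
  measurable D -> (forall t, D t -> mem (z t)) ->
  (forall y, mem y -> measurable_fun D (fun t => ip X y (z t))) ->
  measurable_fun D (fun t => ip X (step_fun s t) (z t)).
Proof.
move=> mD mz mip.
apply: (eq_measurable_fun (fun t => \sum_i (\1_(@step_set _ _ s i) t : R) * ip X (step_val i) (z t))).
  by move=> t /set_mem Dt; rewrite ip_stepE//; exact: mz.
apply: measurable_sum => i; apply: measurable_funM.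
  apply: measurable_funTS; apply: measurable_indic; exact: (step_setP i).1.
by apply: mip; exact: step_valP.
Qed.

Lemma ip_step_integral (s : stepFun X) (D : set (measurableTypeR R)) z :
  measurable D -> mem z ->
  ip X (step_integral D s) z = \int[lebesgue_measure]_(t in D) ip X (step_fun s t) z.
Proof.
move=> mD mz; rewrite ip_suml//; last by move=> i; apply: memZ; exact: step_valP.
under eq_Rintegral do rewrite ip_stepE//.
have I i : (@lebesgue_measure R).-integrable D (EFin \o (fun t => (\1_(@step_set _ _ s i) t : R) * ip X (step_val i) z)).
  rewrite (_ : EFin \o _ = (fun t => ((\1_(@step_set _ _ s i) t : R)%:E * (ip X (step_val i) z)%:E)%E)); last by [].
  by apply: integrableZr => //; have [? ?] := @step_setP _ _ s i; exact: indic_integrable.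
rewrite /Rintegral (_ : (fun t => _) = (fun t => \sum_i ((\1_(@step_set _ _ s i) t : R) * ip X (step_val i) z)%:E)%E); last first.
  by apply/funext => t; rewrite sumEFin.
rewrite integral_sum//=.
rewrite [X in fine X](_ : _ = (\sum_i (ip X (fine (lebesgue_measure (@step_set _ _ s i `&` D)) *: step_val i) z)%:E)%E).
  by rewrite sumEFin.
apply: eq_bigr => i _; rewrite ipZl//; last exact: step_valP.
have [mA fA] := @step_setP _ _ s i.
under eq_integral do rewrite EFinM.
rewrite integralZr//; last exact: indic_integrable.
rewrite integral_indic// EFinM fineK//.
by rewrite ge0_fin_numE// (le_lt_trans _ fA)//; apply: le_measure; rewrite ?inE//; exact: measurableI.
Qed.

End hilbert.

(** * Curves with a weak derivative *)

Lemma bounded_integrable d (T : measurableType d) (R : realType) (mu : {measure set T -> \bar R})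
  (D : set T) (f : T -> R) (M : R) : measurable D -> (mu D < +oo)%E ->
  measurable_fun D f -> (forall x, D x -> `|f x| <= M) -> mu.-integrable D (EFin \o f).
Proof.
move=> mD fD mf fM; apply: measurable_bounded_integrable => //.
exists M; split; first exact: num_real.
by move=> r Mr x Dx; apply: le_trans (fM x Dx) (ltW Mr).
Qed.

Lemma cst_integrable d (T : measurableType d) (R : realType) (mu : {measure set T -> \bar R})
  (D : set T) (c : R) : measurable D -> (mu D < +oo)%E -> mu.-integrable D (fun=> c%:E).
Proof.
move=> mD fD; apply: (@bounded_integrable _ _ R mu D (cst c) `|c| mD fD (measurable_cst _)) => x _.
exact: lexx.
Qed.

Lemma dominated_Rintegral d (T : measurableType d) (R : realType) (mu : {measure set T -> \bar R})
  (D : set T) (f_ : nat -> T -> R) (f g : T -> R) : measurable D ->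
  (forall j, measurable_fun D (f_ j)) -> measurable_fun D f ->
  {ae mu, forall x, D x -> f_ j x @[j --> \oo] --> f x} ->
  mu.-integrable D (EFin \o g) -> (forall j x, D x -> `|f_ j x| <= g x) ->
  \int[mu]_(x in D) f_ j x @[j --> \oo] --> \int[mu]_(x in D) f x.
Proof.
move=> mD mf_ mf cf ig fg.
have [||||if_ _ H] := @dominated_convergence _ _ _ mu D mD
  (fun j x => (f_ j x)%:E) (EFin \o f) (EFin \o g) _ _ _ ig.
- by move=> j; exact/measurable_EFinP.
- exact/measurable_EFinP.
- apply: filterS cf => x cx Dx; apply/fine_cvgP; split; first by near=> j.
  exact: cx.
- by apply: aeW => x j Dx; rewrite /= lee_fin fg.
have fin : (\int[mu]_(x in D) (f x)%:E)%E \is a fin_num by exact: (integrable_fin_num mD if_).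
apply: fine_cvg; rewrite fineK//; exact: H.
Unshelve. all: by end_near.
Qed.

Section delta.
Context {R : realType}.
Local Notation leb := (@lebesgue_measure R).

(** Test functions are differentiated in the direction [1], hence this form of
    the fundamental theorem. *)
Lemma smooth_FTC (f : R -> R) (a b : R) : a < b -> smooth f ->
  (\int[leb]_(x in `[a, b]) ('D_1 f x)%:E = (f b - f a)%:E)%E.
Proof.
move=> ab sf; rewrite EFinB.
have cf := smooth_continuous sf.
have sd : smooth ('D_1 f) by exact: smooth_derive.
rewrite (@continuous_FTC2 _ ('D_1 f) f)//.
- by apply: continuous_subspaceT; exact: smooth_continuous sd.
- split.
  + move=> x _; exact: (@smooth_derivable R _ f x 1 sf).
  + exact: cvg_at_right_filter (cf a).
  + exact: cvg_at_left_filter (cf b).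
- by move=> x _; rewrite derive1E.
Qed.

(** Differences of ramps are test functions on an interval that converge to the
    indicator function of ]x, y], and their derivatives converge to the
    difference of the Dirac masses at [x] and [y]. *)
Definition ramp (c : R) (j : nat) (r : R) : R := step (j.+1%:R * (r - c) - 1).

Lemma smooth_ramp c j : smooth (ramp c j).
Proof.
have sl : smooth (fun t : R => j.+1%:R * (t - c) - 1).
  apply: smoothD; last exact: smooth_cst.
  apply: smoothM; first exact: smooth_cst.
  by apply: smoothD; [exact: smooth_id|exact: smooth_cst].
exact: (smooth_comp smooth_step sl).
Qed.

Lemma derive_ramp c j r : 'D_1 (ramp c j) r = j.+1%:R * 'D_1 step (j.+1%:R * (r - c) - 1).
Proof.
have := (@derive_affine R _ _ (fun t : R => j.+1%:R * (t - c) - 1) (fun t => j.+1%:R * t) step r 1 _).2.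
rewrite /ramp => ->; last by move=> h; rewrite /GRing.scale /=; ring.
rewrite mulr1 (derivable_dirR _ _).2//; apply: smooth_derivable; exact: smooth_step.
Qed.

Lemma ramp0 c j r : r <= c + j.+1%:R^-1 -> ramp c j r = 0.
Proof.
move=> rc; apply: step_le0; have j0 : 0 < j.+1%:R :> R by [].
by rewrite subr_le0 -ler_pdivlMl// mulr1 lerBlDr addrC.
Qed.

Lemma ramp1 c j r : c + 2 * j.+1%:R^-1 <= r -> ramp c j r = 1.
Proof.
move=> rc; apply: step_ge1; have j0 : 0 < j.+1%:R :> R by [].
by rewrite lerBrDr -[1 + 1]/(2 : R) -ler_pdivrMl// mulrC lerBrDr addrC.
Qed.

Lemma ramp_ge0 c j r : 0 <= ramp c j r. Proof. exact: step_ge0. Qed.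
Lemma ramp_le1 c j r : ramp c j r <= 1. Proof. exact: step_le1. Qed.

Lemma near_inv (d : R) : 0 < d -> \forall j \near \oo, j.+1%:R^-1 < d.
Proof. by move=> d0; exact: (near_infty_natSinv_lt (PosNum d0)). Qed.

Lemma ramp_cvg c r : \forall j \near \oo, ramp c j r = (c < r)%R%:R.
Proof.
have [rc|rc] := leP r c.
  by near=> j; rewrite ramp0// (le_trans rc)// lerDl invr_ge0.
have d0 : 0 < (r - c) / 2 by lra.
near=> j; rewrite ramp1//.
have : j.+1%:R^-1 < (r - c) / 2 by near: j; exact: near_inv.
by move: (j.+1%:R^-1) => d ?; lra.
Unshelve. all: by end_near.
Qed.

Lemma derive_ramp_out c j r : ~~ (c + j.+1%:R^-1 <= r <= c + 2 * j.+1%:R^-1) -> 'D_1 (ramp c j) r = 0.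
Proof.
rewrite negb_and -!ltNge => /orP[H|H].
- rewrite (@near_eq_derive _ _ _ _ (fun=> 0)) ?derive_cst//.
  by near=> y; apply: ramp0; rewrite ltW//; near: y; exact: lt_nbhsl.
- rewrite (@near_eq_derive _ R R _ (fun=> 1)) ?derive_cst//.
  by near=> y; apply: ramp1; rewrite ltW//; near: y; exact: lt_nbhsr.
Unshelve. all: by end_near.
Qed.

(** The derivative of the ramp is concentrated in an interval of length [k]
    next to [c], has integral 1 and is bounded by [M / k]. *)
Lemma ramp_delta (h : R -> R) (a b c : R) : a < c < b -> measurable_fun `]a, b[ h ->
  h x @[x --> c] --> h c ->
  \int[leb]_(r in `]a, b[) ('D_1 (ramp c j) r * h r) @[j --> \oo] --> h c.
Proof.
move=> /andP[ac cb] mh ch.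
have [M M0 HM] := @derive_step_bounded R.
apply/cvgrPdist_le => e e0.
have e'0 : 0 < e / (M + 1) by rewrite divr_gt0// ltr_wpDl.
have /nbhs_ballP[d /= d0 dh] : \forall x \near c, `|h c - h x| <= e / (M + 1).
  by move/cvgrPdist_le : ch => /(_ _ e'0).
near=> j.
set k : R := j.+1%:R^-1.
have k0 : 0 < k by rewrite invr_gt0.
have kd : 2 * k < d.
  have : j.+1%:R^-1 < d / 2 by near: j; apply: near_inv; lra.
  by rewrite -/k => ?; lra.
have kb : c + 2 * k < b.
  have : j.+1%:R^-1 < (b - c) / 2 by near: j; apply: near_inv; lra.
  by rewrite -/k => ?; lra.
pose J := `[c + k, c + 2 * k]%classic : set R.
have mJ : measurable J by exact: measurable_itv.
have JD : J `<=` `]a, b[.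
  by move=> x; rewrite /J /= !in_itv/= => /andP[? ?]; apply/andP; split; lra.
have hJ x : J x -> `|h x - h c| <= e / (M + 1).
  rewrite /J /= in_itv/= => /andP[? ?]; rewrite distrC; apply: dh.
  by rewrite /ball/= ltr_norml; apply/andP; split; lra.
have sD : smooth ('D_1 (ramp c j)) by apply: smooth_derive; exact: smooth_ramp.
have mD (A : set R) : measurable_fun A ('D_1 (ramp c j) : R -> R).
  by apply: measurable_funTS; apply: continuous_measurable_fun; exact: smooth_continuous sD.
have bD x : `|'D_1 (ramp c j) x| <= k^-1 * M.
  rewrite derive_ramp normrM ger0_norm// /k invrK ler_pM2l//.
have fJ : leb J = k%:E.
  rewrite /J lebesgue_measure_itv/= lte_fin ifT; last by lra.
  by rewrite -EFinB; congr (_%:E); lra.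
have -> : \int[leb]_(r in `]a, b[) ('D_1 (ramp c j) r * h r) = \int[leb]_(r in J) ('D_1 (ramp c j) r * h r).
  rewrite -[in RHS](setIidr JD) Rintegral_mkcondr; apply: eq_Rintegral => x _.
  rewrite patchE; case: ifPn => // /negP xJ.
  rewrite derive_ramp_out ?mul0r//; apply/negP => H; apply: xJ.
  by apply/mem_set; rewrite /J /= in_itv.
have iD : leb.-integrable J (EFin \o 'D_1 (ramp c j)).
  apply: (@bounded_integrable _ _ R leb J ('D_1 (ramp c j)) (k^-1 * M) mJ _ (mD J)).
    by rewrite [X in (X < _)%E]fJ ltry.
  by move=> x _; exact: bD.
have mh' : measurable_fun J (fun x => h x - h c).
  by apply: measurable_funB => //; apply: measurable_funS mh.
have i1 : leb.-integrable J (fun x => ('D_1 (ramp c j) x * (h x - h c))%:E).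
  exact: (@integrable_mulr_bounded _ _ R leb J ('D_1 (ramp c j)) (fun x => h x - h c) (e / (M + 1)) mJ iD mh' hJ).
have ih : leb.-integrable J (fun x => ('D_1 (ramp c j) x * h c)%:E).
  exact: (@integrable_mulr_bounded _ _ R leb J ('D_1 (ramp c j)) (fun=> h c) (`|h c|) mJ iD (measurable_cst _) (fun _ _ => lexx _)).
have one : \int[leb]_(x in J) ('D_1 (ramp c j) x * h c) = h c.
  rewrite RintegralZr// /Rintegral smooth_FTC; [|lra|exact: smooth_ramp].
  by rewrite ramp1 ?ramp0 ?lexx//= subr0 mul1r.
have -> : \int[leb]_(r in J) ('D_1 (ramp c j) r * h r) =
   \int[leb]_(r in J) ('D_1 (ramp c j) r * (h r - h c)) + h c.
  rewrite -[X in _ + X]one -RintegralD//; apply: eq_Rintegral => x _; ring.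
rewrite opprD addrCA addrN addr0 normrN.
apply: (le_trans (@le_normr_Rintegral _ _ _ leb J (fun r => 'D_1 (ramp c j) r * (h r - h c)) mJ i1)).
apply: (@le_trans _ _ (\int[leb]_(t in J) (k^-1 * M * (e / (M + 1))))).
  apply: le_Rintegral => //.
  - exact: (integrable_norm i1).
  - by apply: (@cst_integrable _ _ R leb J _ mJ); rewrite [X in (X < _)%E]fJ ltry.
  - by move=> x Jx; rewrite normrM ler_pM// hJ.
rewrite Rintegral_cst// [X in fine X]fJ /=.
have -> : k^-1 * M * (e / (M + 1)) * k = e * (M / (M + 1)).
  by field; rewrite !gt_eqF// ltr_wpDl.
have q : M / (M + 1) <= 1 by rewrite ler_pdivrMr ?mul1r ?lerDl// ltr_wpDl.
by rewrite ler_piMr// ltW.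
Unshelve. all: by end_near.
Qed.

End delta.

Section primitive.
Context {R : realType}.
Local Notation leb := (@lebesgue_measure R).

Lemma le_integral_dist (D : set (measurableTypeR R)) (f g h : R -> R) :
  measurable D -> leb.-integrable D (EFin \o f) -> leb.-integrable D (EFin \o g) ->
  measurable_fun D h -> (forall t, D t -> `|f t - g t| <= h t) ->
  (`|\int[leb]_(t in D) f t - \int[leb]_(t in D) g t|%:E <= \int[leb]_(t in D) (h t)%:E)%E.
Proof.
move=> mD fi gi mh fgh.
rewrite -RintegralB//.
have fgi : leb.-integrable D (EFin \o (fun t => f t - g t)) by exact: (integrableB mD fi gi).
apply: (@le_trans _ _ (\int[leb]_(t in D) `|f t - g t|)%:E).
  by rewrite lee_fin; exact: (@le_normr_Rintegral _ _ _ leb D (fun r => f r - g r) mD fgi).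
have ni := integrable_norm fgi.
rewrite /Rintegral fineK ?integrable_fin_num//.
apply: ge0_le_integral => //.
- by case/integrableP : ni.
- exact/measurable_EFinP.
Qed.

Context (X : ipSpace R) (HX : is_hilbert X) (T : R) (u v : R -> X).
Hypothesis mu : forall t, 0 <= t <= T -> ip_mem X (u t).
Hypothesis cu : forall t, 0 <= t <= T -> ipnorm (u s - u t) @[s --> within `[0, T] (nbhs t)] --> 0.
Hypothesis W : W11loc T u v.

Lemma curve_ip_cvg z t : ip_mem X z -> 0 < t < T -> ip X (u s) z @[s --> t] --> ip X (u t) z.
Proof.
move=> mz /andP[t0 tT]; apply/cvgrPdist_le => e e0.
have ze : 0 < e / (ipnorm z + 1) by rewrite divr_gt0// ltr_wpDl// ipnorm_ge0.
have tt : 0 <= t <= T by rewrite !ltW.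
have /cvgrPdist_le/(_ _ ze) := cu tt; rewrite near_withinE => H.
have I01 : \forall s \near t, s \in `[0, T].
  near=> s; rewrite in_itv/=; apply/andP; split; rewrite ltW//; near: s;
    [exact: lt_nbhsr|exact: lt_nbhsl].
near=> s.
have sI : s \in `[0, T] by near: s.
have : `|0 - ipnorm (u s - u t)| <= e / (ipnorm z + 1).
  by move: sI; near: s; exact: H.
move: sI; rewrite in_itv/= => ss.
rewrite sub0r normrN ger0_norm ?ipnorm_ge0// => us.
rewrite -ipBl//; [|exact: mu|exact: mu].
apply: le_trans (cauchy_schwarz HX (memB HX (mu tt) (mu ss)) mz) _.
rewrite (ipnormC HX (mu tt) (mu ss)).
apply: (@le_trans _ _ (e / (ipnorm z + 1) * ipnorm z)).
  by rewrite ler_wpM2r// ipnorm_ge0.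
have q : ipnorm z / (ipnorm z + 1) <= 1.
  by rewrite ler_pdivrMr ?mul1r ?lerDl// ltr_wpDl// ipnorm_ge0.
by rewrite -mulrA [_^-1 * _]mulrC ler_piMr// ltW.
Unshelve. all: by end_near.
Qed.

(** Pairing with [z] commutes with the Bochner integral up to the distance to
    the approximation [g]. With [g = f] and [d = 0] this is exact; with [g] a
    step function it gives the error in L^1. *)
Lemma bochner_ip (D : set (measurableTypeR R)) (f : R -> X) (I z : X) (h : R -> R)
  (g : R -> X) (d : R -> R) :
  measurable D -> (leb D < +oo)%E -> bochner_integral D f I -> ip_mem X z ->
  leb.-integrable D (EFin \o h) -> leb.-integrable D (EFin \o d) -> (forall t, D t -> 0 <= d t) ->
  (forall t, D t -> ip_mem X (g t) /\ h t = ip X (g t) z /\ ipnorm (f t - g t) <= d t) ->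
  (`|ip X I z - \int[leb]_(t in D) h t|%:E <= (ipnorm z)%:E * \int[leb]_(t in D) (d t)%:E)%E.
Proof.
move=> mD fD [mf mI [s [ms cs cI]]] mz ih id d0 H.
have md : measurable_fun D d by apply/measurable_EFinP; case/integrableP : id.
have zn0 := ipnorm_ge0 z.
have Is k : leb.-integrable D (EFin \o (fun t => ip X (step_fun (s k) t) z)).
  apply: (@bounded_integrable _ _ R leb D _ (step_bound (s k) * ipnorm z) mD fD).
    apply: (@measurable_ip_step R X HX (s k) D (fun=> z) mD) => //.
  by move=> t Dt; exact: ip_step_le.
(* Both error terms of the approximation of [I] and of [f] by the step function
   [s k] vanish in the limit. *)
pose a k : \bar R := ((ipnorm z * ipnorm (I - step_integral D (s k)))%:E + (ipnorm z)%:E *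
   (\int[leb]_(t in D) (ipnorm (f t - step_fun (s k) t))%:E + \int[leb]_(t in D) (d t)%:E))%E.
have mSI k : ip_mem X (step_integral D (s k)).
  by apply: mem_sum => // i; apply: memZ => //; exact: step_valP.
have B k : (`|ip X I z - \int[leb]_(t in D) h t|%:E <= a k)%E.
  have -> : ip X I z - \int[leb]_(t in D) h t = ip X (I - step_integral D (s k)) z +
     (\int[leb]_(t in D) ip X (step_fun (s k) t) z - \int[leb]_(t in D) h t).
    by rewrite ipBl// ip_step_integral//; ring.
  apply: le_trans (_ : (`|ip X (I - step_integral D (s k)) z|%:E + `|\int[leb]_(t in D) ip X (step_fun (s k) t) z - \int[leb]_(t in D) h t|%:E <= _)%E).
    by rewrite -EFinD lee_fin ler_normD.
  apply: leeD.
    by rewrite lee_fin mulrC; apply: cauchy_schwarz => //; exact: memB.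
  rewrite -ge0_integralD//; [|by move=> t _; rewrite lee_fin ipnorm_ge0|exact/measurable_EFinP|exact/measurable_EFinP].
  rewrite -ge0_integralZl//; [|by apply: emeasurable_funD; exact/measurable_EFinP|by move=> t Dt; rewrite adde_ge0// lee_fin ?ipnorm_ge0 ?d0].
  apply: (@le_integral_dist D _ h (fun t => ipnorm z * (ipnorm (f t - step_fun (s k) t) + d t))) => //.
    by apply: measurable_funM => //; apply: measurable_funD.
  move=> t Dt; have [mg [-> fg]] := H t Dt; have mst := mem_step HX (s k) t.
  rewrite -ipBl// mulrC; apply: le_trans (cauchy_schwarz HX (memB HX mst mg) mz) _.
  apply: ler_wpM2r => //.
  have -> : step_fun (s k) t - g t = - (f t - step_fun (s k) t) + (f t - g t).
    by rewrite opprB addrA subrK.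
  apply: le_trans (ipnormD HX (memN HX (memB HX (mf t Dt) mst)) (memB HX (mf t Dt) mg)) _.
  by rewrite ipnormN ?lerD2l//; exact: memB (mf t Dt) mst.
have ca : a k @[k --> \oo] --> ((ipnorm z)%:E * \int[leb]_(t in D) (d t)%:E)%E.
  rewrite -[X in _ --> X]add0e; apply: cvgeD => //.
  - apply/fine_cvgP; split; first by near=> k.
    have H0 : ipnorm z * ipnorm (I - step_integral D (s k)) @[k --> \oo] --> ipnorm z * 0.
      exact: cvgMl_tmp cI.
    by move: H0; rewrite mulr0.
  - apply: cvgeZl => //; rewrite -[X in _ --> X]add0e; apply: cvgeD => //; last exact: cvg_cst.
apply: (cvge_ge _ ca).
by apply: nearW => k; exact: B.
Unshelve. all: by end_near.
Qed.

Lemma curve_norm_bounded : 0 <= T -> exists2 M, 0 <= M & forall t, 0 <= t <= T -> ipnorm (u t) <= M.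
Proof.
move=> T0.
have cn : {within `[0, T], continuous (fun t => ipnorm (u t))}.
  apply/subspace_continuousP => t; rewrite /= in_itv/= => tT.
  apply/cvgrPdist_le => e e0.
  have /cvgrPdist_le/(_ _ e0) := cu tT; rewrite !near_withinE; apply: filterS => s H sT.
  have := H sT; rewrite sub0r normrN ger0_norm ?ipnorm_ge0//; apply: le_trans.
  move: sT; rewrite /= in_itv/= => sT; rewrite distrC; exact: ipnorm_dist (mu sT) (mu tT).
have [c _ Hc] := @EVT_max R _ 0 T T0 cn.
exists (ipnorm (u c)); first exact: ipnorm_ge0.
by move=> t tT; apply: Hc; rewrite in_itv.
Qed.

(** The definition of the weak derivative is tested with differences of ramps
    at [x] and [y]. The derivative [v] is replaced by step functions because
    only these have a measurable pairing at hand. *)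
Lemma primitive_estimate a : 0 < a < T -> exists s : nat -> stepFun X,
  let d k r := ipnorm (v r - step_fun (s k) r) in
  [/\ forall r, a < r < T -> ip_mem X (v r),
      forall k, measurable_fun `]a, T[ (d k),
      (\int[leb]_(r in `]a, T[) (d k r)%:E)%E @[k --> \oo] --> 0%E &
      forall k, leb.-integrable `]a, T[ (EFin \o d k) ->
      forall x y z, a < x -> x < y -> y < T -> ip_mem X z ->
        `|ip X (u y - u x) z - \int[leb]_(r in `]x, y]) ip X (step_fun (s k) r) z| <=
          ipnorm z * \int[leb]_(r in `]x, y]) d k r].
Proof.
move=> aT; have /andP[a0 aT'] := aT.
have [_ [I0 [mv _ [s [ms cs _]]]] WT] := W aT.
exists s => d; split; [exact: mv|exact: ms|exact: cs|].
move=> k id x y z ax xy yT mz.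
pose D := `]a, T[%classic : set (measurableTypeR R).
have mD : measurable D by exact: measurable_itv.
have fD : (leb D < +oo)%E.
  by rewrite /D lebesgue_measure_itv/=; case: ifP => _; rewrite ?ltry.
pose h r := ip X (u r) z.
have hc r : 0 < r < T -> h t @[t --> r] --> h r by move=> ?; exact: curve_ip_cvg.
have mh : measurable_fun D h.
  apply: open_continuous_measurable_fun; first exact: interval_open.
  move=> r; rewrite inE /D /= in_itv/= => /andP[ar rT]; apply: hc.
  by rewrite (lt_trans a0 ar).
have [M M0 HM] := curve_norm_bounded (ltW (lt_trans a0 aT')).
have hM r : D r -> `|h r| <= M * ipnorm z.
  rewrite /D /= in_itv/= => /andP[ar rT].
  have rT' : 0 <= r <= T by rewrite !ltW// (lt_trans a0).
  apply: le_trans (cauchy_schwarz HX (mu rT') mz) _.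
  by rewrite ler_wpM2r ?ipnorm_ge0// HM.
pose q r := ip X (step_fun (s k) r) z.
have mq : measurable_fun D q by apply: (@measurable_ip_step R X HX (s k) D (fun=> z) mD).
have qB r : `|q r| <= step_bound (s k) * ipnorm z by exact: ip_step_le.
have iq : leb.-integrable D (EFin \o q).
  by apply: (@bounded_integrable _ _ R leb D q _ mD fD mq (fun r _ => qB r)).
pose phi j r := ramp x j r - ramp y j r.
have sphi j : smooth (phi j).
  by apply: smoothD; [exact: smooth_ramp|apply: smoothN; exact: smooth_ramp].
have dphi j r : 'D_1 (phi j) r = 'D_1 (ramp x j) r - 'D_1 (ramp y j) r.
  by apply: deriveB; apply: smooth_derivable; exact: smooth_ramp.
have phi1 j r : `|phi j r| <= 1.
  rewrite /phi ler_norml; have := ramp_ge0 x j r; have := ramp_le1 x j r.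
  by have := ramp_ge0 y j r; have := ramp_le1 y j r => *; apply/andP; split; lra.
have tphi : \forall j \near \oo, test_function (`]a, T[ : set R) (phi j).
  have d0 : 0 < (T - y) / 2 by lra.
  near=> j; split; first exact: sphi.
  have jd : j.+1%:R^-1 < (T - y) / 2 by near: j; exact: near_inv.
  have k0 : 0 < j.+1%:R^-1 :> R by rewrite invr_gt0.
  exists (`[x + j.+1%:R^-1, y + 2 * j.+1%:R^-1]%classic : set R); split.
  - exact: segment_compact.
  - move: (j.+1%:R^-1) jd k0 => c jd k0 r; rewrite /= !in_itv/= => /andP[? ?].
    by apply/andP; split; lra.
  - move=> r; rewrite /= in_itv/= => /negP; rewrite negb_and -!ltNge => /orP[H|H].
      by rewrite /phi !ramp0 ?subrr// ltW// (lt_trans H)// ltrD2r.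
    rewrite /phi !ramp1 ?subrr ?ltW//; apply: lt_trans H; by rewrite ltrD2r.
have est : \forall j \near \oo, `|(- (\int[leb]_(r in D) ('D_1 (phi j) r * h r))) -
    \int[leb]_(r in D) (phi j r * q r)| <= ipnorm z * \int[leb]_(r in D) (`|phi j r| * d k r).
  apply: filterS tphi => j tj.
  have [I B1 B2] := WT _ tj.
  have cphi := smooth_continuous (sphi j).
  have mphi : measurable_fun D (phi j) by apply: measurable_funTS; exact: continuous_measurable_fun.
  have sdphi : smooth ('D_1 (phi j)) by apply: smooth_derive; exact: sphi.
  have cdphi := smooth_continuous sdphi.
  have tdj : test_function (`]a, T[ : set R) ('D_1 (phi j)) by apply: test_derive; exact: tj.
  have [Md HMd] := test_bounded tdj.
  have ih : leb.-integrable D (EFin \o (fun r => 'D_1 (phi j) r * h r)).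
    apply: (@bounded_integrable _ _ R leb D _ (Md * (M * ipnorm z)) mD fD).
      by apply: measurable_funM => //; apply: measurable_funTS; exact: continuous_measurable_fun.
    by move=> r Dr; rewrite normrM ler_pM// hM.
  have mu' r : D r -> ip_mem X (u r).
    rewrite /D /= in_itv/= => /andP[ar rT]; apply: mu; by rewrite !ltW// (lt_trans a0).
  have E1 : ip X I z = \int[leb]_(r in D) ('D_1 (phi j) r * h r).
    have := @bochner_ip D _ I z _ (fun r => 'D_1 (phi j) r *: u r) (fun=> 0) mD fD B1 mz ih
      (integrable0 _ _) (fun _ _ => lexx _).
    rewrite integral0 mule0 lee_fin normr_le0 subr_eq0 => H; apply/eqP; apply: H.
    move=> r Dr; split; [|split].
    - by apply: memZ => //; exact: mu'.
    - by rewrite ipZl//; exact: mu'.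
    - by rewrite derive1E subrr /ipnorm ip0l ?sqrtr0//; exact: mem0.
  have iphd : leb.-integrable D (EFin \o (fun r => `|phi j r| * d k r)).
    rewrite (_ : EFin \o _ = (fun r => (d k r * `|phi j r|)%:E)); last first.
      by apply/funext => r /=; rewrite mulrC.
    apply: (@integrable_mulr_bounded _ _ R leb D (d k) (fun r => `|phi j r|) 1 mD id).
      exact: measurableT_comp.
    by move=> r _; rewrite normr_id.
  have ipq : leb.-integrable D (EFin \o (fun r => phi j r * q r)).
    rewrite (_ : EFin \o _ = (fun r => (q r * phi j r)%:E)); last first.
      by apply/funext => r /=; rewrite mulrC.
    exact: (@integrable_mulr_bounded _ _ R leb D q (phi j) 1 mD iq).
  have := @bochner_ip D _ (- I) z (fun r => phi j r * q r) (fun r => phi j r *: step_fun (s k) r)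
     (fun r => `|phi j r| * d k r) mD fD B2 mz ipq iphd.
  have mI : ip_mem X I by case: B1.
  rewrite ipNl// E1 -[in X in _ -> X]lee_fin EFinM /Rintegral.
  rewrite [X in _ -> (_ <= _ * X)%E]fineK; last exact: (integrable_fin_num mD iphd).
  apply.
    by move=> r Dr; rewrite mulr_ge0// ipnorm_ge0.
  move=> r Dr; have mst := mem_step HX (s k) r; split; [|split].
  - exact: memZ.
  - by rewrite ipZl.
  - by rewrite -scalerBr ipnormZ//; apply: memB => //; exact: mv.
(* The indicator function of ]x, y], written as the limit of [phi j]. *)
have chi_E (f : R -> R) : \int[leb]_(r in D) (((x < r)%R%:R - (y < r)%R%:R) * f r) = \int[leb]_(r in `]x, y]) f r.
  have xyD : `]x, y] `<=` D.
    by move=> r; rewrite /D /= !in_itv/= => /andP[? ?]; apply/andP; split; lra.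
  rewrite -[in RHS](setIidr xyD) Rintegral_mkcondr; apply: eq_Rintegral => r _.
  rewrite patchE mem_setE in_itv/= [r <= y]leNgt.
  case: (ltP x r) => xr; case: (ltP y r) => yr /=; rewrite ?subrr ?subr0 ?mul0r ?mul1r//.
  by have := lt_trans (le_lt_trans xr xy) yr; rewrite ltxx.
have chi_cvg r : phi j r @[j --> \oo] --> ((x < r)%R%:R - (y < r)%R%:R : R).
  by apply: cvgB; apply: cvg_near_cst; exact: ramp_cvg.
have mchi : measurable_fun D (fun r => (x < r)%R%:R - (y < r)%R%:R : R).
  have E c : (fun r : R => (c < r)%R%:R : R) = \1_(`]c, +oo[%classic : set R).
    by apply/funext => r; rewrite indicE mem_setE in_itv/= andbT.
  by apply: measurable_funB; rewrite E; apply: measurable_indic; exact: measurable_itv.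
have mphiD j : measurable_fun D (phi j).
  by apply: measurable_funTS; apply: continuous_measurable_fun; exact: smooth_continuous.
have L1 : \int[leb]_(r in D) ('D_1 (phi j) r * h r) @[j --> \oo] --> h x - h y.
  have cx : \int[leb]_(r in D) ('D_1 (ramp x j) r * h r) @[j --> \oo] --> h x.
    by apply: ramp_delta => //; [rewrite ax (lt_trans xy yT)|apply: hc; rewrite (lt_trans a0 ax) (lt_trans xy yT)].
  have cy : \int[leb]_(r in D) ('D_1 (ramp y j) r * h r) @[j --> \oo] --> h y.
    by apply: ramp_delta => //; [rewrite (lt_trans ax xy)|apply: hc; rewrite (lt_trans a0 (lt_trans ax xy))].
  apply: cvg_trans (cvgB cx cy); apply: near_eq_cvg; near=> j.
  have ir c : leb.-integrable D (EFin \o (fun r => 'D_1 (ramp c j) r * h r)).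
    have [Md Md0 HMd] := @derive_step_bounded R.
    apply: (@bounded_integrable _ _ R leb D _ (j.+1%:R * Md * (M * ipnorm z)) mD fD).
      apply: measurable_funM => //; apply: measurable_funTS; apply: continuous_measurable_fun.
      have sr : smooth ('D_1 (ramp c j)) by apply: smooth_derive; exact: smooth_ramp.
      exact: smooth_continuous sr.
    move=> r Dr; rewrite normrM ler_pM ?hM// derive_ramp normrM ger0_norm//.
    by rewrite ler_wpM2l.
  rewrite -[LHS]/(\int[leb]_(r in D) ('D_1 (ramp x j) r * h r) - \int[leb]_(r in D) ('D_1 (ramp y j) r * h r)).
  rewrite -(@RintegralB _ _ _ leb D _ _ mD (ir x) (ir y)).
  by apply: eq_Rintegral => r _; rewrite dphi mulrBl.
have L2 : \int[leb]_(r in D) (phi j r * q r) @[j --> \oo] --> \int[leb]_(r in `]x, y]) q r.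
  rewrite -chi_E; apply: (@dominated_Rintegral _ _ R leb D (fun j r => phi j r * q r) _ (fun r => `|q r|) mD).
  - by move=> j; exact: measurable_funM.
  - exact: measurable_funM.
  - by apply: aeW => r _; apply: cvgMr_tmp; exact: chi_cvg.
  - exact: integrable_norm iq.
  - by move=> j r _; rewrite normrM ler_piMl.
have L3 : \int[leb]_(r in D) (`|phi j r| * d k r) @[j --> \oo] --> \int[leb]_(r in `]x, y]) d k r.
  rewrite -chi_E; apply: (@dominated_Rintegral _ _ R leb D (fun j r => `|phi j r| * d k r) _ (d k) mD).
  - by move=> j; apply: measurable_funM; [apply: measurableT_comp => //; exact: mphiD|exact: ms].
  - by apply: measurable_funM => //; exact: ms.
  - apply: aeW => r _; apply: cvgMr_tmp.
    have -> : ((x < r)%R%:R - (y < r)%R%:R : R) = `|(x < r)%R%:R - (y < r)%R%:R|.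
      case: (ltP x r) => xr; case: (ltP y r) => yr /=; rewrite ?subrr ?subr0 ?normr0 ?normr1//.
      by have := lt_trans (le_lt_trans xr xy) yr; rewrite ltxx.
    by apply: cvg_norm; exact: chi_cvg.
  - exact: id.
  - by move=> j r _; rewrite normrM normr_id [X in _ * X]ger0_norm ?ipnorm_ge0// ler_piMl// ipnorm_ge0.
have mux : ip_mem X (u x) by apply: mu; rewrite !ltW// ?(lt_trans a0 ax)// (lt_trans xy).
have muy : ip_mem X (u y) by apply: mu; rewrite !ltW// (lt_trans a0 (lt_trans ax xy)).
have -> : ip X (u y - u x) z = - (h x - h y) by rewrite ipBl// opprB.
have LL : `|(- (\int[leb]_(r in D) ('D_1 (phi j) r * h r))) -
    \int[leb]_(r in D) (phi j r * q r)| @[j --> \oo] --> `|(- (h x - h y)) - \int[leb]_(r in `]x, y]) q r|.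
  by apply: cvg_norm; apply: cvgB => //; exact: cvgN.
have LR : ipnorm z * \int[leb]_(r in D) (`|phi j r| * d k r) @[j --> \oo] -->
   ipnorm z * \int[leb]_(r in `]x, y]) d k r by exact: cvgMl_tmp.
exact: (ler_cvg_to LL LR est).
Unshelve. all: by end_near.
Qed.

End primitive.

(** * From dissipation at almost every time to a decreasing energy *)

Lemma integrable_scale d (T : measurableType d) (R : realType) (mu : {measure set T -> \bar R})
  (D : set T) (c : R) (f : T -> R) : measurable D ->
  mu.-integrable D (EFin \o f) -> mu.-integrable D (EFin \o (fun x => c * f x)).
Proof. by move=> mD fi; exact: (@integrableZl _ _ _ mu D mD c (EFin \o f) fi). Qed.

Lemma Rintegral_subset d (T : measurableType d) (R : realType) (mu : {measure set T -> \bar R})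
  (A B : set T) (f : T -> R) : measurable A -> measurable B -> A `<=` B ->
  mu.-integrable B (EFin \o f) -> (forall x, B x -> 0 <= f x) ->
  \int[mu]_(x in A) f x <= \int[mu]_(x in B) f x.
Proof.
move=> mA mB AB fi f0; have fiA := integrableS mB mA AB fi.
apply: fine_le; [exact: (integrable_fin_num mA fiA)|exact: (integrable_fin_num mB fi)|].
by apply: ge0_subset_integral => //; case/integrableP : fi.
Qed.

Lemma dissip_pointwise_arith (R : realType) (D0 a b c x y z nf ng M C bf bg h : R) :
  D0 <= 0 -> a <= nf * M -> - b <= ng * M -> C * c <= C * (nf * M) ->
  x <= bf * h -> - y <= bg * h -> C * z <= C * (bf * h) -> 0 <= ng * (C * M) ->
  2 * D0 + 2 * (a - b + C * c) + (x - y + C * z) <=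
    (2 * M + 2 * (C * M)) * (nf + ng) + (bf + bg + C * bf) * h.
Proof. by move=> *; lra. Qed.

Lemma dist_lt_within (R : realType) (x q y r m : R) : x <= q -> q <= y -> r - x < m -> y - r < m -> `|q - r| < m.
Proof. by move=> *; rewrite ltr_norml; apply/andP; split; lra. Qed.

Lemma le_sum2 (R : realType) (a b c d : R) : a <= b + c -> b <= d -> c <= d -> a <= 2 * d.
Proof. by move=> *; lra. Qed.

Lemma energy_arith (R : realType) (a b c a' b' c' If Ig M C dl : R) :
  a - a' <= 2 * M * If -> C * (c - c') <= C * (2 * M * If) -> - (b - b') <= 2 * M * Ig ->
  a' - b' + C * c' <= (2 * M + 2 * (C * M)) * (If + Ig) + dl -> 0 <= C * M * Ig ->
  a - b + C * c <= (4 * M + 4 * (C * M)) * (If + Ig) + dl.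
Proof. by move=> *; lra. Qed.

Section energy.
Context {R : realType}.
Local Notation leb := (@lebesgue_measure R).

(** A real induction: the largest point up to which the inequality with the
    value at [s] holds cannot be smaller than [t]. The hypothesis compares only
    points on both sides of [r], as is available for increments. *)
Lemma local_nonincreasing (F : R -> R) (s t : R) : s <= t ->
  (forall r, s <= r <= t -> exists2 d, 0 < d & forall x y, s <= x -> x <= r -> r <= y -> y <= t ->
     r - d < x -> y < r + d -> F y <= F x) -> F t <= F s.
Proof.
move=> st H.
pose A := [set x | s <= x <= t /\ F x <= F s].
have As : A s by rewrite /A /= lexx st.
have ubA : ubound A t by move=> x [/andP[]].
have supA : has_sup A by split; [exists s|exists t].
pose c := sup A.
have cA x : A x -> x <= c by move=> Ax; apply: ub_le_sup => //; exists t.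
have sc : s <= c by exact: cA.
have ct : c <= t by apply: ge_sup => //; exists s.
have [d d0 Hd] : exists2 d, 0 < d & forall x y, s <= x -> x <= c -> c <= y -> y <= t ->
     c - d < x -> y < c + d -> F y <= F x by apply: H; rewrite sc ct.
have [x Ax xc] := sup_adherent d0 supA.
have [/andP[sx xt] Fx] := Ax.
have Fc : F c <= F s.
  apply: le_trans Fx; apply: Hd => //; first exact: cA.
  by rewrite ltrDl.
have [->//|ct'] := eqVneq t c.
have {}ct : c < t by rewrite lt_def ct' ct.
(* A point beyond the supremum, still to be compared through [c]. *)
pose y := Num.min (c + d / 2) t.
have cy : c < y by rewrite /y lt_min ct andbT ltrDl divr_gt0.
have yt : y <= t by rewrite /y ge_min lexx orbT.
have Fy : F y <= F c.
  apply: Hd => //; first exact: ltW.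
    by rewrite gtrBl.
  by rewrite /y gt_min ltrD2l gtr_pMr// invf_lt1// ltr1n.
have Ay : A y by split; [rewrite yt (le_trans sc (ltW cy))|exact: le_trans Fy Fc].
by have := cA _ Ay; rewrite leNgt cy.
Qed.

(** The exceptional null set is removed by comparing with the pointwise
    minimum. *)
Lemma ae_le_Rintegral (D : set (measurableTypeR R)) (f g : R -> R) : measurable D ->
  leb.-integrable D (EFin \o f) -> leb.-integrable D (EFin \o g) ->
  {ae leb, forall x, D x -> f x <= g x} -> \int[leb]_(x in D) f x <= \int[leb]_(x in D) g x.
Proof.
move=> mD fi gi fg.
have mf : measurable_fun D f by apply/measurable_EFinP; case/integrableP : fi.
have mg : measurable_fun D g by apply/measurable_EFinP; case/integrableP : gi.
have mh : measurable_fun D (fun x => Num.min (f x) (g x)) by exact: measurable_minr.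
have E : (\int[leb]_(x in D) (f x)%:E = \int[leb]_(x in D) (Num.min (f x) (g x))%:E)%E.
  apply: ae_eq_integral => //; [exact/measurable_EFinP|exact/measurable_EFinP|].
  apply: filterS fg => x H Dx; congr (_%:E); apply/esym; rewrite minC; exact/min_idPr/H.
rewrite /Rintegral E; apply: fine_le.
- rewrite -E; exact: (integrable_fin_num mD fi).
- exact: (integrable_fin_num mD gi).
have hi : leb.-integrable D (fun x => (Num.min (f x) (g x))%:E).
  apply: (@le_integrable _ _ _ leb D mD _ (fun x => `|(f x)%:E| + `|(g x)%:E|)%E).
  - exact/measurable_EFinP.
  - move=> x Dx /=; rewrite lee_fin [leRHS]ger0_norm; last by rewrite addr_ge0.
    by rewrite minElt; case: ifP => _; [rewrite lerDl|rewrite lerDr].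
  - exact: (integrableD mD (integrable_abse fi) (integrable_abse gi)).
apply: le_integral => // x Dx; rewrite lee_fin ge_min lexx orbT//.
Qed.

Lemma curve_continuous_eps (X : ipSpace R) (T : R) (u : R -> X) :
  (forall t, 0 <= t <= T -> ipnorm (u s - u t) @[s --> within `[0, T] (nbhs t)] --> 0) ->
  forall t, 0 <= t <= T -> forall e, 0 < e -> exists2 d, 0 < d & forall s, 0 <= s <= T ->
    `|s - t| < d -> ipnorm (u s - u t) <= e.
Proof.
move=> cu t tT e e0.
have /cvgrPdist_le/(_ _ e0) := cu t tT; rewrite near_withinE => /nbhs_ballP[d /= d0 H].
exists d => // s sT st.
have := H s; rewrite /ball /= distrC => /(_ st); rewrite sub0r normrN ger0_norm ?ipnorm_ge0//.
by apply; rewrite /= in_itv.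
Qed.

Context (X X0 : ipSpace R) (HX : is_hilbert X) (HX0 : is_hilbert X0).
Context (lift : X0 -> X) (L : X -> X0).
Hypothesis lift_mem : forall x, ip_mem X0 x -> ip_mem X (lift x).
Hypothesis L_mem : forall x, ip_mem X x -> ip_mem X0 (L x).
Hypothesis liftB : forall x y, lift (x - y) = lift x - lift y.
Hypothesis adj : forall x z, ip_mem X0 x -> ip_mem X z -> ip X (lift x) z = ip X0 x (L z).
Hypothesis isom : forall x y, ip_mem X0 x -> ip_mem X0 y -> ip X (lift x) (lift y) = ip X0 x y.

Lemma ipnorm_lift x : ip_mem X0 x -> ipnorm (lift x) = ipnorm x.
Proof. by move=> mx; rewrite /ipnorm isom. Qed.

(** The adjoint of an isometry is a contraction. *)
Lemma ipnorm_L z : ip_mem X z -> ipnorm (L z) <= ipnorm z.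
Proof.
move=> mz; have mL := L_mem mz.
have [L0|L0] := eqVneq (ipnorm (L z)) 0; first by rewrite L0 ipnorm_ge0.
have L1 : 0 < ipnorm (L z) by rewrite lt_def L0 ipnorm_ge0.
rewrite -(ler_pM2l L1) -expr2 ipnorm_sqr// -adj//.
apply: le_trans (ler_norm _) _; apply: le_trans (cauchy_schwarz HX (lift_mem mL) mz) _.
by rewrite ipnorm_lift.
Qed.

Lemma ipnorm_tri (Y : ipSpace R) (HY : is_hilbert Y) (a b c : Y) : ip_mem Y a -> ip_mem Y b -> ip_mem Y c ->
  ipnorm (a - b) <= ipnorm (a - c) + ipnorm (b - c).
Proof.
move=> ma mb mc; rewrite (ipnormC HY mb mc).
by have := ipnormD HY (memB HY ma mc) (memB HY mc mb); rewrite addrA subrK.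
Qed.

(** The dissipation inequality at one time, with the derivatives [d0], [e0]
    replaced by approximations [f], [g] and the vectors [wq], [uq] by halves of
    nearby [z1], [z2]. The right hand side collects both errors. *)
Lemma dissip_pointwise (C M bf bg h : R) (f d0 wq uq z1 z2 : X) (g e0 : X0) : 0 <= C ->
  ip_mem X f -> ip_mem X d0 -> ip_mem X0 g -> ip_mem X0 e0 ->
  ip_mem X wq -> ip_mem X uq -> ip_mem X z1 -> ip_mem X z2 ->
  ip X (d0 - lift e0) wq + C * ip X d0 uq <= 0 ->
  ipnorm wq <= M -> ipnorm uq <= M -> 0 <= bf -> 0 <= bg ->
  (forall z, ip_mem X z -> `|ip X f z| <= bf * ipnorm z) ->
  (forall z, ip_mem X0 z -> `|ip X0 g z| <= bg * ipnorm z) ->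
  ipnorm (z1 - 2 *: wq) <= h -> ipnorm (z2 - 2 *: uq) <= h ->
  ip X f z1 - ip X0 g (L z1) + C * ip X f z2 <=
    (2 * M + 2 * (C * M)) * (ipnorm (d0 - f) + ipnorm (e0 - g)) + (bf + bg + C * bf) * h.
Proof.
move=> C0 mf md mg me mw mu mz1 mz2 diss wM uM bf0 bg0 hf hg.
set e1 := z1 - _; set e2 := z2 - _ => ne1 ne2.
have mlg := lift_mem mg; have mle := lift_mem me.
have m2w := memZ HX 2 mw; have m2u := memZ HX 2 mu.
have me1 : ip_mem X e1 by exact: memB.
have me2 : ip_mem X e2 by exact: memB.
have z1E : z1 = 2 *: wq + e1 by rewrite /e1 addrC subrK.
have z2E : z2 = 2 *: uq + e2 by rewrite /e2 addrC subrK.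
have phiE : ip X f z1 - ip X0 g (L z1) + C * ip X f z2 = 2 * (ip X (d0 - lift e0) wq + C * ip X d0 uq)
    + 2 * (ip X (f - d0) wq - ip X (lift (g - e0)) wq + C * ip X (f - d0) uq)
    + (ip X f e1 - ip X0 g (L e1) + C * ip X f e2).
  have s1 (a : X) : ip_mem X a -> ip X a z1 = 2 * ip X a wq + ip X a e1.
    by move=> ma; rewrite {1}z1E ipDr// ipZr.
  have s2 (a : X) : ip_mem X a -> ip X a z2 = 2 * ip X a uq + ip X a e2.
    by move=> ma; rewrite {1}z2E ipDr// ipZr.
  rewrite -(adj mg mz1) -(adj mg me1) !s1// s2// liftB.
  by rewrite !ipBl//; ring.
have M0 : 0 <= M by exact: le_trans (ipnorm_ge0 _) wM.
have b1 : ip X (f - d0) wq <= ipnorm (d0 - f) * M.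
  apply: le_trans (ler_norm _) _; apply: le_trans (cauchy_schwarz HX (memB HX mf md) mw) _.
  by rewrite (ipnormC HX mf md) ler_wpM2l// ipnorm_ge0.
have b2 : - ip X (lift (g - e0)) wq <= ipnorm (e0 - g) * M.
  have mgd := memB HX0 mg me.
  apply: le_trans (ler_norm _) _; rewrite normrN.
  apply: le_trans (cauchy_schwarz HX (lift_mem mgd) mw) _.
  by rewrite ipnorm_lift// (ipnormC HX0 mg me) ler_wpM2l// ipnorm_ge0.
have b3 : ip X (f - d0) uq <= ipnorm (d0 - f) * M.
  apply: le_trans (ler_norm _) _; apply: le_trans (cauchy_schwarz HX (memB HX mf md) mu) _.
  by rewrite (ipnormC HX mf md) ler_wpM2l// ipnorm_ge0.
have c1 : ip X f e1 <= bf * h.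
  apply: le_trans (ler_norm _) _; apply: le_trans (hf _ me1) _; by rewrite ler_wpM2l.
have c2 : - ip X0 g (L e1) <= bg * h.
  apply: le_trans (ler_norm _) _; rewrite normrN.
  apply: le_trans (hg _ (L_mem me1)) _.
  by rewrite ler_wpM2l// (le_trans (ipnorm_L me1)).
have c3 : ip X f e2 <= bf * h.
  apply: le_trans (ler_norm _) _; apply: le_trans (hf _ me2) _; by rewrite ler_wpM2l.
have b3' := ler_wpM2l C0 b3; have c3' := ler_wpM2l C0 c3.
have gC : 0 <= ipnorm (e0 - g) * (C * M) by rewrite mulr_ge0 ?ipnorm_ge0// mulr_ge0.
rewrite phiE; exact: (dissip_pointwise_arith diss b1 b2 b3' c1 c2 c3' gC).
Qed.

Context (T : R) (u du : R -> X) (v dv : R -> X0) (C : R).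
Hypothesis T0 : 0 < T.
Hypothesis C0 : 0 <= C.
Hypothesis mu : forall t, 0 <= t <= T -> ip_mem X (u t).
Hypothesis cu : forall t, 0 <= t <= T -> ipnorm (u s - u t) @[s --> within `[0, T] (nbhs t)] --> 0.
Hypothesis Wu : W11loc T u du.
Hypothesis mv : forall t, 0 <= t <= T -> ip_mem X0 (v t).
Hypothesis cv : forall t, 0 <= t <= T -> ipnorm (v s - v t) @[s --> within `[0, T] (nbhs t)] --> 0.
Hypothesis Wv : W11loc T v dv.
Hypothesis dissip : {ae leb, forall q : R, 0 < q < T ->
  ip X (du q - lift (dv q)) (u q - lift (v q)) + C * ip X (du q) (u q) <= 0}.

Let w r := u r - lift (v r).
(** The energy whose decrease bounds the distance between the flows. *)
Definition energyQ r := ip X (u r - lift (v r)) (u r - lift (v r)) + C * ip X (u r) (u r).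

Let mw t : 0 <= t <= T -> ip_mem X (w t).
Proof. by move=> tT; apply: memB => //; [exact: mu|apply: lift_mem; exact: mv]. Qed.

Let lift_B x y : 0 <= x <= T -> 0 <= y <= T -> w x - w y = (u x - u y) - lift (v x - v y).
Proof. by move=> xT yT; rewrite /w liftB !opprD !opprK addrACA. Qed.

Let wdist x y : 0 <= x <= T -> 0 <= y <= T -> ipnorm (w x - w y) <= ipnorm (u x - u y) + ipnorm (v x - v y).
Proof.
move=> xT yT; rewrite lift_B//.
have m1 := memB HX (mu xT) (mu yT); have m2 := memB HX0 (mv xT) (mv yT).
by apply: le_trans (ipnormB HX m1 (lift_mem m2)) _; rewrite ipnorm_lift.
Qed.

Let ip_diffsq a b : ip_mem X a -> ip_mem X b -> ip X (a - b) (a + b) = ip X a a - ip X b b.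
Proof.
move=> ma mb; rewrite ipBl//; last exact: memD.
by rewrite !ipDr// (ipC HX mb ma); ring.
Qed.

(** A difference of squares is the pairing of an increment with a sum of end
    values; the increments are then integrals of derivatives. *)
Lemma energyQ_diff x y : 0 <= x <= T -> 0 <= y <= T ->
  energyQ y - energyQ x = ip X (u y - u x) (w y + w x) - ip X0 (v y - v x) (L (w y + w x)) + C * ip X (u y - u x) (u y + u x).
Proof.
move=> xT yT; have ux := mu xT; have uy := mu yT; have vx := mv xT; have vy := mv yT.
have wx := mw xT; have wy := mw yT.
have mz := memD HX wy wx; have mvv := memB HX0 vy vx.
rewrite -adj// -ipBl//; [|exact: memB|exact: lift_mem].
rewrite -lift_B// /energyQ -/(w x) -/(w y).
by rewrite !ip_diffsq//; ring.
Qed.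

(** The weak derivative is integrable on ]a, T[ only for positive [a]. The
    right hand sides of the estimate of [main] tend to 0 along the
    approximating step functions. *)
Lemma energyQ_interior s t : 0 < s -> s <= t -> t < T -> energyQ t <= energyQ s.
Proof.
move=> s0 st tT.
have [Mu Mu0 HMu] := curve_norm_bounded HX mu cu (ltW T0).
have [Mv Mv0 HMv] := curve_norm_bounded HX0 mv cv (ltW T0).
pose M := Mu + Mv.
have M0 : 0 <= M by rewrite addr_ge0.
have uM q : 0 <= q <= T -> ipnorm (u q) <= M by move=> qT; rewrite (le_trans (HMu q qT))// lerDl.
have wM q : 0 <= q <= T -> ipnorm (w q) <= M.
  move=> qT; apply: le_trans (ipnormB HX (mu qT) (lift_mem (mv qT))) _.
  rewrite ipnorm_lift; last exact: mv.
  by apply: lerD; [exact: HMu|exact: HMv].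
pose a := s / 2.
have a0 : 0 < a by rewrite divr_gt0.
have as_ : a < s by rewrite /a; lra.
have aT : 0 < a < T by rewrite a0; apply: lt_trans as_ (le_lt_trans st tT).
have [fs [mdu mfs cfs Hfs]] := primitive_estimate HX mu cu Wu aT.
have [gs [mdv mgs cgs Hgs]] := primitive_estimate HX0 mv cv Wv aT.
pose D := `]a, T[%classic : set (measurableTypeR R).
have mD : measurable D by exact: measurable_itv.
pose df k r := ipnorm (du r - step_fun (fs k) r).
pose dg k r := ipnorm (dv r - step_fun (gs k) r).
pose K := 4 * M + 4 * (C * M).
have CM0 : 0 <= C * M by rewrite mulr_ge0.
have K0 : 0 <= K by rewrite addr_ge0// mulr_ge0.
have main k delta : 0 < delta -> leb.-integrable D (EFin \o df k) -> leb.-integrable D (EFin \o dg k) ->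
   energyQ t - energyQ s <= K * \int[leb]_(r in `]s, t]) (df k r + dg k r) + delta * (t - s).
  move=> delta0 idf idg.
  have idfg : leb.-integrable D (EFin \o (fun r => df k r + dg k r)) by exact: (integrableD mD idf idg).
  (* The increments of [Hh] bound those of the energy; subtracting it leaves a
     nonincreasing function. *)
  pose Hh r := K * \int[leb]_(q in `]s, r]) (df k q + dg k q) + delta * (r - s).
  have sub x y : a < x -> y < T -> `]x, y] `<=` D.
    by move=> ax yT q; rewrite /D /= !in_itv/= => /andP[? ?]; apply/andP; split; lra.
  have HB x y : s <= x -> x <= y -> y <= t ->
     Hh y - Hh x = K * \int[leb]_(q in `]x, y]) (df k q + dg k q) + delta * (y - x).
    move=> sx xy yt.
    have := @Rintegral_itvB R (fun q => df k q + dg k q) (BRight s) (BRight y) x.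
    move=> <-; first by rewrite /Hh; ring.
    - apply: (@integrableS _ _ _ leb D `]s, y] _ mD _ _ idfg); first exact: measurable_itv.
      by apply: sub => //; exact: le_lt_trans yt tT.
    - by rewrite bnd_simp.
    - by rewrite bnd_simp.
  suff : energyQ t - Hh t <= energyQ s - Hh s.
    have : Hh s = 0 by rewrite /Hh set_itvoc0 Rintegral_set0 mulr0 subrr mulr0 addr0.
    move=> ->; rewrite subr0 lerBlDr => H; rewrite lerBlDl; exact: H.
  apply: (@local_nonincreasing (fun r => energyQ r - Hh r)) => // r /andP[sr rt].
  have rT : 0 <= r <= T by apply/andP; split; lra.
  pose B := step_bound (fs k) + step_bound (gs k) + C * step_bound (fs k) + 1.
  have Bf := step_bound_ge0 (fs k); have Bg := step_bound_ge0 (gs k).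
  have B0 : 0 < B by rewrite /B ltr_wpDl// !addr_ge0// mulr_ge0.
  (* The oscillation allowed on a short interval, so that the error [8 * e * B]
     is the slope [delta]. *)
  pose e := delta / (8 * B).
  have e0 : 0 < e by rewrite divr_gt0// mulr_gt0.
  have [d1 d10 H1] := curve_continuous_eps cu rT e0.
  have [d2 d20 H2] := curve_continuous_eps cv rT e0.
  exists (Num.min d1 d2); first by rewrite lt_min d10 d20.
  move=> x y sx xr ry yt.
  rewrite ltrBlDr -ltrBlDl => dx; rewrite -ltrBlDl => dy.
  have inT q : x <= q -> q <= y -> 0 <= q <= T by move=> xq qy; rewrite (le_trans (ltW s0) (le_trans sx xq)) (ltW (le_lt_trans (le_trans qy yt) tT)).
  have near_r q : x <= q -> q <= y -> ipnorm (u q - u r) <= e /\ ipnorm (w q - w r) <= 2 * e.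
    move=> xq qy; have qT := inT q xq qy.
    have : `|q - r| < Num.min d1 d2.
      exact: (dist_lt_within xq qy dx dy).
    rewrite lt_min => /andP[q1 q2].
    have h1 := H1 q qT q1; have h2 := H2 q qT q2; split => //.
    exact: le_sum2 (wdist qT rT) h1 h2.
  have xy := le_trans xr ry.
  have [->|xney] := eqVneq x y; first by [].
  have {}xy' : x < y by rewrite lt_def eq_sym xney.
  have xT := inT x (lexx x) xy; have yT := inT y xy (lexx y).
  have H0 := HB x y sx xy yt.
  suff : energyQ y - energyQ x <= Hh y - Hh x by lra.
  rewrite H0 {H0}.
  pose J := `]x, y]%classic : set (measurableTypeR R).
  have mJ : measurable J by exact: measurable_itv.
  have fJ : leb J = (y - x)%:E by rewrite /J lebesgue_measure_itv/= lte_fin xy' EFinB.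
  have fJ' : (leb J < +oo)%E by rewrite [X in (X < _)%E]fJ ltry.
  have ax : a < x by exact: lt_le_trans as_ sx.
  have yT' : y < T by exact: le_lt_trans yt tT.
  have JD : J `<=` D by exact: sub.
  have wx := mw xT; have wy := mw yT; have ux := mu xT; have uy := mu yT.
  pose z1 := w y + w x; pose z2 := u y + u x.
  have mz1 : ip_mem X z1 by exact: memD.
  have mz2 : ip_mem X z2 by exact: memD.
  have mLz1 := L_mem mz1.
  have nz1 : ipnorm z1 <= 2 * M.
    exact: le_sum2 (ipnormD HX wy wx) (wM y yT) (wM x xT).
  have nz2 : ipnorm z2 <= 2 * M.
    exact: le_sum2 (ipnormD HX uy ux) (uM y yT) (uM x xT).
  have E1 := Hfs k idf x y z1 ax xy' yT' mz1.
  have E2 := Hfs k idf x y z2 ax xy' yT' mz2.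
  have E3 := Hgs k idg x y (L z1) ax xy' yT' mLz1.
  have idfJ : leb.-integrable J (EFin \o df k) by apply: (@integrableS _ _ _ leb D J _ mD mJ JD idf).
  have idgJ : leb.-integrable J (EFin \o dg k) by apply: (@integrableS _ _ _ leb D J _ mD mJ JD idg).
  have idfgJ : leb.-integrable J (EFin \o (fun q => df k q + dg k q)) by apply: (@integrableS _ _ _ leb D J _ mD mJ JD idfg).
  have istep (Y : ipSpace R) (HY : is_hilbert Y) (ss : stepFun Y) z : ip_mem Y z ->
      leb.-integrable J (EFin \o (fun q => ip Y (step_fun ss q) z)).
    move=> mz; apply: (@bounded_integrable _ _ R leb J _ (step_bound ss * ipnorm z) mJ fJ').
      by apply: (@measurable_ip_step R Y HY ss J (fun=> z) mJ).
    by move=> q _; exact: ip_step_le.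
  have i1 := istep X HX (fs k) z1 mz1; have i2 := istep X HX (fs k) z2 mz2.
  have i3 := istep X0 HX0 (gs k) (L z1) mLz1.
  have df0 q : 0 <= df k q by exact: ipnorm_ge0.
  have dg0 q : 0 <= dg k q by exact: ipnorm_ge0.
  pose If := \int[leb]_(q in J) df k q; pose Ig := \int[leb]_(q in J) dg k q.
  have If0 : 0 <= If by apply: Rintegral_ge0.
  have Ig0 : 0 <= Ig by apply: Rintegral_ge0.
  have Ifg : \int[leb]_(q in J) (df k q + dg k q) = If + Ig by rewrite (@RintegralD _ _ _ leb J _ _ mJ idfJ idgJ).
  pose phi1 q := ip X (step_fun (fs k) q) z1 - ip X0 (step_fun (gs k) q) (L z1) + C * ip X (step_fun (fs k) q) z2.
  have iC : leb.-integrable J (EFin \o (fun q => C * ip X (step_fun (fs k) q) z2)).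
    exact: (@integrable_scale _ _ R leb J C _ mJ i2).
  have i13 : leb.-integrable J (EFin \o (fun q => ip X (step_fun (fs k) q) z1 - ip X0 (step_fun (gs k) q) (L z1))).
    exact: (integrableB mJ i1 i3).
  have iphi1 : leb.-integrable J (EFin \o phi1) by exact: (integrableD mJ i13 iC).
  have Ephi1 : \int[leb]_(q in J) phi1 q = \int[leb]_(q in J) ip X (step_fun (fs k) q) z1 -
     \int[leb]_(q in J) ip X0 (step_fun (gs k) q) (L z1) + C * \int[leb]_(q in J) ip X (step_fun (fs k) q) z2.
    rewrite (@RintegralD _ _ _ leb J _ _ mJ i13 iC) (@RintegralB _ _ _ leb J _ _ mJ i1 i3).
    by rewrite (@RintegralZl _ _ _ leb J _ C mJ i2).
  pose phi2 q := (2 * M + 2 * (C * M)) * (df k q + dg k q) + delta.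
  have idc : leb.-integrable J (fun=> delta%:E) by exact: (@cst_integrable _ _ R leb J delta mJ fJ').
  have iKd : leb.-integrable J (EFin \o (fun q => (2 * M + 2 * (C * M)) * (df k q + dg k q))).
    exact: (@integrable_scale _ _ R leb J (2 * M + 2 * (C * M)) _ mJ idfgJ).
  have iphi2 : leb.-integrable J (EFin \o phi2) by exact: (integrableD mJ iKd idc).
  have Ephi2 : \int[leb]_(q in J) phi2 q = (2 * M + 2 * (C * M)) * (If + Ig) + delta * (y - x).
    rewrite (@RintegralD _ _ _ leb J _ _ mJ iKd idc) (@RintegralZl _ _ _ leb J _ _ mJ idfgJ) Ifg.
    by rewrite Rintegral_cst// [X in fine X]fJ.
  have le12 : \int[leb]_(q in J) phi1 q <= \int[leb]_(q in J) phi2 q.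
    apply: ae_le_Rintegral => //; move: dissip.
    apply: filterS; first exact: (ae_filter_ringOfSetsType leb).
    move=> q diss Jq.
    have [xq qy] : x < q /\ q <= y by move: Jq; rewrite /J /= in_itv/= => /andP[].
    have qT := inT q (ltW xq) qy.
    have aq : a < q < T by rewrite (lt_trans ax xq) (le_lt_trans qy yT').
    have q0T : 0 < q < T by case/andP: aq => aq ->; rewrite (lt_trans a0 aq).
    have {}diss := diss q0T.
    have mdu' := mdu q aq; have mdv' := mdv q aq.
    have uq := mu qT; have wq := mw qT.
    have dwq p : x <= p -> p <= y -> ipnorm (w p - w q) <= 2 * (2 * e) /\ ipnorm (u p - u q) <= 2 * e.
      move=> xp py; have [p1 p2] := near_r p xp py; have [q1 q2] := near_r q (ltW xq) qy.
      have pT := inT p xp py.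
      split; first exact: le_sum2 (ipnorm_tri HX (mw pT) (mw qT) (mw rT)) p2 q2.
      exact: le_sum2 (ipnorm_tri HX (mu pT) (mu qT) (mu rT)) p1 q1.
    have ne1 : ipnorm (z1 - 2 *: w q) <= 8 * e.
      have [y1 _] := dwq y xy (lexx y); have [x1 _] := dwq x (lexx x) xy.
      rewrite /z1 scaler_nat mulr2n opprD addrACA.
      have -> : 8 * e = 2 * (2 * (2 * e)) by ring.
      exact: le_sum2 (ipnormD HX (memB HX wy wq) (memB HX wx wq)) y1 x1.
    have ne2 : ipnorm (z2 - 2 *: u q) <= 8 * e.
      have [_ y1] := dwq y xy (lexx y); have [_ x1] := dwq x (lexx x) xy.
      rewrite /z2 scaler_nat mulr2n opprD addrACA.
      apply: (le_trans (le_sum2 (ipnormD HX (memB HX uy uq) (memB HX ux uq)) y1 x1)).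
      by rewrite mulrA ler_pM2r// -natrM ler_nat.
    have := dissip_pointwise C0 (mem_step HX (fs k) q) mdu' (mem_step HX0 (gs k) q) mdv' wq uq mz1 mz2 diss (wM q qT) (uM q qT)
      (step_bound_ge0 (fs k)) (step_bound_ge0 (gs k)) (fun z => @ip_step_le _ _ HX (fs k) z q) (fun z => @ip_step_le _ _ HX0 (gs k) z q) ne1 ne2.
    move=> /le_trans; apply; rewrite /phi2 lerD2l.
    have eB : 8 * e * B = delta by rewrite /e; field; rewrite gt_eqF.
    rewrite -eB mulrC ler_wpM2l//; first by rewrite mulr_ge0// ltW.
    by rewrite /B lerDl.
  rewrite energyQ_diff// -/z1 -/z2 Ifg.
  move: E1 E2 E3; rewrite -/J -/(df k) -/(dg k) -/If -/Ig => E1 E2 E3.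
  have F1 : ip X (u y - u x) z1 - \int[leb]_(q in J) ip X (step_fun (fs k) q) z1 <= 2 * M * If.
    by apply: le_trans (ler_norm _) _; apply: le_trans E1 _; rewrite ler_wpM2r.
  have F2 : ip X (u y - u x) z2 - \int[leb]_(q in J) ip X (step_fun (fs k) q) z2 <= 2 * M * If.
    by apply: le_trans (ler_norm _) _; apply: le_trans E2 _; rewrite ler_wpM2r.
  have F3 : - (ip X0 (v y - v x) (L z1) - \int[leb]_(q in J) ip X0 (step_fun (gs k) q) (L z1)) <= 2 * M * Ig.
    apply: le_trans (ler_norm _) _; rewrite normrN; apply: le_trans E3 _; rewrite ler_wpM2r//.
    by apply: le_trans (ipnorm_L mz1) nz1.
  have F2' := ler_wpM2l C0 F2.
  move: le12; rewrite Ephi1 Ephi2 => le12.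
  have CI : 0 <= C * M * Ig by rewrite mulr_ge0.
  exact: (energy_arith F1 F2' F3 le12 CI).
pose eta k := (\int[leb]_(r in D) (df k r)%:E + \int[leb]_(r in D) (dg k r)%:E)%E.
have ceta : eta k @[k --> \oo] --> 0%E.
  by rewrite -[X in _ --> X]adde0; apply: cvgeD; [by []|exact: cfs|exact: cgs].
apply/ler_addgt0Pl => e e0; rewrite -lerBlDr.
have tss : 0 <= t - s by rewrite subr_ge0.
pose e' := e / (2 * (K + 1)).
have e'0 : 0 < e' by rewrite divr_gt0// mulr_gt0// ltr_wpDl.
have [k [ki kj kl]] : exists k, [/\ leb.-integrable D (EFin \o df k), leb.-integrable D (EFin \o dg k) &
    \int[leb]_(r in D) (df k r + dg k r) <= e'].
  have /fine_cvgP[_ /cvgrPdist_le/(_ _ e'0)] := ceta.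
  have : \forall k \near \oo, eta k \is a fin_num by case/fine_cvgP : ceta.
  move=> N1 N2; have [k [k1 k2]] := @filter_ex _ \oo _ _ (filterI N1 N2).
  exists k.
  have mdf : measurable_fun D (df k) by exact: mfs.
  have mdg : measurable_fun D (dg k) by exact: mgs.
  have [f1 f2] : (\int[leb]_(r in D) (df k r)%:E)%E \is a fin_num /\ (\int[leb]_(r in D) (dg k r)%:E)%E \is a fin_num.
    by apply/andP; rewrite -fin_numD.
  have idf : leb.-integrable D (EFin \o df k).
    apply/integrableP; split; first exact/measurable_EFinP.
    under eq_integral do rewrite /= ger0_norm ?ipnorm_ge0//.
    by rewrite ltey_eq f1.
  have idg : leb.-integrable D (EFin \o dg k).
    apply/integrableP; split; first exact/measurable_EFinP.
    under eq_integral do rewrite /= ger0_norm ?ipnorm_ge0//.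
    by rewrite ltey_eq f2.
  split => //; rewrite (@RintegralD _ _ _ leb D _ _ mD idf idg) /Rintegral -fineD//.
  by move: k2; rewrite sub0r normrN; apply: le_trans; exact: ler_norm.
have stD : `]s, t] `<=` D.
  by move=> q; rewrite /D /= !in_itv/= => /andP[? ?]; apply/andP; split; lra.
pose delta := e / (2 * (t - s + 1)).
have delta0 : 0 < delta by rewrite divr_gt0// mulr_gt0// ltr_wpDl.
apply: le_trans (main k delta delta0 ki kj) _.
have I1 : \int[leb]_(r in `]s, t]) (df k r + dg k r) <= e'.
  apply: le_trans kl; apply: (@Rintegral_subset _ _ R leb `]s, t] D (fun r => df k r + dg k r) _ mD stD); first exact: measurable_itv.
    exact: (integrableD mD ki kj).
  by move=> r _; rewrite addr_ge0 ?ipnorm_ge0.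
have KI := ler_wpM2l K0 I1.
have h1 : K * e' <= e / 2.
  rewrite /e' invfM !mulrA; have : K * (K + 1)^-1 <= 1 by rewrite ler_pdivrMr ?mul1r ?lerDl// ltr_wpDl.
  have -> : K * e / 2 / (K + 1) = e / 2 * (K * (K + 1)^-1) by ring.
  by move=> h; rewrite ler_piMr// ltW// divr_gt0.
have h2 : delta * (t - s) <= e / 2.
  rewrite /delta invfM !mulrA.
  have : (t - s) * (t - s + 1)^-1 <= 1 by rewrite ler_pdivrMr ?mul1r ?lerDl// ltr_wpDl.
  have -> : e / 2 / (t - s + 1) * (t - s) = e / 2 * ((t - s) * (t - s + 1)^-1) by ring.
  by move=> h; rewrite ler_piMr// ltW// divr_gt0.
by rewrite [leRHS](splitr e); apply: lerD => //; exact: le_trans KI h1.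
Qed.

Lemma energyQ_continuous r e : 0 <= r <= T -> 0 < e ->
  exists2 d, 0 < d & forall q, 0 <= q <= T -> `|q - r| < d -> `|energyQ q - energyQ r| < e.
Proof.
move=> rT e0.
have [Mu Mu0 HMu] := curve_norm_bounded HX mu cu (ltW T0).
have [Mv Mv0 HMv] := curve_norm_bounded HX0 mv cv (ltW T0).
pose M := Mu + Mv.
have M0 : 0 <= M by rewrite addr_ge0.
have uM q : 0 <= q <= T -> ipnorm (u q) <= M by move=> qT; rewrite (le_trans (HMu q qT))// lerDl.
have wM q : 0 <= q <= T -> ipnorm (w q) <= M.
  move=> qT; apply: le_trans (ipnormB HX (mu qT) (lift_mem (mv qT))) _.
  rewrite ipnorm_lift; last exact: mv.
  by apply: lerD; [exact: HMu|exact: HMv].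
pose K := 2 * M * 2 + C * (2 * M) + 1.
have K1 : 0 <= 2 * M * 2 + C * (2 * M) by rewrite addr_ge0 ?mulr_ge0.
have K0 : 0 < K by rewrite /K ltr_wpDl.
have d0 : 0 < e / K by rewrite divr_gt0.
have [d1 d10 H1] := curve_continuous_eps cu rT d0.
have [d2 d20 H2] := curve_continuous_eps cv rT d0.
exists (Num.min d1 d2); first by rewrite lt_min d10.
move=> q qT; rewrite lt_min => /andP[/(H1 _ qT) h1 /(H2 _ qT) h2].
have z1 : ipnorm (w q + w r) <= 2 * M := le_sum2 (ipnormD HX (mw qT) (mw rT)) (wM q qT) (wM r rT).
have z2 : ipnorm (u q + u r) <= 2 * M := le_sum2 (ipnormD HX (mu qT) (mu rT)) (uM q qT) (uM r rT).
have mz1 : ip_mem X (w q + w r) by exact: memD (mw qT) (mw rT).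
have mz2 : ip_mem X (u q + u r) by exact: memD (mu qT) (mu rT).
have mdu : ip_mem X (u q - u r) by exact: memB (mu qT) (mu rT).
have mdv : ip_mem X0 (v q - v r) by exact: memB (mv qT) (mv rT).
have mLz := L_mem mz1.
have b1 : `|ip X (u q - u r) (w q + w r)| <= e / K * (2 * M).
  apply: le_trans (cauchy_schwarz HX mdu mz1) _; apply: ler_pM => //; exact: ipnorm_ge0.
have b2 : `|ip X0 (v q - v r) (L (w q + w r))| <= e / K * (2 * M).
  apply: le_trans (cauchy_schwarz HX0 mdv mLz) _; apply: ler_pM => //; [exact: ipnorm_ge0|exact: ipnorm_ge0|].
  exact: le_trans (ipnorm_L mz1) z1.
have b3 : `|ip X (u q - u r) (u q + u r)| <= e / K * (2 * M).
  apply: le_trans (cauchy_schwarz HX mdu mz2) _; apply: ler_pM => //; exact: ipnorm_ge0.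
rewrite energyQ_diff//.
apply: (@le_lt_trans _ _ (e / K * (2 * M * 2 + C * (2 * M)))); last first.
  by rewrite -mulrA gtr_pMr// ltr_pdivrMl// mulr1 /K ltrDl.
apply: le_trans (ler_normD _ _) _.
have -> : e / K * (2 * M * 2 + C * (2 * M)) = (e / K * (2 * M) + e / K * (2 * M)) + C * (e / K * (2 * M)) by ring.
apply: lerD; first by apply: le_trans (ler_normB _ _) _; exact: lerD.
by rewrite normrM ger0_norm// ler_wpM2l.
Qed.

(** The end points are reached by continuity. *)
Lemma energyQ_le0 t : 0 <= t <= T -> energyQ t <= energyQ 0.
Proof.
move=> tT; have /andP[t0 tT'] := tT.
have [->//|tn0] := eqVneq t 0.
have {}t0 : 0 < t by rewrite lt_neqAle eq_sym tn0.
have z0T : (0 : R) <= 0 <= T by rewrite lexx ltW.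
apply/ler_addgt0Pr => e e0; have e20 : 0 < e / 2 by rewrite divr_gt0.
have [d1 d10 H1] := energyQ_continuous z0T e20.
have [d2 d20 H2] := energyQ_continuous tT e20.
pose s := Num.min (t / 2) (d1 / 2); pose r := Num.max (t / 2) (t - d2 / 2).
have t20 : 0 < t / 2 by rewrite divr_gt0.
have t2t : t / 2 < t by rewrite ltr_pdivrMr// ltr_pMr// ltr1n.
have s0 : 0 < s by rewrite /s lt_min t20 divr_gt0.
have st : s <= t / 2 by rewrite /s ge_min lexx.
have sd : s < d1 by apply: (@le_lt_trans _ _ (d1 / 2)); [rewrite /s ge_min lexx orbT|rewrite ltr_pdivrMr// ltr_pMr// ltr1n].
have rt : r < t by rewrite /r gt_max t2t gtrDl oppr_lt0 divr_gt0.
have tr : t / 2 <= r by rewrite /r le_max lexx.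
have rd : t - r < d2.
  have : t - d2 / 2 <= r by rewrite /r le_max lexx orbT.
  rewrite lerBlDr -lerBlDl => /le_lt_trans; apply; by rewrite ltr_pdivrMr// ltr_pMr// ltr1n.
have sr : s <= r by exact: le_trans st tr.
have sT : 0 <= s <= T by rewrite (ltW s0) (le_trans sr)// (le_trans (ltW rt)).
have rT : 0 <= r <= T by rewrite (le_trans (ltW s0) sr) (le_trans (ltW rt)).
have Q1 : `|energyQ s - energyQ 0| < e / 2 by apply: H1 => //; rewrite subr0 gtr0_norm.
have Q2 : `|energyQ r - energyQ t| < e / 2 by apply: H2 => //; rewrite distrC gtr0_norm// subr_gt0.
have Q3 := energyQ_interior s0 sr (lt_le_trans rt tT').
have Q1' : energyQ s <= energyQ 0 + e / 2.
  by rewrite -lerBlDl (le_trans (ler_norm _))// ltW.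
have Q2' : energyQ t <= energyQ r + e / 2.
  by rewrite -lerBlDl (le_trans (ler_norm _))// distrC ltW.
apply: (le_trans Q2'); rewrite [in leRHS](splitr e) addrA lerD2r.
exact: le_trans Q3 Q1'.
Qed.
End energy.

(** * Completeness and a lower bound for the weight *)

Section hilbert_limits.
Context {R : realType} {X : ipSpace R} (HX : is_hilbert X).

(** A geometric form of completeness. *)
Lemma fast_cauchy_cvg (u : nat -> X) : (forall k, ip_mem X (u k)) ->
  (forall k, ipnorm (u k.+1 - u k) <= 2^-1 ^+ k) ->
  exists2 l, ip_mem X l & ipnorm (u k - l) @[k --> \oo] --> 0.
Proof.
move=> mu du.
have step j k : ipnorm (u (j + k)%N - u j) <= 2 * 2^-1 ^+ j - 2 * 2^-1 ^+ (j + k).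
  elim: k => [|k IH].
    rewrite addn0 !subrr -(scale0r (u 0%N)) ipnormZ//.
    by rewrite normr0 mul0r.
  rewrite addnS -(subrK (u (j + k)%N) (u (j + k).+1)) -addrA.
  apply: le_trans (ipnormD HX (memB HX (mu _) (mu _)) (memB HX (mu _) (mu _))) _.
  apply: le_trans (lerD (du _) IH) _.
  rewrite exprS mulrA divff// mul1r; lra.
case: HX => _ _ _ _; apply => // e e0.
have : (fun k => 2 * 2^-1 ^+ k : R) @ \oo --> (2 * 0 : R).
  by apply: cvgM; [exact: cvg_cst|apply: cvg_expr; rewrite ger0_norm// invf_lt1// ltr1n].
rewrite mulr0 => /cvgrPdist_lt/(_ _ e0)[N _ HN].
have H j k : (N <= j)%N -> (j <= k)%N -> ipnorm (u k - u j) < e.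
  move=> Nj jk; rewrite -(subnKC jk); apply: le_lt_trans (step _ _) _.
  have := HN j Nj; rewrite /= sub0r normrN ger0_norm ?mulr_ge0 ?exprn_ge0//.
  by apply: le_lt_trans; rewrite lerBlDr lerDl mulr_ge0// exprn_ge0.
exists N => j k Nj Nk; case/orP: (leq_total j k) => jk; last exact: H.
by rewrite ipnormC//; apply: H.
Qed.

Lemma ip_cvg_weak (u : nat -> X) l z : (forall k, ip_mem X (u k)) -> ip_mem X l -> ip_mem X z ->
  ipnorm (u k - l) @[k --> \oo] --> 0 -> ip X (u k) z @[k --> \oo] --> ip X l z.
Proof.
move=> mu ml mz cu; apply/cvgrPdist_le => e e0.
have e'0 : 0 < e / (ipnorm z + 1) by rewrite divr_gt0// ltr_wpDl// ipnorm_ge0.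
have /cvgrPdist_le/(_ _ e'0) := cu; apply: filterS => k.
rewrite sub0r normrN ger0_norm ?ipnorm_ge0// => h.
rewrite distrC -ipBl//; apply: le_trans (cauchy_schwarz HX (memB HX (mu k) ml) mz) _.
apply: le_trans (ler_wpM2r (ipnorm_ge0 z) h) _.
rewrite mulrAC ler_pdivrMr; last by rewrite ltr_wpDl// ipnorm_ge0.
by rewrite ler_wpM2l ?(ltW e0)// lerDl.
Qed.

End hilbert_limits.

(** The number [a] is a value of an indicator function. *)
Lemma young_arith (R : realType) (q l a : R) : 0 < q -> (a == 0) || (a == 1) -> l * a <= l ^+ 2 / (2 * q) + q / 2 * a.
Proof.
move=> q0 /orP[] /eqP ->; first by rewrite !mulr0 addr0 divr_ge0 ?sqr_ge0// mulr_ge0// ltW.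
rewrite !mulr1 -subr_ge0.
have -> : l ^+ 2 / (2 * q) + q / 2 - l = (l - q) ^+ 2 / (2 * q) by field; rewrite gt_eqF.
by rewrite divr_ge0 ?sqr_ge0// mulr_ge0// ltW.
Qed.

Lemma bounded_Lp (R : realType) n (om : set 'rV[R]_n) p (u : 'rV[R]_n -> R) M :
  measurable om -> (lebesgue_rV om < +oo)%E -> 0 < p -> measurable_fun om u ->
  (forall x, om x -> `|u x| <= M) -> Lp om p u.
Proof.
move=> om_meas om_fin p0 mu_ uM; apply/LpP => //; split => //.
apply: (@le_lt_trans _ _ (\int[lebesgue_rV]_(x in om) (M `^ p)%:E)%E).
  apply: ge0_le_integral => //.
  - by apply/measurable_EFinP; apply: (measurableT_comp (measurable_powR p)); exact: measurableT_comp.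
  - by move=> x ox; rewrite lee_fin ge0_ler_powR ?(ltW p0) ?nnegrE//; [exact: le_trans (uM x ox)|exact: uM].
by rewrite integral_cst// lte_mul_pinfty// lee_fin powR_ge0.
Qed.

Section weight.
Context {R : realType} {n : nat} (om : set 'rV[R]_n) (gm gp : 'rV[R]_n -> R).
Let g x := gp x - gm x.
Let mu := @lebesgue_rV R n.
Hypothesis om_open : open om.
Hypothesis om_fin : (mu om < +oo)%E.
Hypothesis g_cont : {in om, continuous g}.
Hypothesis g_gt0 : forall x, om x -> 0 < g x.
Let X := limit_space om gm gp.
Hypothesis HX : is_hilbert X.

Let om_meas : measurable om. Proof. exact: open_measurable_rV. Qed.

Let g_meas : measurable_fun om g.
Proof. exact: open_continuous_measurable_rV. Qed.

Let B k := om `&` [set x | g x < (16^-1) ^+ k].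
Let A c k := B k `&` [set x | c <= g x].

Let mB k : measurable (B k).
Proof.
have := g_meas om_meas (measurable_itv (Interval -oo%O (BLeft ((16^-1) ^+ k)))).
by rewrite (_ : om `&` _ = B k)//; apply/seteqP; split => x /=; rewrite in_itv/=.
Qed.

Let mA c k : measurable (A c k).
Proof.
rewrite (_ : A c k = B k `&` (om `&` g @^-1` `[c, +oo[)).
  by apply: measurableI => //; apply: g_meas => //; exact: measurable_itv.
apply/seteqP; split => x /=; rewrite in_itv/= andbT => -[b ?]; split => //.
  by case: b.
by tauto.
Qed.

Let B_open k : open (B k).
Proof.
rewrite openE => x [ox gx]; apply: filterI; first exact: open_nbhs_nbhs.
have /cvgr_lt := @g_cont x (mem_set ox); exact.
Qed.

Let ind_mem (D : set 'rV[R]_n) : measurable D -> ip_mem X (\1_D : 'rV[R]_n -> R).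
Proof.
move=> mD; apply: (@bounded_Lp _ _ _ 2 _ 1) => //.
by move=> x _; rewrite indicE ger0_norm// lern1; case: (_ \in _).
Qed.

Let inv_mem c k : 0 < c -> ip_mem X (fun x => \1_(A c k) x / g x).
Proof.
move=> c0; apply: (@bounded_Lp _ _ _ 2 _ c^-1) => //.
  apply: measurable_funM; first exact: measurable_indic.
  apply: open_continuous_measurable_rV => // x ox; apply: continuousV; last exact: g_cont.
  by rewrite gt_eqF// g_gt0//; rewrite inE in ox.
move=> x ox; rewrite indicE; case: (boolP (_ \in _)) => [|_]; last by rewrite mul0r normr0 invr_ge0 ltW.
rewrite inE => -[_ cg]; rewrite mul1r ger0_norm ?invr_ge0 ?(ltW (g_gt0 ox))//.
by rewrite lef_pV2 ?posrE//; exact: g_gt0.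
Qed.

Let measure_fin (D : set 'rV[R]_n) : measurable D -> D `<=` om -> mu D \is a fin_num.
Proof.
move=> mD Dom; rewrite ge0_fin_numE//; apply: le_lt_trans om_fin.
by apply: le_measure => //; rewrite inE.
Qed.

Let ip_ind_inv (D : set 'rV[R]_n) c k : measurable D -> 0 < c ->
  ip X (\1_D : 'rV[R]_n -> R) (fun x => \1_(A c k) x / g x) = fine (mu (D `&` A c k)).
Proof.
move=> mD c0; rewrite /= /Rintegral; congr fine.
transitivity (\int[mu]_(x in om) (\1_(D `&` A c k) x)%:E)%E.
  apply: eq_integral => x; rewrite inE => /g_gt0 gx.
  by rewrite indicI/= -/(g x); congr EFin; field; rewrite gt_eqF.
rewrite integral_indic//; last exact: measurableI.
by congr (mu _); apply/seteqP; split => [x []//|x [dx [[ox gx] cx]]].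
Qed.

Lemma ind_norm k : ipnorm (\1_(B k) : X) <= 4^-1 ^+ k * Num.sqrt (fine (mu (B k))).
Proof.
have Bom : B k `<=` om by move=> x [].
have iB : mu.-integrable om (fun x => (\1_(B k) x)%:E).
  by apply: (indic_integrable om_meas (mB k)); rewrite -ge0_fin_numE// measure_fin.
have -> : 4^-1 ^+ k = Num.sqrt (16^-1 ^+ k : R).
  rewrite (_ : 16^-1 ^+ k = (4^-1 ^+ k) ^+ 2) ?sqrtr_sqr ?ger0_norm ?exprn_ge0//.
  by rewrite -exprM mulnC exprM; congr (_ ^+ k); field.
rewrite -sqrtrM ?exprn_ge0// /ipnorm ler_wsqrtr// /=.
rewrite [leRHS](_ : _ = \int[mu]_(x in om) (16^-1 ^+ k * \1_(B k) x)).
  apply: le_Rintegral => //.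
  - apply: (@bounded_integrable _ _ R mu om _ (16^-1 ^+ k)) => //.
      by apply: measurable_funM => //; apply: measurable_funM.
    move=> x ox; rewrite indicE; case: (boolP (_ \in _)) => [|_]; last by rewrite mulr0 normr0 exprn_ge0.
    by rewrite inE !mulr1 => -[_ /= gx]; rewrite ger0_norm ltW// g_gt0.
  - by apply: integrable_scale => //; exact: iB.
  move=> x ox; rewrite indicE; case: (boolP (_ \in _)) => [|_]; last by rewrite !mulr0.
  by rewrite inE !mulr1 => -[_ /ltW].
rewrite RintegralZl//.
by rewrite /Rintegral integral_indic// setIidl.
Qed.

(** Suppose that [g] has no positive lower bound. The sets [B k] where [g < 16
    ^ -k] are open and nonempty, hence of positive measure, and [q k] times the
    indicator function of [B k] has norm at most [2 ^ -k] in the weighted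
    space. The sum [l] of this series is an element of L^2, while its integral
    over each part [A c k] of [B k] where [c <= g] is at least [q k] times the
    measure of that part. By the Young inequality the square integral of [l] is
    at least [q k ^ 2 * mu (B k) = 4 ^ k] for every [k]. *)
Lemma weight_bounded_below : om !=set0 -> exists2 c, 0 < c & forall x, om x -> c <= g x.
Proof.
move=> om0; apply: contrapT => H.
have Bom k : B k `<=` om by move=> x [].
have B0 k : B k !=set0.
  apply: contrapT => Bk; apply: H; exists (16^-1 ^+ k); first by rewrite exprn_gt0.
  by move=> x ox; rewrite leNgt; apply/negP => gx; apply: Bk; exists x.
have fB k := measure_fin (mB k) (@Bom k).
have m0 k : 0 < fine (mu (B k)).
  by apply: fine_gt0; rewrite -ge0_fin_numE// fB andbT; exact: open_lebesgue_rV_gt0.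
(* The coefficient makes the square integral of each term equal to [4 ^ k]. *)
pose q k := 2 ^+ k / Num.sqrt (fine (mu (B k))).
have q0 k : 0 < q k by rewrite divr_gt0 ?exprn_gt0// sqrtr_gt0.
pose a k : X := q k *: (\1_(B k) : X).
have ma k : ip_mem X (a k) by apply: memZ => //; exact: ind_mem.
pose f N : X := \sum_(k < N) a k.
have mf N : ip_mem X (f N) by exact: mem_sum.
have df N : ipnorm (f N.+1 - f N) <= 2^-1 ^+ N.
  rewrite /f big_ord_recr/= addrAC subrr add0r /a ipnormZ//; last exact: ind_mem.
  rewrite ger0_norm ?(ltW (q0 N))//; apply: le_trans (ler_wpM2l (ltW (q0 N)) (ind_norm N)) _.
  rewrite /q mulrACA mulVf ?mulr1 ?gt_eqF ?sqrtr_gt0// -exprMn.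
  by rewrite (_ : 2 * 4^-1 = 2^-1 :> R)//; field.
have [l ml cl] := fast_cauchy_cvg HX mf df.
have /LpP[//|//|l_meas l_fin] : Lp om 2 l := ml.
pose La := \int[mu]_(x in om) (l x ^+ 2).
have il2 : mu.-integrable om (EFin \o (fun x => l x ^+ 2)).
  apply/integrableP; split; first by apply/measurable_EFinP; exact: measurable_funX.
  by move: l_fin; under eq_integral do rewrite powR_mulrn// -normrX//.
(* The bound [c] on the weight makes [1 / g] bounded on [A c k], hence a
   legitimate test vector; it is removed in [lim]. *)
have key k c : 0 < c -> q k ^+ 2 * fine (mu (A c k)) <= La.
  move=> c0; have mz := inv_mem k c0.
  have Aom : A c k `<=` om by move=> x [[]].
  have fA := measure_fin (mA c k) Aom.
  have low : q k * fine (mu (A c k)) <= ip X l (fun x => \1_(A c k) x / g x).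
    have cw := ip_cvg_weak HX mf ml mz cl.
    apply: (ler_cvg_to (cvg_cst _) cw); exists k.+1 => // N kN; have {}kN : (k < N)%N := kN.
    rewrite /f (ip_suml HX)// (bigD1 (Ordinal kN))// /a ipZl//; last exact: ind_mem.
    rewrite ip_ind_inv// (_ : B k `&` A c k = A c k); last by apply/seteqP; split => [x []//|x]; case.
    rewrite lerDl sumr_ge0// => j _; rewrite ipZl//; last exact: ind_mem.
    by rewrite ip_ind_inv// mulr_ge0 ?(ltW (q0 _)) ?fine_ge0.
  have : q k * fine (mu (A c k)) <= La / (2 * q k) + q k / 2 * fine (mu (A c k)).
    apply: (le_trans low); rewrite /=.
    rewrite [leLHS](_ : _ = \int[mu]_(x in om) (l x * \1_(A c k) x)); last first.
      apply: eq_Rintegral => x; rewrite inE => /g_gt0 gx.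
      by rewrite -/(g x); field; rewrite gt_eqF.
    have iA : mu.-integrable om (fun x => (\1_(A c k) x)%:E).
      by apply: (indic_integrable om_meas (mA c k)); rewrite -ge0_fin_numE.
    have i1 := @integrable_scale _ _ R mu om (2 * q k)^-1 _ om_meas il2.
    have i2 := @integrable_scale _ _ R mu om (q k / 2) _ om_meas iA.
    rewrite [leRHS](_ : _ = \int[mu]_(x in om) ((2 * q k)^-1 * l x ^+ 2 + q k / 2 * \1_(A c k) x)).
      apply: le_Rintegral => //.
      - apply: (@integrable_mulr_bounded _ _ R mu om _ _ 1) => //.
        + by apply: (Lp_integrable om_meas om_fin _ ml); rewrite ler1n.
        + by move=> x _; rewrite indicE ger0_norm// lern1; case: (_ \in _).
      - exact: (integrableD om_meas i1 i2).
      move=> x _; rewrite [_ * l x ^+ 2]mulrC; apply: young_arith => //.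
      by rewrite indicE; case: (_ \in _); rewrite eqxx ?orbT.
    rewrite (@RintegralD _ _ R mu om _ _ om_meas i1 i2) (@RintegralZl _ _ R mu om _ _ om_meas il2).
    rewrite (@RintegralZl _ _ R mu om _ _ om_meas iA) [La / _]mulrC; congr (_ + _ * _).
    by rewrite /Rintegral integral_indic// setIidl.
  have qk := q0 k; set m := fine _; set qq := q k in qk *.
  have -> : La / (2 * qq) = (La / qq) / 2 by field; rewrite gt_eqF.
  move=> h; have : qq * m <= La / qq by lra.
  by rewrite ler_pdivlMr// expr2 mulrAC.
have lim k : q k ^+ 2 * fine (mu (B k)) <= La.
  have qk := q0 k; rewrite mulrC -ler_pdivlMr ?exprn_gt0// -lee_fin fineK//.
  pose F j := A j.+1%:R^-1 k.
  have UF : \bigcup_j F j = B k.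
    apply/seteqP; split => [x [j _ []]//|x bx].
    have gx : 0 < g x by apply: g_gt0; case: bx.
    have [j _ Hj] := near_inv gx; exists j => //; split => //=.
    by apply: ltW; exact: Hj j (leqnn _).
  have : (mu \o F) j @[j --> \oo] --> mu (\bigcup_j F j).
    apply: nondecreasing_cvg_mu; [by move=> j; exact: mA|by rewrite UF|].
    move=> i j ij; apply/subsetPset => x [bx ix]; split => //=; apply: le_trans ix.
    by rewrite lef_pV2 ?posrE// ler_nat.
  rewrite UF => cF; apply: (cvge_le _ cF); exists 0%N => // j _ /=.
  have fA : mu (F j) \is a fin_num by apply: (measure_fin (mA _ k)) => x [[]].
  by rewrite -[X in (X <= _)%E]fineK// lee_fin ler_pdivlMr ?exprn_gt0// mulrC key.
have lim4 k : k%:R <= La.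
  apply: le_trans (lim k); rewrite /q expr_div_n sqr_sqrtr ?(ltW (m0 k))// divfK ?gt_eqF//.
  rewrite -exprM -natrX ler_nat; apply: leq_trans (ltnW (ltn_expl k (isT : (1 < 2)%N))) _.
  by rewrite leq_exp2l// leq_pmulr.
have La0 : 0 <= La := le_trans (ler0n _ 0) (lim4 0%N).
have := archi_boundP La0; rewrite ltNge => /negP; apply; exact: lim4.
Qed.

End weight.

(** * Jensen inequalities and averages over the fibres *)

(** Young inequality with conjugate exponents, written as convexity: it gives
    Jensen inequalities by integration. *)
Lemma powR_ge_tangent (R : realType) (q s m : R) : 1 <= q -> 0 <= s -> 0 <= m ->
  m `^ q + q * m `^ (q - 1) * (s - m) <= s `^ q.
Proof.
rewrite le_eqVlt => /predU1P[<-|q1] s0 m0.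
  by rewrite subrr powRr0 !powRr1// !mul1r subrKC.
have q0 : 0 < q by apply: lt_trans q1.
have q10 : 0 < q - 1 by rewrite subr_gt0.
have mm : m `^ q = m `^ (q - 1) * m.
  by rewrite -[X in _ * X]powRr1// -powRD ?subrK// gt_eqF.
have Y := @conjugate_powR _ s (m `^ (q - 1)) q (q / (q - 1)) s0 (powR_ge0 _ _) q0 (divr_gt0 q0 q10).
have : s * m `^ (q - 1) <= s `^ q / q + (m `^ (q - 1)) `^ (q / (q - 1)) / (q / (q - 1)).
  by apply: Y; field; rewrite !gt_eqF.
rewrite -powRrM [_ * (q / _)]mulrC divfK ?gt_eqF// => {}Y.
have E2 : m `^ q / (q / (q - 1)) * q = m `^ q * (q - 1) by field; rewrite !gt_eqF.
have := ler_wpM2r (ltW q0) Y; rewrite mulrDl divfK ?gt_eqF// E2.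
by rewrite !mm; nra.
Qed.

Lemma Rintegral_sum d (T : measurableType d) (R : realType) (mu : {measure set T -> \bar R})
    (D : set T) (I : Type) (s : seq I) (f : I -> T -> R) : measurable D ->
  (forall i, mu.-integrable D (EFin \o f i)) ->
  mu.-integrable D (EFin \o (fun x => \sum_(i <- s) f i x)) /\
  \int[mu]_(x in D) (\sum_(i <- s) f i x) = \sum_(i <- s) \int[mu]_(x in D) f i x.
Proof.
move=> mD fi; elim: s => [|i s [IH1 IH2]].
  rewrite big_nil; under eq_fun do rewrite big_nil.
  split; first exact: (@integrable0 _ _ _ mu D).
  by rewrite Rintegral_cst// mul0r.
rewrite big_cons; under eq_fun do rewrite big_cons.
split; first exact: (integrableD mD (fi i) IH1).
by rewrite (@RintegralD _ _ _ mu D _ _ mD (fi i) IH1) IH2.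
Qed.

Section mean.
Context d (T : measurableType d) (R : realType) (mu : {measure set T -> \bar R}).
Context (I : set T) (r : R) (mI : measurable I) (muI : mu I = r%:E) (r0 : 0 < r).

(** Jensen: integrate the tangent at the mean. *)
Lemma mean_powR (f : T -> R) q : 1 <= q -> mu.-integrable I (EFin \o f) ->
  mu.-integrable I (EFin \o (fun x => `|f x| `^ q)) ->
  `|r^-1 * \int[mu]_(x in I) f x| `^ q <= r^-1 * \int[mu]_(x in I) (`|f x| `^ q).
Proof.
move=> q1 fi fqi; pose m := r^-1 * \int[mu]_(x in I) `|f x|.
have iabs : mu.-integrable I (EFin \o (fun x => `|f x|)) by exact: (integrable_abse fi).
have ii : 0 <= \int[mu]_(x in I) `|f x| by apply: Rintegral_ge0.
have m0 : 0 <= m by rewrite mulr_ge0 ?invr_ge0// ltW.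
have q0 : 0 <= q by apply: le_trans q1.
have fI : (mu I < +oo)%E by rewrite muI ltry.
apply: (@le_trans _ _ (m `^ q)).
  rewrite ge0_ler_powR ?nnegrE// normrM ger0_norm ?invr_ge0 ?(ltW r0)//.
  by rewrite ler_wpM2l ?invr_ge0 ?(ltW r0)//; exact: le_normr_Rintegral.
rewrite ler_pdivlMl//.
have ic c := @cst_integrable _ _ R mu I c mI fI.
have i1 : mu.-integrable I (EFin \o (fun x => `|f x| - m)) by exact: (integrableB mI iabs (ic m)).
have i2 := @integrable_scale _ _ R mu I (q * m `^ (q - 1)) _ mI i1.
rewrite [leLHS](_ : _ = \int[mu]_(x in I) (m `^ q + q * m `^ (q - 1) * (`|f x| - m))).
  apply: le_Rintegral => //; first exact: (integrableD mI (ic _) i2).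
  by move=> x _; exact: powR_ge_tangent.
rewrite (@RintegralD _ _ _ mu I _ _ mI (ic _) i2) (@RintegralZl _ _ _ mu I _ _ mI i1).
rewrite (@RintegralB _ _ _ mu I _ _ mI iabs (ic _)) !Rintegral_cst// muI/=.
by rewrite /m; field; rewrite gt_eqF.
Qed.

(** Jensen for the Euclidean norm: pair the mean with itself and use Cauchy and
    Schwarz under the integral. *)
Lemma mean_enorm n (f : T -> 'rV[R]_n) :
  (forall i, mu.-integrable I (EFin \o (fun x => f x ord0 i))) ->
  mu.-integrable I (EFin \o (fun x => enorm (f x))) ->
  enorm (\row_i (r^-1 * \int[mu]_(x in I) f x ord0 i)) <= r^-1 * \int[mu]_(x in I) enorm (f x).
Proof.
move=> fi ei; set V := \row_i _.
have en0 (x : 'rV[R]_n) : 0 <= enorm x by exact: sqrtr_ge0.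
have sq0 (x : 'rV[R]_n) : 0 <= \sum_i x ord0 i ^+ 2 by apply: sumr_ge0 => i _; exact: sqr_ge0.
have ensq (x : 'rV[R]_n) : enorm x ^+ 2 = \sum_i x ord0 i ^+ 2 by rewrite sqr_sqrtr.
have [V0|V0] := eqVneq (enorm V) 0.
  by rewrite V0 mulr_ge0 ?invr_ge0 ?(ltW r0)// Rintegral_ge0.
have {}V0 : 0 < enorm V by rewrite lt_neqAle eq_sym V0 en0.
have CS (x : 'rV[R]_n) : \sum_i V ord0 i * x ord0 i <= enorm V * enorm x.
  pose a := enorm V; pose b := enorm x.
  have : 0 <= \sum_i (b * V ord0 i - a * x ord0 i) ^+ 2 by apply: sumr_ge0 => i _; exact: sqr_ge0.
  have -> : \sum_i (b * V ord0 i - a * x ord0 i) ^+ 2 = 2 * (a * b) * (a * b - \sum_i V ord0 i * x ord0 i).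
    transitivity (\sum_i (b ^+ 2 * V ord0 i ^+ 2 + a ^+ 2 * x ord0 i ^+ 2 - 2 * (a * b) * (V ord0 i * x ord0 i))).
      by apply: eq_bigr => i _; ring.
    by rewrite sumrB big_split/= -!mulr_sumr -!ensq -/a -/b; ring.
  have [b0|b0] := eqVneq b 0.
    move=> _; rewrite -/b b0 mulr0 big1// => i _.
    have : \sum_i x ord0 i ^+ 2 = 0 by rewrite -ensq -/b b0 expr0n.
    move=> /eqP; rewrite psumr_eq0; last by move=> j _; exact: sqr_ge0.
    by move=> /allP/(_ i (mem_index_enum i)); rewrite sqrf_eq0 => /eqP->; rewrite mulr0.
  have ab : 0 < 2 * (a * b) by rewrite !mulr_gt0// lt_neqAle eq_sym b0 en0.
  by rewrite pmulr_rge0// subr_ge0.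
rewrite -(ler_pM2l V0) -expr2 ensq.
have iV i := @integrable_scale _ _ R mu I (V ord0 i) _ mI (fi i).
have [iS ES] := Rintegral_sum (index_enum _) mI iV.
have -> : \sum_i V ord0 i ^+ 2 = r^-1 * \int[mu]_(x in I) (\sum_i V ord0 i * f x ord0 i).
  rewrite ES mulr_sumr; apply: eq_bigr => i _.
  by rewrite (@RintegralZl _ _ _ mu I _ _ mI (fi i)) expr2 {2}/V mxE; ring.
rewrite mulrCA ler_wpM2l ?invr_ge0 ?(ltW r0)// -(@RintegralZl _ _ _ mu I _ _ mI ei).
apply: le_Rintegral => //.
exact: (@integrable_scale _ _ R mu I (enorm V) _ mI ei).
Qed.
End mean.

Lemma Lp2_sqr_integrable (R : realType) n (Om : set 'rV[R]_n) u : measurable Om -> Lp Om 2 u ->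
  lebesgue_rV.-integrable Om (EFin \o (fun x => u x ^+ 2)).
Proof.
move=> mO /LpP[//|//|mu_ fu]; apply/integrableP; split.
  by apply/measurable_EFinP; exact: measurable_funX.
by move: fu; under eq_integral do rewrite powR_mulrn// -normrX//.
Qed.

Lemma Lp2_mul_integrable (R : realType) n (Om : set 'rV[R]_n) u v : measurable Om -> Lp Om 2 u -> Lp Om 2 v ->
  lebesgue_rV.-integrable Om (EFin \o (fun x => u x * v x)).
Proof.
move=> mO Lu Lv.
have /LpP[//|//|mu_ _] := Lu; have /LpP[//|//|mv _] := Lv.
apply: (@le_integrable _ _ _ lebesgue_rV Om mO _ _ _ _ (integrableD mO (Lp2_sqr_integrable mO Lu) (Lp2_sqr_integrable mO Lv))).
  by apply/measurable_EFinP; exact: measurable_funM.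
move=> x _ /=; rewrite lee_fin [leRHS]ger0_norm ?addr_ge0 ?sqr_ge0// normrM.
rewrite -(real_normK (num_real (u x))) -(real_normK (num_real (v x))).
have := sqr_ge0 (`|u x| - `|v x|); have := normr_ge0 (u x); have := normr_ge0 (v x).
by move: `|u x| `|v x|; clear => a b ? ? ?; nra.
Qed.

Lemma integrable_ae_eq d (T : measurableType d) (R : realType) (mu : {measure set T -> \bar R})
    (D : set T) (f h : T -> \bar R) : measurable D -> mu.-integrable D f -> measurable_fun D h ->
  ae_eq mu D f h -> mu.-integrable D h.
Proof.
move=> mD /integrableP[mf fi] mh fh; apply/integrableP; split => //.
rewrite (@ae_eq_integral _ _ _ mu D (fun x => `|f x|%E))//; try exact: measurableT_comp.
by move: fh; apply: filterS => x H Dx; rewrite H.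
Qed.

Section average.
Context {R : realType} {n : nat} (om : set 'rV[R]_n) (gm gp : 'rV[R]_n -> R) (c G e : R).
Let g x := gp x - gm x.
Local Notation leb := (@lebesgue_measure R).
Let mu := @lebesgue_rV R n.
Let mu1 := @lebesgue_rV R n.+1.
Hypothesis om_open : open om.
Hypothesis om_fin : (mu om < +oo)%E.
Hypothesis gm_cont : {in om, continuous gm}.
Hypothesis gp_cont : {in om, continuous gp}.
Hypothesis c0 : 0 < c.
Hypothesis gc : forall x, om x -> c <= g x.
Hypothesis gG : forall x, om x -> g x <= G.
Hypothesis e0 : 0 < e.
Let a x := e * gm x.
Let b x := e * gp x.
Let thin := thin_domain om gm gp e.
Let Av (F : 'rV[R]_n.+1 -> R) : 'rV[R]_n -> R :=
  fun x => (e * g x)^-1 * \int[leb]_(t in `]a x, b x[) F (rV_rcons x t).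

Let om_meas : measurable om. Proof. exact: open_measurable_rV. Qed.
Let a_cont : {in om, continuous a}.
Proof. by move=> x ox; apply: continuousM; [exact: cst_continuous|exact: gm_cont]. Qed.
Let b_cont : {in om, continuous b}.
Proof. by move=> x ox; apply: continuousM; [exact: cst_continuous|exact: gp_cont]. Qed.
Let g_cont : {in om, continuous g}.
Proof. by move=> x ox; apply: continuousB; [exact: gp_cont|exact: gm_cont]. Qed.
Let g_meas : measurable_fun om g. Proof. exact: open_continuous_measurable_rV. Qed.
Let g0 x : om x -> 0 < g x. Proof. by move=> /gc; exact: lt_le_trans. Qed.
Let eg0 x : om x -> 0 < e * g x. Proof. by move=> /g0 gx; rewrite mulr_gt0. Qed.

Lemma thin_open : open thin. Proof. exact: (between_open om_open a_cont b_cont). Qed.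

Lemma thin_measurable : measurable thin.
Proof. exact: (measurable_between om_open a_cont b_cont). Qed.

Let thin_om : (fun z : 'rV[R]_n.+1 => col' ord_max z : 'rV[R]_n) @` thin `<=` om.
Proof. by move=> _ [z [oz _] <-]. Qed.

Lemma slice_measure x : om x -> leb `]a x, b x[%classic = (e * g x)%:E.
Proof.
move=> ox; rewrite lebesgue_measure_itv/= lte_fin.
have ab : a x < b x by rewrite -subr_gt0 /a /b -mulrBr; exact: eg0.
by rewrite ab -EFinB /a /b -mulrBr.
Qed.

Lemma ext_measurable d (T : measurableType d) (f : 'rV[R]_n -> T) : measurable_fun om f ->
  measurable_fun thin (f \o (fun z => col' ord_max z)).
Proof.
move=> mf; apply: (measurable_comp om_meas thin_om mf).
exact: measurable_funTS (@measurable_col' R n).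
Qed.

(** The fibre over [x] has length [e * g x]; this is why the weight [g] appears
    in the limit. *)
Lemma ext_tonelli (f : 'rV[R]_n -> \bar R) : measurable_fun om f -> (forall x, om x -> (0 <= f x)%E) ->
  (\int[mu1]_(z in thin) f (col' ord_max z) = \int[mu]_(x in om) (f x * (e * g x)%:E))%E.
Proof.
move=> mf f0; rewrite (between_tonelli om_open a_cont b_cont (ext_measurable mf)); last first.
  by move=> z [oz _]; exact: f0.
apply: eq_integral => x /[!inE] ox.
under eq_integral do rewrite /= col'_rcons.
by rewrite integral_cst//= slice_measure.
Qed.

Lemma thin_fin : (mu1 thin < +oo)%E.
Proof.
rewrite -[mu1 thin]mul1e -integral_cst//; last exact: thin_measurable.
rewrite (@ext_tonelli (cst 1%E))//.
apply: (@le_lt_trans _ _ (\int[mu]_(x in om) (e * G)%:E)%E).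
  apply: ge0_le_integral => //.
  - by move=> x ox; rewrite mul1e lee_fin ltW// eg0.
  - under eq_fun do rewrite mul1e.
    by apply/measurable_EFinP; apply: measurable_funM.
  - by move=> x ox; rewrite mul1e lee_fin ler_wpM2l ?(ltW e0)// gG.
have [->|/set0P[x ox]] := eqVneq om set0; first by rewrite integral_set0.
by rewrite integral_cst// lte_mul_pinfty// lee_fin mulr_ge0 ?(ltW e0)// (le_trans (ltW (g0 ox)))// gG.
Qed.

Lemma ext_integrable (f : 'rV[R]_n -> R) : mu.-integrable om (EFin \o f) ->
  mu1.-integrable thin (EFin \o (fun z => f (col' ord_max z))).
Proof.
move=> /integrableP[mf fi]; apply/integrableP; split; first exact: (ext_measurable mf).
rewrite (@ext_tonelli (fun x => `|(f x)%:E|%E))//; last exact: measurableT_comp.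
apply: (@le_lt_trans _ _ (\int[mu]_(x in om) ((e * G)%:E * `|(f x)%:E|))%E).
  apply: ge0_le_integral => //.
  - by move=> x ox; rewrite mule_ge0// lee_fin ltW// eg0.
  - apply: emeasurable_funM; first exact: measurableT_comp.
    by apply/measurable_EFinP; apply: measurable_funM.
  - by apply: emeasurable_funM => //; exact: measurableT_comp.
  - by move=> x ox; rewrite muleC lee_wpmul2r// lee_fin ler_wpM2l ?(ltW e0)// gG.
have [->|/set0P[x ox]] := eqVneq om set0; first by rewrite integral_set0.
have eG : 0 <= e * G by rewrite mulr_ge0 ?(ltW e0)// (le_trans (ltW (g0 ox)))// gG.
rewrite ge0_integralZl_EFin//; last exact: measurableT_comp.
by rewrite lte_mul_pinfty// lee_fin.
Qed.

Lemma av_ext (f : 'rV[R]_n -> R) x : om x -> Av (fun z => f (col' ord_max z)) x = f x.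
Proof.
move=> ox; rewrite /Av; under eq_Rintegral do rewrite col'_rcons.
by rewrite Rintegral_cst//= slice_measure//= mulrCA mulVf ?mulr1// gt_eqF// eg0.
Qed.

Lemma slice_integrable F : mu1.-integrable thin (EFin \o F) -> {ae mu, forall x, om x ->
  leb.-integrable `]a x, b x[ (EFin \o (fun t => F (rV_rcons x t)))}.
Proof. by move=> iF; exact: (between_integrable_ae om_open a_cont b_cont iF). Qed.

Lemma av_measurable F : mu1.-integrable thin (EFin \o F) -> measurable_fun om (Av F).
Proof.
move=> iF; apply: measurable_funM.
  apply: open_continuous_measurable_rV => // x ox; apply: (@continuousV _ _ (fun x => e * g x)).
    by rewrite gt_eqF// eg0//; rewrite inE in ox.
  by apply: continuousM; [exact: cst_continuous|exact: g_cont].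
have /integrableP[m _] := between_fubini_integrable om_open a_cont b_cont iF.
exact: (measurableT_comp (fine_measurable measurableT) m).
Qed.

Let slice_mul F (h : 'rV[R]_n -> R) : mu1.-integrable thin (EFin \o F) ->
  {ae mu, forall x, om x ->
    (\int[leb]_(t in `]a x, b x[) (F (rV_rcons x t) * h (col' ord_max (rV_rcons x t)))%:E)%E =
    (e * (g x * Av F x * h x))%:E}.
Proof.
move=> /slice_integrable; apply: filterS => x iF ox.
under eq_integral do rewrite col'_rcons.
have := @integralZr _ _ _ leb _ (measurable_itv `]a x, b x[) _ (iF ox) (h x).
move=> ->; rewrite -[X in (X * _)%E]fineK; last exact: (integrable_fin_num _ (iF ox)).
rewrite -EFinM; congr EFin; rewrite /Av /Rintegral /comp mulrA; congr (_ * _).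
by field; rewrite !gt_eqF// g0.
Qed.

Lemma av_mul_integrable F (h : 'rV[R]_n -> R) : mu1.-integrable thin (EFin \o F) ->
  mu1.-integrable thin (EFin \o (fun z => F z * h (col' ord_max z))) ->
  measurable_fun om h ->
  mu.-integrable om (EFin \o (fun x => g x * Av F x * h x)).
Proof.
move=> iF iFh mh; have /integrableP[m fi] := between_fubini_integrable om_open a_cont b_cont iFh.
have mA : measurable_fun om (EFin \o (fun x => e * (g x * Av F x * h x))).
  apply/measurable_EFinP; do 3! apply: measurable_funM => //; exact: av_measurable.
have : mu.-integrable om (EFin \o (fun x => e * (g x * Av F x * h x))).
  apply: (@integrable_ae_eq _ _ _ mu om _ _ om_meas _ mA).
    exact: (between_fubini_integrable om_open a_cont b_cont iFh).
  by move: (slice_mul h iF); apply: filterS => x H ox; exact: H.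
move=> /(@integrable_scale _ _ R mu om e^-1 _ om_meas); apply: eq_integrable => // x _ /=.
by rewrite mulKf// gt_eqF.
Qed.

Lemma av_mul_integral F (h : 'rV[R]_n -> R) : mu1.-integrable thin (EFin \o F) ->
  mu1.-integrable thin (EFin \o (fun z => F z * h (col' ord_max z))) ->
  measurable_fun om h ->
  \int[mu1]_(z in thin) (F z * h (col' ord_max z)) = e * \int[mu]_(x in om) (g x * Av F x * h x).
Proof.
move=> iF iFh mh; rewrite -RintegralZl//; last exact: av_mul_integrable.
rewrite /Rintegral (between_fubini om_open a_cont b_cont iFh); congr fine.
apply: ae_eq_integral => //.
- by have /integrableP[] := between_fubini_integrable om_open a_cont b_cont iFh.
- apply/measurable_EFinP; do 3! apply: measurable_funM => //; exact: av_measurable.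
- by move: (slice_mul h iF); apply: filterS => x H ox; exact: H.
Qed.

(** Jensen on each fibre followed by Fubini; the weight [g] cancels the
    normalisation of the average. *)
Lemma av_powR F q : 1 <= q -> mu1.-integrable thin (EFin \o F) ->
  mu1.-integrable thin (EFin \o (fun z => `|F z| `^ q)) ->
  (\int[mu]_(x in om) (g x * `|Av F x| `^ q)%:E <= e^-1%:E * \int[mu1]_(z in thin) (`|F z| `^ q)%:E)%E.
Proof.
move=> q1 iF iFq; rewrite (between_fubini om_open a_cont b_cont iFq).
have iI := between_fubini_integrable om_open a_cont b_cont iFq.
have /integrableP[m _] := iI.
rewrite -ge0_integralZl_EFin ?invr_ge0 ?(ltW e0)//; last first.
  by move=> x _; apply: integral_ge0 => t _; rewrite lee_fin powR_ge0.
apply: ae_ge0_le_integral => //.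
- by move=> x ox; rewrite lee_fin mulr_ge0 ?powR_ge0// ltW// g0.
- apply/measurable_EFinP; apply: measurable_funM => //.
  apply: (measurableT_comp (measurable_powR q)); apply: measurableT_comp => //; exact: av_measurable.
- by move=> x _; rewrite mule_ge0 ?lee_fin ?invr_ge0 ?(ltW e0)//; apply: integral_ge0 => t _; rewrite lee_fin powR_ge0.
- exact: emeasurable_funM.
apply: filterS2 (slice_integrable iF) (slice_integrable iFq) => x i1 i2 ox.
rewrite -[X in (_ * X)%E]fineK; last exact: (integrable_fin_num _ (i2 ox)).
rewrite -EFinM lee_fin.
have := @mean_powR _ _ _ leb `]a x, b x[%classic _ (measurable_itv _) (slice_measure ox) (eg0 ox) _ q q1 (i1 ox) (i2 ox).
rewrite -/(Av F x) => /(ler_wpM2l (ltW (g0 ox))) /le_trans; apply.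
by rewrite mulrA invfM mulrCA mulfV ?mulr1// gt_eqF// g0.
Qed.
End average.

(** * Extension by constants along the fibres *)

Lemma Lp_powR_integrable (R : realType) n (Om : set 'rV[R]_n) q u : measurable Om -> 0 < q ->
  Lp Om q u <-> measurable_fun Om u /\ lebesgue_rV.-integrable Om (EFin \o (fun x => `|u x| `^ q)).
Proof.
move=> mO q0; rewrite LpP//; split => -[mu_ iu]; split => //.
  apply/integrableP; split.
    apply/measurable_EFinP; apply: (measurableT_comp (measurable_powR q)); exact: measurableT_comp.
  by under eq_integral do rewrite /= ger0_norm ?powR_ge0//.
move/integrableP : iu => [_]; under eq_integral do rewrite /= ger0_norm ?powR_ge0//.
by [].
Qed.

Lemma grad_spec (R : realType) n (Om : set 'rV[R]_n) p u : W1p Om p u -> weak_gradient Om p u (grad Om p u).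
Proof. by move=> [_ [w uw]]; exact: (xgetPex (fun=> 0) (ex_intro _ w uw)). Qed.

Lemma enorm_measurable (R : realType) d (T : measurableType d) (D : set T) n (w : T -> 'rV[R]_n) : measurable D ->
  (forall i, measurable_fun D (fun x => w x ord0 i)) -> measurable_fun D (fun x => enorm (w x)).
Proof.
move=> mD mw; apply: (measurableT_comp (continuous_measurable_fun (@sqrt_continuous R))).
by apply: measurable_sum => i; apply: measurable_funX.
Qed.

Lemma enorm_ge0 (R : realType) n (x : 'rV[R]_n) : 0 <= enorm x.
Proof. exact: sqrtr_ge0. Qed.

Lemma enorm_rcons0 (R : realType) n (x : 'rV[R]_n) : enorm (rV_rcons x 0) = enorm x.
Proof.
rewrite /enorm big_ord_recr/= rcons_last expr0n addr0; congr Num.sqrt.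
apply: eq_bigr => i _; congr (_ ^+ 2).
by rewrite -(rcons_lift x 0 i); congr (rV_rcons _ _ _ _); apply: val_inj; rewrite /= /bump leqNgt ltn_ord.
Qed.

(** The support of the slice is the projection of a slice of the support. *)
Lemma test_slice (R : realType) n (om : set 'rV[R]_n) (D : set 'rV[R]_n.+1) phi t :
  (forall z, D z -> om (col' ord_max z)) -> test_function D phi ->
  test_function om (fun x => phi (rV_rcons x t)).
Proof.
move=> Dom [sphi [K [cK KD Kphi]]]; split; first exact: smooth_rcons_init.
pose F := [set z : 'rV[R]_n.+1 | z ord0 ord_max = t].
have clF : closed F.
  have cl : closed ((fun z : 'rV[R]_n.+1 => z ord0 ord_max) @^-1` [set t]).
    apply: closed_comp; last exact: closed_eq.
    by move=> z _; exact: coord_continuous.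
  exact: cl.
exists ((fun z => col' ord_max z : 'rV[R]_n) @` (K `&` F)); split.
- apply: continuous_compact; last exact: compact_closedI.
  by apply: continuous_subspaceT; exact: continuous_col'.
- by move=> _ [z [Kz _] <-]; apply: Dom; exact: KD.
- move=> x nx; apply: Kphi => Kz; apply: nx; exists (rV_rcons x t); last exact: col'_rcons.
  by split => //; rewrite /F /= rcons_last.
Qed.

Section extension.
Context {R : realType} {n : nat} (om : set 'rV[R]_n) (gm gp : 'rV[R]_n -> R) (c G e : R).
Let g x := gp x - gm x.
Local Notation leb := (@lebesgue_measure R).
Let mu := @lebesgue_rV R n.
Let mu1 := @lebesgue_rV R n.+1.
Hypothesis om_open : open om.
Hypothesis om_fin : (mu om < +oo)%E.
Hypothesis gm_cont : {in om, continuous gm}.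
Hypothesis gp_cont : {in om, continuous gp}.
Hypothesis c0 : 0 < c.
Hypothesis gc : forall x, om x -> c <= g x.
Hypothesis gG : forall x, om x -> g x <= G.
Hypothesis e0 : 0 < e.
Let thin := thin_domain om gm gp e.
Let Av (F : 'rV[R]_n.+1 -> R) : 'rV[R]_n -> R := @thin_average R n om gm gp e F.
Let ext (v : 'rV[R]_n -> R) : 'rV[R]_n.+1 -> R := fun z => v (col' ord_max z).

Let om_meas : measurable om. Proof. exact: open_measurable_rV. Qed.
Let g0 x : om x -> 0 < g x. Proof. by move=> /gc; exact: lt_le_trans. Qed.
Let thin_meas : measurable thin. Proof. exact: thin_measurable. Qed.
Let thin_finite : (mu1 thin < +oo)%E.
Proof. exact: (thin_fin om_open om_fin gm_cont gp_cont c0 gc gG e0). Qed.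
Let thin_open' : open thin. Proof. exact: thin_open. Qed.

Lemma ext_Lp q v : 0 < q -> Lp om q v -> Lp thin q (ext v).
Proof.
move=> q0 /(Lp_powR_integrable _ om_meas q0)[mv iv].
apply/(Lp_powR_integrable _ thin_meas q0); split.
  exact: (ext_measurable om_open mv).
exact: (ext_integrable om_open gm_cont gp_cont c0 gc gG e0 iv).
Qed.

(** The bounds [c] and [G] of the weight turn the weighted estimate into an
    unweighted one. *)
Lemma av_Lp q F : 1 <= q -> Lp thin q F -> Lp om q (Av F).
Proof.
move=> q1 LF; have q0 : 0 < q by apply: lt_le_trans q1.
have iF := Lp_integrable thin_meas thin_finite q1 LF.
have /(Lp_powR_integrable _ thin_meas q0)[mF iFq] := LF.
have H := av_powR om_open gm_cont gp_cont c0 gc e0 q1 iF iFq.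
have mA := av_measurable om_open gm_cont gp_cont c0 gc e0 iF.
have mAq : measurable_fun om (EFin \o (fun x => `|Av F x| `^ q)).
  apply/measurable_EFinP; apply: (measurableT_comp (measurable_powR q)); exact: measurableT_comp.
have mg : measurable_fun om g.
  apply: open_continuous_measurable_rV => // x ox; apply: continuousB; [exact: gp_cont|exact: gm_cont].
apply/LpP => //; split => //.
apply: (@le_lt_trans _ _ (c^-1%:E * \int[mu]_(x in om) (g x * `|Av F x| `^ q)%:E)%E).
  rewrite -ge0_integralZl_EFin ?invr_ge0 ?(ltW c0)//.
  - apply: ge0_le_integral => //.
    + apply: emeasurable_funM => //; apply/measurable_EFinP; apply: measurable_funM => //; exact/measurable_EFinP.
    + move=> x ox; rewrite -EFinM lee_fin ler_pdivlMl// ler_wpM2r ?powR_ge0// gc//.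
  - by move=> x ox; rewrite lee_fin mulr_ge0 ?powR_ge0// ltW// g0.
  - by apply/measurable_EFinP; apply: measurable_funM => //; exact/measurable_EFinP.
rewrite lte_mul_pinfty ?lee_fin ?invr_ge0 ?(ltW c0)//.
apply: (le_lt_trans H); rewrite lte_mul_pinfty ?lee_fin ?invr_ge0 ?(ltW e0)//.
by move/integrableP : iFq => [_]; under eq_integral do rewrite /= ger0_norm ?powR_ge0//.
Qed.

Lemma av_adjoint (v : limit_space om gm gp) (z : thin_space om gm gp e) :
  ip_mem (limit_space om gm gp) v -> ip_mem (thin_space om gm gp e) z ->
  ip (thin_space om gm gp e) (ext v) z = ip (limit_space om gm gp) v (Av z).
Proof.
move=> Lv Lz.
have iz := Lp_integrable thin_meas thin_finite (ler1n _ 2) Lz.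
have iv := Lp2_mul_integrable thin_meas Lz (ext_Lp (ltr0Sn _ 1) Lv).
have /LpP[//|//|mv _] := Lv.
have := av_mul_integral om_open gm_cont gp_cont c0 gc e0 iz iv mv.
rewrite /= => H.
have -> : \int[mu1]_(x in thin) (ext v x * z x) = \int[mu1]_(x in thin) (z x * ext v x).
  by apply: eq_Rintegral => x _; rewrite mulrC.
rewrite /ext H mulKf ?gt_eqF//; apply: eq_Rintegral => x _.
by rewrite mulrAC.
Qed.

Lemma ext_isometry (v w : limit_space om gm gp) :
  ip_mem (limit_space om gm gp) v -> ip_mem (limit_space om gm gp) w ->
  ip (thin_space om gm gp e) (ext v) (ext w) = ip (limit_space om gm gp) v w.
Proof.
move=> Lv Lw; rewrite av_adjoint//; last exact: ext_Lp.
apply: eq_Rintegral => x; rewrite inE => ox; congr (_ * _).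
exact: (av_ext c0 gc e0).
Qed.

(** In the directions of [om], slices of a test function at fixed height are
    test functions on [om], so Fubini is used with the height outside. In the
    last direction the integral over a fibre of the derivative of a test
    function vanishes. *)
Lemma ext_weak_gradient p v w : 1 <= p -> Lp om p v -> weak_gradient om p v w ->
  weak_gradient thin p (ext v) (fun z => rV_rcons (w (col' ord_max z)) 0).
Proof.
move=> p1 Lv vw i; have p0 : 0 < p by apply: lt_le_trans p1.
have iv := Lp_integrable om_meas om_fin p1 Lv.
have iev := ext_integrable om_open gm_cont gp_cont c0 gc gG e0 iv.
case: (unliftP ord_max i) => [j ->|->].
  have [Lw Hw] := vw j.
  have iw := Lp_integrable om_meas om_fin p1 Lw.
  have Ew : (fun z : 'rV[R]_n.+1 => rV_rcons (w (col' ord_max z)) 0 ord0 (lift ord_max j)) = ext (fun x => w x ord0 j).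
    by apply/funext => z; rewrite rcons_lift.
  have Lew := ext_Lp p0 Lw.
  split; first by rewrite Ew.
  move=> phi tphi.
  have iew := ext_integrable om_open gm_cont gp_cont c0 gc gG e0 iw.
  have tdphi := test_derive (delta_mx ord0 (lift ord_max j)) tphi.
  have thin_om z : thin z -> om (col' ord_max z) by case.
  have i1 := integrable_test thin_open' iev tdphi; have i2 := integrable_test thin_open' iew tphi.
  have i12 := integrableD thin_meas i1 i2.
  under [in RHS]eq_Rintegral do rewrite rcons_lift.
  apply/eqP; rewrite -subr_eq0 opprK -(@RintegralD _ _ _ mu1 thin _ _ thin_meas i1 i2); apply/eqP.
  rewrite /Rintegral (_ : (\int[mu1]_(z in thin) _)%E = 0%E)//.
  rewrite integral_mkcond rV_fubini21; last first.
    by apply/(integrable_mkcond _ thin_meas); exact: i12.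
  apply: integral0_eq => t _.
  have tpt := test_slice t thin_om tphi.
  have tdt := test_derive (delta_mx ord0 j) tpt.
  have j1 := integrable_test om_open iv tdt; have j2 := integrable_test om_open iw tpt.
  transitivity (\int[mu]_(x in om) ((v x * 'D_(delta_mx ord0 j) (fun y => phi (rV_rcons y t)) x)%:E + (w x ord0 j * phi (rV_rcons x t))%:E))%E.
    have [_ [K [cK KD Kphi]]] := tphi.
    rewrite [RHS]integral_mkcond; apply: eq_integral => x _.
    rewrite !patchE derive_rcons_init rcons_delta_lift; case: ifPn => [|nin].
      by rewrite inE => -[]; rewrite col'_rcons => ox _; rewrite mem_set// /ext col'_rcons.
    have nK : ~ K (rV_rcons x t) by move=> /KD /mem_set; rewrite (negbTE nin).
    rewrite Kphi// (test_supp_derive _ cK Kphi)//.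
    by case: ifP; rewrite ?mulr0 ?adde0.
  rewrite (integralD om_meas j1 j2); have := congr1 EFin (Hw _ tpt).
  rewrite /Rintegral EFinN !fineK; [|exact: (integrable_fin_num om_meas j2)|exact: (integrable_fin_num om_meas j1)].
  by move=> ->; rewrite addeC subee// (integrable_fin_num om_meas j2).
split.
  apply: (@bounded_Lp _ _ _ _ _ 0) => //.
    rewrite (_ : (fun _ => _) = cst 0)//.
    by apply/funext => z; rewrite rcons_last.
  by move=> z _; rewrite rcons_last normr0.
move=> phi tphi.
under [in RHS]eq_Rintegral do rewrite rcons_last mul0r.
rewrite Rintegral_cst// mul0r oppr0.
have tdphi := test_derive (delta_mx ord0 ord_max) tphi.
have iF : mu1.-integrable thin (EFin \o 'D_(delta_mx ord0 ord_max) phi).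
  have := integrable_test thin_open' (@cst_integrable _ _ R mu1 thin 1 thin_meas thin_finite) tdphi.
  by apply: eq_integrable => // z _ /=; rewrite mul1r.
have iFv := integrable_test thin_open' iev tdphi.
have [_ [K [cK KD Kphi]]] := tphi.
have mv : measurable_fun om v by have /LpP[] := Lv.
have iFv' : mu1.-integrable thin (EFin \o (fun z => 'D_(delta_mx ord0 ord_max) phi z * v (col' ord_max z))).
  by move: iFv; apply: eq_integrable => // z _ /=; rewrite mulrC.
under eq_Rintegral do rewrite mulrC.
rewrite (av_mul_integral om_open gm_cont gp_cont c0 gc e0 iF iFv' mv).
rewrite (_ : \int[lebesgue_rV]_(x in om) _ = 0) ?mulr0//.
transitivity (\int[mu]_(x in om) (0 : R)); last by rewrite Rintegral_cst// mul0r.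
apply: eq_Rintegral => x; rewrite inE => ox.
rewrite (_ : \int[leb]_(t in _) _ = 0) ?mulr0 ?mul0r//.
have ab : e * gm x < e * gp x by rewrite ltr_pM2l// -subr_gt0 g0.
have phi0 t : ~~ (e * gm x < t < e * gp x) -> phi (rV_rcons x t) = 0.
  move=> /negP nt; apply: Kphi => /KD [_]; rewrite /= rcons_last col'_rcons.
  by move=> /nt.
have := smooth_FTC ab (smooth_rcons_last x tphi.1).
rewrite !phi0 ?ltxx ?andbF// subrr => H.
have md (D : set (measurableTypeR R)) : measurable_fun D (fun t : R => ('D_1 (fun t : R => phi (rV_rcons x t)) t)%:E).
  have sl : smooth (fun t : R => phi (rV_rcons x t)) by apply: smooth_rcons_last; exact: tphi.1.
  have cd : continuous ('D_1 (fun t : R => phi (rV_rcons x t))).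
    by apply: smooth_continuous; apply: smooth_derive; exact: sl.
  by apply/measurable_EFinP; apply: measurable_funTS; exact: (continuous_measurable_fun cd).
rewrite integral_itv_bndoo in H; last exact: md.
rewrite /Rintegral; under eq_integral do rewrite -rcons_delta_last -derive_rcons_last.
by rewrite H.
Qed.

Lemma ext_energy p (v : limit_space om gm gp) : 1 <= p ->
  (thin_energy p (ext v : thin_space om gm gp e) <= limit_energy p v)%E.
Proof.
move=> p1; have p0 : 0 < p by apply: lt_le_trans p1.
rewrite /limit_energy; case: ifPn => [|_]; last by rewrite leey.
rewrite inE => Wv; have vw := grad_spec Wv; have [Lv _] := Wv.
have evw := ext_weak_gradient p1 Lv vw.
have Wev : W1p thin p (ext v) by split; [exact: ext_Lp|eexists; exact: evw].
rewrite /thin_energy mem_set//.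
set w := grad om p v in vw evw *.
have mw (i : 'I_n) : measurable_fun om (fun x => w x ord0 i).
  by have [/(LpP _ om_meas p0)[]] := vw i.
have mpw : measurable_fun om (fun x => enorm (w x) `^ p).
  apply: (measurableT_comp (measurable_powR p)); exact: enorm_measurable.
have ae := weak_gradient_unique thin_open' thin_finite p1 (grad_spec Wev) evw.
have mwe (i : 'I_n.+1) : measurable_fun thin (fun x => grad thin p (ext v) x ord0 i).
  by have [/(LpP _ thin_meas p0)[]] := grad_spec Wev i.
have mext : measurable_fun thin (fun z => enorm (w (col' ord_max z)) `^ p).
  exact: (ext_measurable om_open mpw).
rewrite (_ : \int[lebesgue_rV]_(x in thin_domain om gm gp e) _ = \int[lebesgue_rV]_(x in thin) (enorm (w (col' ord_max x)) `^ p)%:E)%E; last first.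
  apply: ae_eq_integral => //.
  - apply/measurable_EFinP; apply: (measurableT_comp (measurable_powR p)); exact: enorm_measurable.
  - exact/measurable_EFinP.
  - by move: ae; apply: filterS => z H tz; rewrite H// enorm_rcons0.
rewrite (ext_tonelli om_open gm_cont gp_cont c0 gc e0 (f := fun x => (enorm (w x) `^ p)%:E)); last 2 first.
- exact/measurable_EFinP.
- by move=> x _; rewrite lee_fin powR_ge0.
have mg : measurable_fun om g.
  apply: open_continuous_measurable_rV => // x ox; apply: continuousB; [exact: gp_cont|exact: gm_cont].
rewrite (eq_integral (fun x => e%:E * (g x * enorm (w x) `^ p)%:E)%E); last first.
  by move=> x _; rewrite -!EFinM; congr EFin; rewrite /g; ring.
rewrite ge0_integralZl_EFin ?(ltW e0)//.
- rewrite muleA -EFinM invfM (_ : e^-1 * p^-1 * e = p^-1)//.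
  by field; rewrite !gt_eqF.
- by move=> x ox; rewrite lee_fin mulr_ge0 ?powR_ge0// ltW// g0.
- by apply/measurable_EFinP; apply: measurable_funM.
Qed.
End extension.

(** * Smooth approximation of Lipschitz functions *)

Section hat.
Context {R : realType}.

(** The integer translates of [hat] form a partition of unity, by telescoping.
    *)
Definition hat (t : R) : R := step (t + 1) - step t.

Lemma smooth_shift (f : R -> R) (s : R) : smooth f -> smooth (fun t => f (t + s)).
Proof.
move=> sf; apply: smooth_comp => //; apply: smoothD; [exact: smooth_id|exact: smooth_cst].
Qed.

Lemma derive_shift (f : R -> R) (s t : R) : smooth f -> 'D_1 (fun t => f (t + s)) t = 'D_1 f (t + s).
Proof.
move=> sf; rewrite (derive_affine (A := fun t : R => t + s) (L := fun t => t) f (x:=t) (v:=1) _).2//.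
by move=> h; rewrite addrA.
Qed.

Lemma smooth_hat : smooth hat.
Proof.
apply: smoothD; first by apply: smooth_shift; exact: smooth_step.
by apply: smoothN; exact: smooth_step.
Qed.

Lemma hat_out t : 1 < `|t| -> hat t = 0.
Proof.
rewrite lter_normr => /orP[] t1; rewrite /hat.
  by rewrite !step_ge1 ?subrr//; lra.
by rewrite !step_le0 ?subrr//; lra.
Qed.

Lemma hat_le1 t : `|hat t| <= 1.
Proof.
rewrite /hat; have := step_ge0 t; have := step_le1 t; have := step_ge0 (t + 1); have := step_le1 (t + 1).
by move=> a1 a2 a3 a4; rewrite ler_norml; apply/andP; split; lra.
Qed.

Lemma derive_hat_out t : 1 < `|t| -> 'D_1 hat t = 0.
Proof.
move=> t1; rewrite (@near_eq_derive _ _ _ hat (fun=> 0)) ?derive_cst//.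
have : \forall s \near t, 1 < `|s : R|.
  have /cvgr_gt := @norm_continuous _ _ t; exact.
by apply: filterS => s s1; rewrite hat_out.
Qed.

Lemma derive_hat_bounded : exists2 M, 0 <= M & forall t, `|'D_1 hat t| <= M.
Proof.
have [M M0 HM] := @derive_step_bounded R.
exists (M + M) => [|t]; first exact: addr_ge0.
have s1 : smooth (fun t : R => step (t + 1)) by apply: smooth_shift; exact: smooth_step.
have s2 : smooth (@step R) by exact: smooth_step.
have d1 : derivable (fun t : R => step (t + 1)) t 1 by exact: smooth_derivable s1.
have d2 : derivable (@step R) t 1 by exact: smooth_derivable s2.
have -> : 'D_1 hat t = 'D_1 (fun t : R => step (t + 1)) t - 'D_1 step t by exact: (deriveB d1 d2).
rewrite derive_shift; last exact: s2.
by apply: le_trans (ler_normB _ _) _; exact: lerD.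
Qed.

Lemma hat_sum N (t : R) : 0 <= t -> t <= N%:R - 1 -> \sum_(k < N) hat (t - k%:R) = 1.
Proof.
move=> t0 tN.
have E m : \sum_(k < m) hat (t - k%:R) = step (t + 1) - step (t + 1 - m%:R).
  elim: m => [|m IH]; first by rewrite big_ord0 subr0 subrr.
  rewrite big_ord_recr/= IH /hat -[in X in _ = X]natr1.
  rewrite (_ : t - m%:R + 1 = t + 1 - m%:R); last by rewrite addrAC.
  rewrite (_ : t + 1 - (m%:R + 1) = t - m%:R); last by rewrite opprD addrACA subrr addr0.
  by rewrite addrA subrK.
by rewrite E step_ge1 ?step_le0 ?subr0//; lra.
Qed.

(** At most the three integers next to the floor of [t] are at distance 1 from
    [t]. *)
Lemma near_int_count N (t : R) : \sum_(k < N) (`|t - k%:R| <= 1)%R%:R <= 3 :> R.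
Proof.
rewrite -(big_mkord xpredT (fun k => (`|t - k%:R| <= 1)%R%:R : R)) -natr_sum ler_nat.
pose b k := `|t - k%:R| <= 1; rewrite -/b.
have -> : (\sum_(0 <= i < N) b i = size [seq k <- index_iota 0 N | b k])%N.
  by rewrite size_filter; elim: (index_iota 0 N) => [|k r IH]; rewrite ?big_nil// big_cons IH.
pose m := Num.floor t.
rewrite -(size_map (fun k : nat => k%:Z)).
apply: (@uniq_leq_size _ _ [:: m - 1; m; m + 1]).
  rewrite map_inj_uniq; last by move=> k l [].
  by rewrite filter_uniq// iota_uniq.
move=> z /mapP[k]; rewrite mem_filter => /andP[bk _] ->{z}.
have mt : m%:~R <= t by exact: floor_le_tmp.
have tm : t < (m + 1)%:~R by exact: floorD1_gt.
move: bk; rewrite /b ler_norml => /andP[b1 b2].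
have k1 : (m - 2 < k%:Z)%R by rewrite -(ltr_int R) rmorphB/=; lra.
have k2 : (k%:Z < m + 2)%R by rewrite -(ltr_int R) rmorphD/=; move: tm; rewrite rmorphD/=; lra.
by rewrite !inE; lia.
Qed.

End hat.

Lemma derive_const_dir (R : realType) (V : normedModType R) (f : V -> R) x v :
  (forall h : R, f (h *: v + x) = f x) -> 'D_v f x = 0.
Proof.
move=> H; rewrite -derive_along_line (_ : (fun h : R => f (h *: v + x)) = cst (f x)) ?derive_cst//.
by apply/funext => h; exact: H.
Qed.

Lemma derive_bigsum (R : realType) (V : normedModType R) I (r : seq I) (b : I -> R) (f : I -> V -> R) x v :
  (forall k, smooth (f k)) ->
  'D_v (fun x => \sum_(k <- r) b k * f k x) x = \sum_(k <- r) b k * 'D_v (f k) x.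
Proof.
move=> sf; elim: r => [|k r IH].
  by rewrite big_nil; under eq_fun do rewrite big_nil; rewrite derive_cst.
rewrite big_cons -IH; under eq_fun do rewrite big_cons.
have s1 : smooth (fun x => b k * f k x) by apply: smoothM; [exact: smooth_cst|exact: sf].
have s2 : smooth (fun x => \sum_(k <- r) b k * f k x).
  by apply: smooth_sum => l; apply: smoothM; [exact: smooth_cst|exact: sf].
have d1 : derivable (fun x => b k * f k x) x v by exact: smooth_derivable s1.
have d2 : derivable (fun x => \sum_(k <- r) b k * f k x) x v by exact: smooth_derivable s2.
have d3 : derivable (f k) x v by exact: smooth_derivable (sf k).
have -> : b k * 'D_v (f k) x = 'D_v (fun x => b k * f k x) x by rewrite -[LHS](deriveZ (b k) d3).
exact: (deriveD d1 d2).
Qed.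

Section partition.
Context {R : realType} {n N : nat} (s c : R).
Local Notation T := {ffun 'I_n -> 'I_N}.

(** The scale is [s], and [c] shifts the bounded domain into the range of the
    indices. *)
Definition cell (k : T) (x : 'rV[R]_n) := [forall j, `|x ord0 j * s + c - (k j)%:R| <= 1].
Definition cell_weight (k : T) (x : 'rV[R]_n) : R := \prod_j hat (x ord0 j * s + c - (k j)%:R).

Let shape j (m : R) := fun x : 'rV[R]_n => x ord0 j * s + c - m.

Let smooth_shape j m : smooth (shape j m).
Proof.
apply: smoothD; last exact: smooth_cst.
apply: smoothD; last exact: smooth_cst.
by apply: smoothM; [exact: smooth_coord|exact: smooth_cst].
Qed.

Lemma smooth_cell_weight k : smooth (cell_weight k).
Proof. by apply: smooth_prod => j; apply: smooth_comp; [exact: smooth_hat|exact: smooth_shape]. Qed.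

Lemma cellE k x : (cell k x)%:R = \prod_j (`|x ord0 j * s + c - (k j)%:R| <= 1)%R%:R :> R.
Proof.
have [/forallP H|] := boolP (cell k x); first by rewrite big1// => j _; rewrite H.
by rewrite negb_forall => /existsP[j /negbTE H]; rewrite (bigD1 j)//= H mul0r.
Qed.

(** The number of supports that meet at a point is independent of the scale,
    which makes the derivatives of the approximants bounded uniformly. *)
Lemma sum_cell x : \sum_k (cell k x)%:R <= 3 ^+ n :> R.
Proof.
under eq_bigr do rewrite cellE.
rewrite -(bigA_distr_bigA (fun (j : 'I_n) (m : 'I_N) => (`|x ord0 j * s + c - m%:R| <= 1)%R%:R : R)).
rewrite -[X in 3 ^+ X](card_ord n) -prodr_const.
apply: ler_prod => j _; rewrite near_int_count andbT; exact: sumr_ge0.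
Qed.

Lemma sum_cell_weight (x : 'rV[R]_n) : (forall j, 0 <= x ord0 j * s + c <= N%:R - 1) -> \sum_k cell_weight k x = 1.
Proof.
move=> H; rewrite /cell_weight -(bigA_distr_bigA (fun (j : 'I_n) (m : 'I_N) => hat (x ord0 j * s + c - m%:R))).
by rewrite big1// => j _; have /andP[h1 h2] := H j; rewrite hat_sum.
Qed.

Lemma cell_weight_le k x : `|cell_weight k x| <= (cell k x)%:R.
Proof.
rewrite cellE /cell_weight normr_prod; apply: ler_prod => j _; rewrite normr_ge0/=.
by case: (leP `|x ord0 j * s + c - (k j)%:R| 1) => [_|h]; [exact: hat_le1|rewrite hat_out// normr0].
Qed.

(** Only the factor of index [i] depends on the coordinate [i]. *)
Lemma derive_cell_weight_le M k x i : (forall t, `|'D_1 hat t| <= M :> R) ->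
  `|'D_(delta_mx ord0 i) (cell_weight k) x| <= `|s| * M * (cell k x)%:R.
Proof.
move=> HM; pose v : 'rV[R]_n := delta_mx ord0 i.
pose f x := hat (shape i (k i)%:R x).
pose r x := \prod_(j | j != i) hat (shape j (k j)%:R x).
have Ew : cell_weight k = (fun x => f x * r x).
  by apply/funext => y; rewrite /cell_weight (bigD1 i).
have sf : smooth f by apply: smooth_comp; [exact: smooth_hat|exact: smooth_shape].
have sr : smooth r.
  rewrite /r (_ : (fun _ => _) = fun x => \prod_(j <- [seq j <- index_enum 'I_n | j != i]) hat (shape j (k j)%:R x)).
    by apply: smooth_prod => j; apply: smooth_comp; [exact: smooth_hat|exact: smooth_shape].
  by apply/funext => y; rewrite big_filter.
have Dr : 'D_v r x = 0.
  apply: derive_const_dir => h; apply: eq_bigr => j ji; congr hat.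
  by rewrite /shape !mxE/= (negbTE ji) mulr0 add0r.
have Ds : 'D_v (shape i (k i)%:R) x = s.
  rewrite (derive_affine (A := shape i (k i)%:R) (L := fun y => y ord0 i * s) (fun x : R => x) (x:=x) (v:=v) _).2.
    by rewrite derive_id mxE !eqxx mul1r.
  by move=> h; rewrite /shape !mxE/= mulrDl -!mulrA !addrA.
have Df : 'D_v f x = 'D_1 hat (shape i (k i)%:R x) * s.
  have dh : derivable (@hat R) (shape i (k i)%:R x) 1 by exact: smooth_derivable smooth_hat.
  have dg : derivable (shape i (k i)%:R) x v by exact: smooth_derivable (smooth_shape _ _).
  by have := @derive_val _ _ _ _ _ _ _ (is_derive_dir_comp dh dg); rewrite Ds.
rewrite Ew deriveM; [|exact: smooth_derivable|exact: smooth_derivable].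
rewrite Dr scaler0 add0r Df /GRing.scale/= normrM cellE (bigD1 i)//= normrM.
set P := \prod_(j | j != i) _.
have B : `|r x| <= P.
  rewrite /r normr_prod; apply: ler_prod => j _; rewrite normr_ge0/=.
  by case: (leP `|x ord0 j * s + c - (k j)%:R| 1) => [_|h]; [exact: hat_le1|rewrite hat_out// normr0].
have A : `|'D_1 hat (shape i (k i)%:R x)| <= M * (`|x ord0 i * s + c - (k i)%:R| <= 1)%R%:R.
  case: (leP `|x ord0 i * s + c - (k i)%:R| 1) => [_|h]; first by rewrite mulr1.
  by rewrite derive_hat_out// normr0 mulr0.
rewrite mulrC mulrA -[leRHS]mulrA [leRHS]mulrC mulrAC.
rewrite (_ : _ * P * _ = M * (`|x ord0 i * s + c - (k i)%:R| <= 1)%R%:R * P * `|s|); last by ring.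
by apply: ler_wpM2r => //; apply: ler_pM.
Qed.
End partition.

Lemma rV_norm_le (R : realType) n (x y : 'rV[R]_n) e : 0 < e -> (forall j, `|x ord0 j - y ord0 j| < e) -> `|x - y| <= e.
Proof.
move=> e0 H; apply: ltW; have : ball x e y by apply/rV_ballP.
by rewrite -ball_normE.
Qed.

(** Average the values of [f] at points of [om] in the cells of a grid of size
    [eta] with the partition of unity. The derivatives of the weights are of
    size [1 / eta] and add up to 0, so that [f x] may be subtracted from the
    values, which differ from it by [O (eta)]. *)
Lemma lipschitz_smooth_approx (R : realType) n (om : set 'rV[R]_n) (f : 'rV[R]_n -> R) K B i : open om ->
  (forall x, om x -> forall j, `|x ord0 j| <= B) -> 0 <= K ->
  (forall x y, om x -> om y -> `|f x - f y| <= K * `|x - y|) ->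
  exists2 C, 0 <= C & forall d, 0 < d -> exists h : 'rV[R]_n -> R, [/\ smooth h,
    forall x, om x -> `|h x - f x| <= d & forall x, om x -> `|'D_(delta_mx ord0 i) h x| <= C].
Proof.
move=> oom omB K0 fK; have [M M0 HM] := @derive_hat_bounded R.
pose A := 3 * K * 3 ^+ n; have A0 : 0 <= A by rewrite !mulr_ge0// exprn_ge0.
exists (A * M) => [|d d0]; first by rewrite mulr_ge0.
(* The grid size; the error of the approximation is at most [A * eta]. *)
pose eta := d / (A + 1); have eta0 : 0 < eta by rewrite divr_gt0// ltr_wpDl.
pose s := eta^-1; have s0 : 0 < s by rewrite invr_gt0.
pose N0 := Num.bound (B * s); pose N := (N0 + N0).+1.
pose c := N0%:R : R.
have inN x : om x -> forall j, 0 <= x ord0 j * s + c <= N%:R - 1.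
  move=> ox j; have b1 : `|x ord0 j| * s <= B * s by rewrite ler_wpM2r ?(ltW s0)//; exact: omB.
  have b0 : 0 <= B * s by apply: le_trans b1; rewrite mulr_ge0// ltW.
  have b2 : B * s <= c by apply: ltW; exact: archi_boundP.
  have : `|x ord0 j * s| <= c by rewrite normrM (gtr0_norm s0); exact: le_trans b1 b2.
  rewrite ler_norml => /andP[h1 h2].
  have -> : N%:R - 1 = c + c :> R by rewrite /N -natr1 natrD addrK.
  by apply/andP; split; lra.
pose T := {ffun 'I_n -> 'I_N}.
(* A point of the domain in each cell that meets it; the value chosen for the
   other cells is multiplied by 0. *)
pose y (k : T) := xget 0 [set z : 'rV[R]_n | om z /\ cell s c k z].
pose h x := \sum_(k : T) f (y k) * cell_weight s c k x.
have near_y (k : T) x : om x -> cell s c k x -> `|f (y k) - f x| <= 3 * K * eta.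
  move=> ox cx; have [oy cy] : om (y k) /\ cell s c k (y k).
    exact: (@xgetPex _ 0 [set z : 'rV[R]_n | om z /\ cell s c k z] (ex_intro _ x (conj ox cx))).
  apply: le_trans (fK _ _ oy ox) _; rewrite [3 * K]mulrC -mulrA ler_wpM2l//.
  apply: rV_norm_le => [|j]; first by rewrite mulr_gt0.
  have /forallP/(_ j) := cx; have /forallP/(_ j) := cy.
  rewrite !ler_norml => /andP[h1 h2] /andP[h3 h4].
  have : `|(y k ord0 j - x ord0 j) * s| < 3.
    by rewrite ltr_norml mulrBl; apply/andP; split; lra.
  by rewrite normrM (gtr0_norm s0) /s ltr_pdivrMr.
have main (a : T -> R) x L : om x -> 0 <= L -> (forall k, `|a k| <= L * (cell s c k x)%:R) ->
    `|\sum_k (f (y k) - f x) * a k| <= 3 * K * eta * L * 3 ^+ n.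
  move=> ox L0 aL; apply: le_trans (ler_norm_sum _ _ _) _.
  have : \sum_(k : T) 3 * K * eta * L * (cell s c k x)%:R <= 3 * K * eta * L * 3 ^+ n.
    rewrite -mulr_sumr; apply: ler_wpM2l; last exact: sum_cell.
    by apply: mulr_ge0 => //; apply: mulr_ge0; [exact: mulr_ge0|exact: ltW].
  apply: le_trans; apply: ler_sum => k _; rewrite normrM.
  have := aL k; case: (boolP (cell s c k x)) => [cx|_].
    by rewrite !mulr1 => ak; apply: ler_pM => //; exact: near_y.
  by rewrite !mulr0 normr_le0 => /eqP->; rewrite normr0 mulr0.
have sw (k : T) : smooth (cell_weight s c k) by exact: smooth_cell_weight.
have sh : smooth h.
  by apply: smooth_sum => k; apply: smoothM; [exact: smooth_cst|exact: sw].
exists h; split => // x ox.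
  have -> : h x - f x = \sum_(k : T) (f (y k) - f x) * cell_weight s c k x.
    under [RHS]eq_bigr do rewrite mulrBl.
    by rewrite sumrB -mulr_sumr sum_cell_weight ?mulr1//; exact: inN.
  have := main (fun k => cell_weight s c k x) x 1 ox ler01.
  move=> /(_ _)/le_trans; apply; first by move=> k; rewrite mul1r cell_weight_le.
  have -> : 3 * K * eta * 1 * 3 ^+ n = A * eta by rewrite /A; ring.
  by rewrite /eta mulrA ler_pdivrMr ?ltr_wpDl// mulrC ler_wpM2l ?(ltW d0)// lerDl.
pose v : 'rV[R]_n := delta_mx ord0 i.
have dw (k : T) : derivable (cell_weight s c k) x v by exact: smooth_derivable.
have Dsum (b : T -> R) : 'D_v (fun x => \sum_(k : T) b k * cell_weight s c k x) x = \sum_(k : T) b k * 'D_v (cell_weight s c k) x.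
  exact: derive_bigsum.
have D0 : \sum_(k : T) 'D_v (cell_weight s c k) x = 0.
  have := Dsum (fun=> 1); under [in RHS]eq_bigr do rewrite mul1r.
  move=> <-; rewrite (@near_eq_derive _ _ _ _ (fun=> 1 : R)) ?derive_cst//.
  have : \forall z \near x, om z by exact: open_nbhs_nbhs.
  apply: filterS => z oz; under eq_bigr do rewrite mul1r.
  by rewrite sum_cell_weight//; exact: inN.
have -> : 'D_v h x = \sum_(k : T) (f (y k) - f x) * 'D_v (cell_weight s c k) x.
  rewrite /h Dsum; under [RHS]eq_bigr do rewrite mulrBl.
  by rewrite sumrB -mulr_sumr D0 mulr0 subr0.
have := main (fun k => 'D_v (cell_weight s c k) x) x (`|s| * M) ox (mulr_ge0 (normr_ge0 _) M0).
move=> /(_ _)/le_trans; apply; first by move=> k; exact: derive_cell_weight_le.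
rewrite (gtr0_norm s0) (_ : _ * _ * (s * M) * _ = A * M)//.
by rewrite /A /s; field; rewrite gt_eqF.
Qed.

(** * Almost everywhere limits of derivatives *)

(** The infima of the norms over the decreasing sets [P m] increase to a limit.
    Two elements with norm close to it have a midpoint with norm not much
    smaller, and are close to each other by the parallelogram identity. *)
Lemma min_norm_sequence (R : realType) (X : ipSpace R) (P : nat -> X -> Prop) (B : R) : is_hilbert X ->
  (forall m, exists a, P m a) -> (forall m a, P m a -> ip_mem X a) ->
  (forall m j a, (m <= j)%N -> P j a -> P m a) ->
  (forall m a b, P m a -> P m b -> P m (2^-1 *: (a + b))) ->
  (forall m a, P m a -> ip X a a <= B) ->
  exists a : nat -> X, (forall m, P m (a m)) /\ forall m, ipnorm (a m.+1 - a m) <= 2^-1 ^+ m.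
Proof.
move=> HX P0 Pmem Pdec Pmid PB.
pose E m := [set r | exists2 a, P m a & r = ip X a a].
have E0 m : E m !=set0 by have [a Pa] := P0 m; exists (ip X a a); exists a.
have Elb m : has_lbound (E m).
  by exists 0 => _ [a Pa ->]; apply: ip_ge0 => //; exact: Pmem Pa.
pose D := range (fun m => inf (E m)).
have Dub : has_ubound D.
  exists B => _ [m _ <-]; have [a Pa] := P0 m.
  by apply: le_trans (PB _ _ Pa); apply: ge_inf => //; exists a.
have D0 : D !=set0 by exists (inf (E 0%N)); exists 0%N.
have infle m j : (m <= j)%N -> inf (E m) <= inf (E j).
  move=> mj; apply: lb_le_inf => // _ [a Pa ->]; apply: ge_inf => //.
  by exists a => //; exact: Pdec Pa.
have pick k : exists a, exists2 n, (k <= n)%N & [/\ P n a, ip X a a <= sup D + 4^-1 ^+ k / 8 & sup D - 4^-1 ^+ k / 8 <= inf (E n)].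
  have eta0 : 0 < 4^-1 ^+ k / 8 :> R by rewrite divr_gt0// exprn_gt0.
  have [_ [m _ <-] mD] := sup_adherent eta0 (conj D0 Dub).
  (* Beyond [m] the infima are close to their supremum, and beyond [k] the
     element belongs to [P k]. *)
  pose n := maxn m k.
  have [_ [a Pa ->] an] := inf_adherent eta0 (conj (E0 n) (Elb n)).
  exists a, n; first exact: leq_maxr.
  split => //; last by apply: le_trans (ltW mD) _; apply: infle; exact: leq_maxl.
  apply: le_trans (ltW an) _; rewrite lerD2r; apply: ub_le_sup => //.
  by exists n.
have [a Ha] := choice pick.
exists a; split => m; first by have [n mn [Pa _ _]] := Ha m; exact: Pdec mn Pa.
have [n mn [Pa a1 a2]] := Ha m; have [l ml [Pb b1 b2]] := Ha m.+1.
set x := a m in Pa a1 *; set y := a m.+1 in Pb b1 *.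
have mx := Pmem _ _ Pa; have my := Pmem _ _ Pb.
pose k := minn n l.
have Pz : P k (2^-1 *: (x + y)).
  by apply: Pmid; [apply: Pdec Pa; exact: geq_minl|apply: Pdec Pb; exact: geq_minr].
have low : sup D - 4^-1 ^+ m / 8 <= ip X (2^-1 *: (x + y)) (2^-1 *: (x + y)).
  apply: (@le_trans _ _ (inf (E k))); last by apply: ge_inf => //; eexists; first exact: Pz.
  rewrite /k; case: (leqP n l) => _ //; apply: le_trans b2.
  rewrite lerD2l lerN2 exprS ler_pM2r ?invr_gt0//.
  by apply: ler_piMl; [exact: exprn_ge0|rewrite invf_le1 ?ltr0n// ler1n].
have mxy := memD HX mx my.
move: low; rewrite ipZl// ?ipZr//; last exact: memZ.
rewrite mulrA ip_sqrD// => low.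
rewrite -(@ler_pXn2r _ 2)// ?nnegrE ?ipnorm_ge0 ?exprn_ge0// ipnorm_sqr//; last exact: memB.
rewrite ip_sqrB// (ipC HX my mx) -exprM mulnC exprM.
have -> : 2^-1 ^+ 2 = 4^-1 :> R by field.
move: b1; rewrite exprS => b1.
have : 0 <= 4^-1 ^+ m :> R by rewrite exprn_ge0.
by move: low a1 b1; move: (4^-1 ^+ m) (sup D) (ip X x x) (ip X y y) (ip X x y) => *; lra.
Qed.

Lemma nneseries_ub (R : realType) (u : nat -> \bar R) (M : \bar R) : (forall k, (0 <= u k)%E) ->
  (forall N, (\sum_(k < N) u k <= M)%E) -> (\sum_(0 <= k <oo) u k <= M)%E.
Proof.
move=> u0 uM; apply: lime_le; first exact: is_cvg_nneseries.
by apply: nearW => N; rewrite big_mkord; exact: uM.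
Qed.

(** A telescoping series whose absolute values have a finite integral converges
    almost everywhere. *)
Lemma fast_L1_cvg_ae d (T : measurableType d) (R : realType) (mu : {measure set T -> \bar R}) (D : set T)
    (a : nat -> T -> R) (K : R) : measurable D -> (forall k, measurable_fun D (a k)) -> 0 <= K ->
  (forall k, (\int[mu]_(x in D) `|a k.+1 x - a k x|%:E <= (K * 2^-1 ^+ k)%:E)%E) ->
  {ae mu, forall x, D x -> cvgn (a ^~ x)}.
Proof.
move=> mD ma K0 Ka; pose f k x := (`|a k.+1 x - a k x|)%:E.
have mf k : measurable_fun D (f k).
  by apply/measurable_EFinP; apply: measurableT_comp => //; exact: measurable_funB.
have f0 k x : (0 <= f k x)%E by rewrite lee_fin.
have If : (\int[mu]_(x in D) \sum_(0 <= k <oo) f k x <= (2 * K)%:E)%E.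
  rewrite integral_nneseries//; apply: nneseries_ub => [k|N]; first exact: integral_ge0.
  apply: (@le_trans _ _ (\sum_(k < N) (K * 2^-1 ^+ k)%:E)%E).
    by apply: lee_sum => k _; exact: Ka.
  rewrite sumEFin lee_fin -mulr_sumr mulrC; apply: ler_wpM2r => //.
  have -> : \sum_(k < N) 2^-1 ^+ k = 2 - 2 * 2^-1 ^+ N :> R.
    elim: N => [|N IH]; first by rewrite big_ord0 expr0 mulr1 subrr.
    by rewrite big_ord_recr/= IH exprS mulrA divff// mul1r; lra.
  by rewrite gerBl mulr_ge0// exprn_ge0.
have iF : mu.-integrable D (fun x => (\sum_(0 <= k <oo) f k x)%E).
  apply/integrableP; split; first exact: ge0_emeasurable_sum.
  rewrite (_ : (\int[mu]_(x in D) _ = \int[mu]_(x in D) \sum_(0 <= k <oo) f k x)%E); last first.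
    by apply: eq_integral => x _; rewrite gee0_abs// nneseries_ge0.
  by apply: le_lt_trans If _; rewrite ltry.
have := integrable_ae mD iF; apply: filterS => x H Dx.
have {}H := H Dx.
pose b k := a k.+1 x - a k x.
have cb : cvgn (series b).
  apply: normed_cvg; apply: nondecreasing_is_cvgn.
    by apply: nondecreasing_series => k _ _; exact: normr_ge0.
  exists (fine (\sum_(0 <= k <oo) f k x)%E) => _ [N _ <-].
  rewrite -lee_fin fineK// /series/= -sumEFin.
  by apply: nneseries_lim_ge => k _ _; exact: f0.
have -> : a ^~ x = (fun n => a 0%N x + series b n).
  apply/funext; elim => [|n IH]; first by rewrite /series/= big_geq// addr0.
  by rewrite seriesSr addrA -IH /b subrKC.
by apply: is_cvgD => //; exact: is_cvg_cst.
Qed.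

Section lipschitz_derivative.
Context {R : realType} {n : nat} (om : set 'rV[R]_n) (gm gp : 'rV[R]_n -> R) (c G : R).
Let g x := gp x - gm x.
Let mu := @lebesgue_rV R n.
Hypothesis om_open : open om.
Hypothesis om_fin : (mu om < +oo)%E.
Hypothesis g_cont : {in om, continuous g}.
Hypothesis c0 : 0 < c.
Hypothesis gc : forall x, om x -> c <= g x.
Hypothesis gG : forall x, om x -> g x <= G.
Let X := limit_space om gm gp.
Hypothesis HX : is_hilbert X.

Let om_meas : measurable om. Proof. exact: open_measurable_rV. Qed.
Let g0 x : om x -> 0 < g x. Proof. by move=> /gc; exact: lt_le_trans. Qed.
Let g_meas : measurable_fun om g. Proof. exact: open_continuous_measurable_rV. Qed.

Let bdd_mem (u : 'rV[R]_n -> R) M : measurable_fun om u -> (forall x, om x -> `|u x| <= M) -> ip_mem X u.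
Proof. by move=> mu_ uM; exact: (@bounded_Lp _ _ _ 2 u M). Qed.

Let inv_g_mem : ip_mem X (fun x => (g x)^-1).
Proof.
apply: (@bdd_mem _ c^-1).
  apply: open_continuous_measurable_rV => // x ox; apply: continuousV; last exact: g_cont.
  by rewrite gt_eqF// g0//; rewrite inE in ox.
move=> x ox; rewrite ger0_norm ?invr_ge0 ?(ltW (g0 ox))//.
by rewrite lef_pV2 ?posrE//; [exact: gc|exact: g0].
Qed.

(** Pair the absolute value with [1 / g]. *)
Lemma integral_norm_le_ipnorm (u : X) : ip_mem X u ->
  (\int[mu]_(x in om) `|u x|%:E <= (ipnorm (X:=X) (fun x => (g x)^-1) * ipnorm u)%:E)%E.
Proof.
move=> mu_; have /LpP[//|//|meas_u fu] := mu_.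
pose v : X := fun x => `|u x|.
have mv : ip_mem X v.
  apply/LpP => //; split; first exact: measurableT_comp.
  by under eq_integral do rewrite normr_id.
have nv : ipnorm v = ipnorm u.
  rewrite /ipnorm; congr Num.sqrt; apply: eq_Rintegral => x _.
  by rewrite -!mulrA /v -!expr2 real_normK// num_real.
have iu := Lp_integrable om_meas om_fin (ler1n _ 2) mu_.
have iv : mu.-integrable om (EFin \o v) by exact: (integrable_abse iu).
have -> : (\int[mu]_(x in om) `|u x|%:E = (ip X (fun x => (g x)^-1) v)%:E)%E.
  rewrite /ip/= /Rintegral fineK.
    by apply: eq_integral => x; rewrite inE => ox; rewrite mulfV ?mul1r// gt_eqF// g0.
  rewrite (_ : (\int[lebesgue_rV]_(x in om) _ = \int[mu]_(x in om) (v x)%:E)%E).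
    exact: (integrable_fin_num om_meas iv).
  by apply: eq_integral => x; rewrite inE => ox; rewrite mulfV ?mul1r// gt_eqF// g0.
rewrite lee_fin -nv; apply: le_trans (ler_norm _) _; exact: cauchy_schwarz.
Qed.

(** The derivatives of the approximants of precision [1 / (m + 1)] form a
    convex set, so [min_norm_sequence] applies in the weighted space. The limit
    function [F] is an almost everywhere derivative of [f], obtained together
    with the approximants that the integrations by parts require. *)
Lemma smooth_approx_derivative_ae (f : 'rV[R]_n -> R) (C : R) (i : 'I_n) :
  (forall d, 0 < d -> exists h : 'rV[R]_n -> R, [/\ smooth h,
    forall x, om x -> `|h x - f x| <= d & forall x, om x -> `|'D_(delta_mx ord0 i) h x| <= C]) ->
  exists (h : nat -> 'rV[R]_n -> R) (F : 'rV[R]_n -> R),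
  [/\ forall m, [/\ smooth (h m), forall x, om x -> `|h m x - f x| <= m.+1%:R^-1 &
         forall x, om x -> `|'D_(delta_mx ord0 i) (h m) x| <= C],
      measurable_fun om F, forall x, om x -> `|F x| <= C &
      {ae mu, forall x, om x -> 'D_(delta_mx ord0 i) (h m) x @[m --> \oo] --> F x}].
Proof.
move=> Hf; pose v : 'rV[R]_n := delta_mx ord0 i.
pose A m (h : 'rV[R]_n -> R) := [/\ smooth h, forall x, om x -> `|h x - f x| <= m.+1%:R^-1 &
  forall x, om x -> `|'D_v h x| <= C].
pose P m (a : X) := exists2 h, A m h & a = 'D_v h.
have md h : smooth h -> measurable_fun om ('D_v h : 'rV[R]_n -> R).
  move=> sh; apply: measurable_funTS; apply: continuous_measurable_rV.
  by apply: smooth_continuous; apply: smooth_derive; exact: sh.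
have Pmem m a : P m a -> ip_mem X a.
  by move=> [h [sh _ hC] ->]; apply: (@bdd_mem _ C) => //; exact: md.
have [a [Pa da]] : exists a : nat -> X, (forall m, P m (a m)) /\ forall m, ipnorm (a m.+1 - a m) <= 2^-1 ^+ m.
  apply: (@min_norm_sequence R X P (G * C * C * fine (mu om)) HX).
  - move=> m; have d0 : (0 : R) < m.+1%:R^-1 by rewrite invr_gt0.
    by have [h Ah] := Hf _ d0; exists ('D_v h); exists h.
  - exact: Pmem.
  - move=> m j a mj [h [sh hf hC] ->]; exists h => //; split => // x ox.
    by apply: le_trans (hf x ox) _; rewrite lef_pV2 ?posrE// ler_nat.
  - move=> m a b [h1 [s1 f1 C1] ->] [h2 [s2 f2 C2] ->].
    have s12 : smooth (fun x => h1 x + h2 x) by exact: smoothD.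
    have d12 x : 'D_v (fun x => 2^-1 * (h1 x + h2 x)) x = 2^-1 * ('D_v h1 x + 'D_v h2 x).
      have e1 : derivable h1 x v by exact: smooth_derivable s1.
      have e2 : derivable h2 x v by exact: smooth_derivable s2.
      have e12 : derivable (fun x => h1 x + h2 x) x v by exact: smooth_derivable s12.
      rewrite -[X in _ = _ * X](deriveD e1 e2); exact: (deriveZ 2^-1 e12).
    exists (fun x => 2^-1 * (h1 x + h2 x)); last by apply/funext => x; rewrite d12.
    split.
    + by apply: smoothM; [exact: smooth_cst|exact: s12].
    + move=> x ox; have := f1 x ox; have := f2 x ox; set q := _^-1.
      rewrite (_ : 2^-1 * (h1 x + h2 x) - f x = 2^-1 * ((h1 x - f x) + (h2 x - f x))); last by field.
      move=> a1 a2; rewrite normrM ger0_norm// ler_pdivrMl//.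
      by apply: le_trans (ler_normD _ _) _; rewrite mulr2n mulrDl mul1r; exact: lerD.
    + move=> x ox; have a1 := C1 x ox; have a2 := C2 x ox.
      rewrite d12 normrM ger0_norm// ler_pdivrMl//.
      by apply: le_trans (ler_normD _ _) _; rewrite mulr2n mulrDl mul1r; exact: lerD.
  - move=> m a [h [sh _ hC] ->] /=.
    rewrite -Rintegral_cst//.
    have bd x : om x -> `|g x * 'D_v h x * 'D_v h x| <= G * C * C.
      move=> ox; rewrite !normrM; apply: ler_pM; [by rewrite mulr_ge0|by []| |exact: hC].
      by apply: ler_pM => //; [rewrite ger0_norm ?gG// ltW// g0|exact: hC].
    apply: le_Rintegral => //.
    + apply: (@bounded_integrable _ _ R mu om _ (G * C * C)) => //.
      by apply: measurable_funM; [apply: measurable_funM => //|]; exact: md.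
    + exact: cst_integrable.
    + by move=> x ox; apply: le_trans (ler_norm _) _; exact: bd.
have /choice[h Ah] m : exists h, A m h /\ a m = 'D_v h by have [h Ah E] := Pa m; exists h.
have ma m : measurable_fun om (a m).
  by have [[sh _ _] ->] := Ah m; exact: md.
have aC m x : om x -> `|a m x| <= C by have [[_ _ hC] ->] := Ah m; exact: hC.
pose K := ipnorm (X:=X) (fun x => (g x)^-1).
have K0 : 0 <= K by exact: ipnorm_ge0.
have cva : {ae mu, forall x, om x -> cvgn (fun m => a m x)}.
  apply: (@fast_L1_cvg_ae _ _ R mu om (fun m => a m) K om_meas ma K0) => k.
  apply: le_trans (integral_norm_le_ipnorm (memB HX (Pmem _ _ (Pa k.+1)) (Pmem _ _ (Pa k)))) _.
  by rewrite lee_fin ler_wpM2l.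
case: (cva) => N [mN N0 subN].
(* Setting the sequence to 0 on a measurable null set makes it converge
   everywhere, so that its limit is measurable. *)
pose b m x := a m x * \1_(~` N) x.
pose F x := limn (b ^~ x).
have cvb x : om x -> b m x @[m --> \oo] --> F x.
  move=> ox; have [xN|xN] := pselect (N x).
    have -> : b ^~ x = fun=> 0.
      by apply/funext => m; rewrite /b indicE memNset ?mulr0//= => /(_ xN).
    by rewrite /F (_ : b ^~ x = fun=> 0) ?lim_cst//; [exact: cvg_cst|apply/funext => m; rewrite /b indicE memNset ?mulr0//= => /(_ xN)].
  have -> : b ^~ x = a ^~ x.
    by apply/funext => m; rewrite /b indicE mem_set ?mulr1.
  rewrite /F (_ : b ^~ x = a ^~ x); last by apply/funext => m; rewrite /b indicE mem_set ?mulr1.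
  by apply: contrapT => nc; apply: xN; apply: subN => /(_ ox).
exists h, F; split.
- by move=> m; have [] := Ah m.
- apply: (@measurable_fun_cvg _ _ R om b) => // m.
  by apply: measurable_funM => //; apply: measurable_indic; exact: measurableC.
- move=> x ox; apply: (ler_cvg_to (cvg_norm (cvb x ox)) (cvg_cst C)); apply: nearW => m.
  rewrite /b normrM indicE; case: (_ \in _); rewrite ?normr1 ?mulr1 ?normr0 ?mulr0; first exact: aC.
  exact: le_trans (normr_ge0 _) (aC m x ox).
- exists N; split => // x /= nx; apply: contrapT => xN; apply: nx => ox.
  rewrite (_ : (fun m => 'D_v (h m) x) = b ^~ x); first exact: cvb.
  by apply/funext => m; rewrite /b indicE mem_set ?mulr1//; have [_ ->] := Ah m.
Qed.
End lipschitz_derivative.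

(** * Vector fields tangent to the graphs *)

Section shear.
Context {R : realType} {V : normedModType R}.
Implicit Types (f g : V -> R) (x v : V).

Lemma smooth_deriveM f g x v : smooth f -> smooth g ->
  'D_v (fun y => f y * g y) x = f x * 'D_v g x + g x * 'D_v f x.
Proof.
move=> sf sg; have df : derivable f x v by exact: smooth_derivable sf.
have dg : derivable g x v by exact: smooth_derivable sg.
exact: (deriveM df dg).
Qed.

Lemma smooth_deriveD f g x v : smooth f -> smooth g ->
  'D_v (fun y => f y + g y) x = 'D_v f x + 'D_v g x.
Proof.
move=> sf sg; have df : derivable f x v by exact: smooth_derivable sf.
have dg : derivable g x v by exact: smooth_derivable sg.
exact: (deriveD df dg).
Qed.

Lemma smooth_derive_comp (chi : R -> R) f x v : smooth chi -> smooth f ->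
  'D_v (fun y => chi (f y)) x = 'D_1 chi (f x) * 'D_v f x.
Proof.
move=> sc sf; have df : derivable f x v by exact: smooth_derivable sf.
have dc : derivable chi (f x) 1 by exact: smooth_derivable sc.
exact: (@derive_val _ _ _ _ _ _ _ (is_derive_dir_comp dc df)).
Qed.

Lemma smooth_deriveN f x v : smooth f -> 'D_v (fun y => - f y) x = - 'D_v f x.
Proof.
move=> sf; have df : derivable f x v by exact: smooth_derivable sf.
exact: (deriveN df).
Qed.

(** The field [(k, - (t d_v k + e d_v a))] annihilates [s] and is divergence
    free: [d_v k - d_w (t d_v k) = 0]. Hence only the derivative of [P]
    survives. *)
Lemma shear_divergence (k a t P : V -> R) (chi : R -> R) (e : R) x v w :
  smooth k -> smooth a -> smooth t -> smooth P -> smooth chi -> e != 0 ->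
  (forall y, 'D_v t y = 0) -> (forall y, 'D_w t y = 1) ->
  (forall y, 'D_w k y = 0) -> (forall y, 'D_w a y = 0) -> (forall y, 'D_w P y = 0) ->
  (forall y, 'D_w ('D_v k) y = 0) -> (forall y, 'D_w ('D_v a) y = 0) ->
  let s y := t y * k y / e + a y in
  'D_v (fun y => k y * P y * chi (s y)) x +
  'D_w (fun y => - ((t y * 'D_v k y + e * 'D_v a y) * P y * chi (s y))) x =
  k x * 'D_v P x * chi (s x).
Proof.
move=> sk sa st sP sc e0 tv tw kw aw Pw kvw avw s.
have skv : smooth ('D_v k) by apply: smooth_derive; exact: sk.
have sav : smooth ('D_v a) by apply: smooth_derive; exact: sa.
have stk : smooth (fun y => t y * k y) by exact: smoothM st sk.
have sc1 : smooth (fun _ : V => e^-1) by exact: smooth_cst.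
have sc2 : smooth (fun _ : V => e) by exact: smooth_cst.
have ste : smooth (fun y => t y * k y / e) by exact: smoothM stk sc1.
have ss : smooth s by exact: smoothD ste sa.
have scs : smooth (fun y => chi (s y)) by exact: smooth_comp sc ss.
have skP : smooth (fun y => k y * P y) by exact: smoothM sk sP.
have stkv : smooth (fun y => t y * 'D_v k y) by exact: smoothM st skv.
have seav : smooth (fun y => e * 'D_v a y) by exact: smoothM sc2 sav.
have sq : smooth (fun y => t y * 'D_v k y + e * 'D_v a y) by exact: smoothD stkv seav.
have sqP : smooth (fun y => (t y * 'D_v k y + e * 'D_v a y) * P y) by exact: smoothM sq sP.
have Ds u : 'D_u s x = (t x * 'D_u k x + k x * 'D_u t x) / e + 'D_u a x.
  rewrite (smooth_deriveD x u ste sa) (smooth_deriveM x u stk sc1) derive_cst mulr0 add0r.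
  by rewrite (smooth_deriveM x u st sk) [_^-1 * _]mulrC.
rewrite (smooth_deriveM x v skP scs) (smooth_deriveM x v sk sP) (smooth_derive_comp x v sc ss) Ds tv.
have sqPc : smooth (fun y => (t y * 'D_v k y + e * 'D_v a y) * P y * chi (s y)) by exact: smoothM sqP scs.
rewrite (smooth_deriveN x w sqPc) (smooth_deriveM x w sqP scs) (smooth_deriveM x w sq sP).
rewrite (smooth_deriveD x w stkv seav) (smooth_deriveM x w st skv) (smooth_deriveM x w sc2 sav).
rewrite derive_cst (smooth_derive_comp x w sc ss) Ds tw kw aw Pw kvw avw.
by field.
Qed.
End shear.

Section support.
Context {R : realType} {n : nat} (om : set 'rV[R]_n) (gm gp : 'rV[R]_n -> R) (c G e B Z : R).
Let g x := gp x - gm x.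
Hypothesis omB : forall x, om x -> forall j, `|x ord0 j| <= B.
Hypothesis c0 : 0 < c.
Hypothesis gc : forall x, om x -> c <= g x.
Hypothesis G0 : 0 < G.
Hypothesis gG : forall x, om x -> g x <= G.
Hypothesis gmZ : forall x, om x -> `|gm x| <= Z.
Hypothesis e0 : 0 < e.

(** The relative height in the fibre when [k = 1 / g] and [a = - gm / g]. *)
Definition tilt (k a : 'rV[R]_n -> R) (z : 'rV[R]_n.+1) := z ord0 ord_max * k (col' ord_max z) / e + a (col' ord_max z).

Lemma smooth_tilt k a : smooth k -> smooth a -> smooth (tilt k a).
Proof.
move=> sk sa; apply: smoothD; last exact: smooth_col'.
apply: smoothM; last exact: smooth_cst.
by apply: smoothM; [exact: smooth_coord|exact: smooth_col'].
Qed.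

Lemma tilt_thin z : om (col' ord_max z) ->
  thin_domain om gm gp e z <-> 0 < tilt (fun x => (g x)^-1) (fun x => - gm x / g x) z < 1.
Proof.
move=> oz; have g0 : 0 < g (col' ord_max z) := lt_le_trans c0 (gc oz).
rewrite /thin_domain /tilt /=; set x := col' _ z in oz g0 *; set t := z ord0 ord_max.
have -> : t * (g x)^-1 / e + - gm x / g x = (t - e * gm x) / (e * g x) by field; rewrite !gt_eqF.
have eg : 0 < e * g x by rewrite mulr_gt0.
rewrite ltr_pdivlMr// ltr_pdivrMr// mul0r mul1r subr_gt0 ltrBlDr /g mulrBr subrK.
by split => [[]|].
Qed.

(** If [k] and [a] are close to [1 / g] and [- gm / g], the approximate
    relative height is close to the true one on bounded heights, so cutting it
    off away from 0 and 1 gives compact support in the thin domain. The height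
    is bounded first, by a multiple [Y] of [e], because [k] is bounded below.
    *)
Lemma tilt_support j : exists2 d, 0 < d & forall (k a : 'rV[R]_n -> R) (K : set 'rV[R]_n),
  compact K -> K `<=` om -> smooth k -> smooth a ->
  (forall x, om x -> `|k x - (g x)^-1| <= d) -> (forall x, om x -> `|a x - (- gm x / g x)| <= d) ->
  exists K' : set 'rV[R]_n.+1, [/\ compact K', K' `<=` thin_domain om gm gp e &
    forall z, ~ K' z -> ~ K (col' ord_max z) \/ ibump 0 1 j (tilt k a z) = 0].
Proof.
pose eta : R := j.+1%:R^-1; have eta0 : 0 < eta by rewrite invr_gt0.
pose Y := (2 + Z / c) * (2 * G).
pose d := Num.min ((2 * G)^-1) (Num.min 1 (eta / (2 * (`|Y| + 1)))).
have Y10 : 0 < `|Y| + 1 by rewrite ltr_wpDl.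
have d0 : 0 < d.
  by rewrite !lt_min ltr01 invr_gt0 mulr_gt0//=; apply: divr_gt0 => //; exact: mulr_gt0.
exists d => // k a K cK Kom ck ca hk ha.
have dG : d <= (2 * G)^-1 by rewrite /d ge_min lexx.
have d1 : d <= 1 by rewrite /d !ge_min lexx orbT.
have dY : d <= eta / (2 * (`|Y| + 1)) by rewrite /d !ge_min lexx !orbT.
have key z : om (col' ord_max z) -> eta <= tilt k a z <= 1 - eta ->
    `|z ord0 ord_max| <= e * Y /\ thin_domain om gm gp e z.
  move=> oz; rewrite /tilt; set x := col' _ z in oz *; set t := z ord0 ord_max => st.
  have g0 : 0 < g x := lt_le_trans c0 (gc oz).
  have Z0 : 0 <= Z := le_trans (normr_ge0 _) (gmZ oz).
  have Y0 : 0 <= Y by rewrite mulr_ge0 ?addr_ge0 ?divr_ge0 ?(ltW c0) ?mulr_ge0 ?(ltW G0).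
  have kx := hk x oz; have ax := ha x oz.
  have k1 : (2 * G)^-1 <= k x.
    have : G^-1 <= (g x)^-1 by rewrite lef_pV2 ?posrE//; exact: gG.
    have : `|k x - (g x)^-1| <= (2 * G)^-1 by exact: le_trans kx dG.
    have -> : G^-1 = (2 * G)^-1 + (2 * G)^-1 by field; rewrite gt_eqF.
    by rewrite ler_norml => /andP[h1 h2] h3; lra.
  have a1 : `|a x| <= 1 + Z / c.
    have : `|- gm x / g x| <= Z / c.
      rewrite normrM normrN [X in _ * X]ger0_norm ?invr_ge0 ?(ltW g0)//.
      by apply: ler_pM => //; [rewrite invr_ge0 ltW|exact: gmZ|rewrite lef_pV2 ?posrE//; exact: gc].
    have : `|a x - - gm x / g x| <= 1 by exact: le_trans ax d1.
    move=> h1 h2; have -> : a x = (a x - - gm x / g x) + - gm x / g x by rewrite subrK.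
    by apply: le_trans (ler_normD _ _) _; exact: lerD.
  have k0 : 0 < k x by apply: lt_le_trans k1; rewrite invr_gt0 mulr_gt0.
  have tY : `|t| <= e * Y.
    have E : t * k x = e * ((t * k x / e + a x) - a x) by rewrite addrK; field; rewrite gt_eqF.
    have : `|t * k x| <= e * (2 + Z / c).
      rewrite E normrM (gtr0_norm e0) ler_wpM2l ?(ltW e0)//.
      apply: le_trans (ler_normB _ _) _; have -> : 2 + Z / c = 1 + (1 + Z / c) by ring.
      apply: lerD => //; case/andP: st => s1 s2.
      by rewrite ger0_norm ?(le_trans (ltW eta0))// (le_trans s2)// gerBl ltW.
    rewrite normrM (gtr0_norm k0) => h; rewrite /Y mulrA -ler_pdivrMr ?mulr_gt0//.
    by apply: le_trans h; apply: ler_wpM2l.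
  split => //; apply/(tilt_thin oz); rewrite /tilt -/x -/t.
  set s := _ / _ + a x in st; set s' := _ + _.
  have : `|s - s'| <= eta / 2.
    have -> : s - s' = t / e * (k x - (g x)^-1) + (a x - (- gm x / g x)) by rewrite /s /s'; ring.
    apply: (@le_trans _ _ (Y * d + d)).
      apply: le_trans (ler_normD _ _) _; apply: lerD => //.
      rewrite normrM; apply: ler_pM => //.
      by rewrite normrM [`|e^-1|]ger0_norm ?invr_ge0 ?(ltW e0)// ler_pdivrMr// mulrC.
    have -> : Y * d + d = d * (`|Y| + 1) by rewrite ger0_norm//; ring.
    have Y1 : 0 < `|Y| + 1 by rewrite ltr_wpDl.
    apply: le_trans (ler_wpM2r (ltW Y1) dY) _.
    by rewrite invfM mulrA mulrVK// unitfE gt_eqF.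
  by case/andP: st => s1 s2; rewrite ler_norml => /andP[h1 h2]; apply/andP; split; lra.
have ct : continuous (tilt k a) by apply: smooth_continuous; exact: smooth_tilt.
exists [set z | K (col' ord_max z) /\ eta <= tilt k a z <= 1 - eta]; split.
- pose M := Num.max B (e * Y).
  apply: (@subclosed_compact _ _ [set z : 'rV[R]_n.+1 | forall i, `[- M, M]%classic (z ord0 i)]).
  + apply: closedI.
      have cl : closed ((fun z : 'rV[R]_n.+1 => col' ord_max z : 'rV[R]_n) @^-1` K).
        apply: preimage_closed; first by move=> z _; exact: continuous_col'.
        by apply: compact_closed => //; exact: norm_hausdorff.
      exact: cl.
    have cl : closed [set z : 'rV[R]_n.+1 | eta <= tilt k a z <= 1 - eta].
      rewrite (_ : [set z | _] = tilt k a @^-1` `[eta, 1 - eta]%classic).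
        by apply: preimage_closed; [move=> z _; exact: ct|exact: interval_closed].
      by apply/seteqP; split => z /=; rewrite in_itv.
    exact: cl.
  + by apply: (@rV_compact _ _ (fun _ => `[- M, M]%classic)) => i; exact: segment_compact.
  + move=> z [Kz sz] i /=; rewrite in_itv/= -ler_norml /M le_max.
    have [tY _] := key z (Kom _ Kz) sz.
    case: (unliftP ord_max i) => [l ->|->]; last by rewrite tY orbT.
    by have := omB (Kom _ Kz) l; rewrite mxE => ->.
- by move=> z [Kz sz]; have [] := key z (Kom _ Kz) sz.
- move=> z nz; have [Kz|] := pselect (K (col' ord_max z)); last by left.
  right; apply: ibump_supp; apply/negP => sz; apply: nz; split => //.
  by move: sz; rewrite add0r.
Qed.
End support.

(** * The weak derivative of an average *)

Lemma derive_dir0 (R : realType) (V : normedModType R) (f : V -> R) x : 'D_0 f x = 0.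
Proof. by apply: derive_const_dir => h; rewrite scaler0 add0r. Qed.

Lemma col'_delta_lift (R : realType) n (i : 'I_n) :
  col' ord_max (delta_mx ord0 (lift ord_max i) : 'rV[R]_n.+1) = delta_mx ord0 i.
Proof. by rewrite -rcons_delta_lift col'_rcons. Qed.

Lemma col'_delta_last (R : realType) n : col' ord_max (delta_mx ord0 ord_max : 'rV[R]_n.+1) = 0.
Proof. by rewrite -rcons_delta_last col'_rcons. Qed.

(** The power of a sum is bounded by that of twice the maximum. *)
Lemma Lp_dominated (R : realType) n (Om : set 'rV[R]_n) p (f h F : 'rV[R]_n -> R) (C : R) : measurable Om -> 0 < p -> 0 <= C ->
  Lp Om p f -> Lp Om p h -> measurable_fun Om F -> (forall x, Om x -> `|F x| <= `|f x| + C * `|h x|) -> Lp Om p F.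
Proof.
move=> mO p0 C0 /(Lp_powR_integrable _ mO p0)[mf if_] /(Lp_powR_integrable _ mO p0)[mh ih] mF FC.
have ih' := @integrable_scale _ _ R lebesgue_rV Om (C `^ p) _ mO ih.
have iS := integrableD mO if_ ih'.
have iS' := @integrable_scale _ _ R lebesgue_rV Om (2 `^ p) _ mO iS.
apply/(Lp_powR_integrable _ mO p0); split => //.
apply: (@le_integrable _ _ _ lebesgue_rV Om mO _ _ _ _ iS').
  by apply/measurable_EFinP; apply: (measurableT_comp (measurable_powR p)); exact: measurableT_comp.
move=> x Ox /=; rewrite lee_fin [leLHS]ger0_norm ?powR_ge0// [leRHS]ger0_norm; last first.
  by rewrite mulr_ge0 ?addr_ge0 ?mulr_ge0 ?powR_ge0.
pose a := `|f x|; pose b := C * `|h x|.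
have a0 : 0 <= a by exact: normr_ge0. have b0 : 0 <= b by rewrite mulr_ge0.
have -> : C `^ p * `|h x| `^ p = b `^ p by rewrite powRM.
apply: (@le_trans _ _ ((2 * Num.max a b) `^ p)).
  rewrite ge0_ler_powR ?nnegrE ?(ltW p0)// ?mulr_ge0 ?le_max ?a0//.
  apply: le_trans (FC x Ox) _; rewrite -/a -/b mulr2n mulrDl mul1r.
  by apply: lerD; rewrite le_max lexx ?orbT.
rewrite powRM ?le_max ?a0// ler_wpM2l ?powR_ge0//.
by rewrite maxEle; case: ifP => _; [rewrite lerDr powR_ge0|rewrite lerDl powR_ge0].
Qed.

Section average_derivative.
Context {R : realType} {n : nat} (om : set 'rV[R]_n) (gm gp : 'rV[R]_n -> R) (c G e B Z p : R).
Let g x := gp x - gm x.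
Let mu := @lebesgue_rV R n.
Let mu1 := @lebesgue_rV R n.+1.
Hypothesis om_open : open om.
Hypothesis om_fin : (mu om < +oo)%E.
Hypothesis omB : forall x, om x -> forall j, `|x ord0 j| <= B.
Hypothesis gm_cont : {in om, continuous gm}.
Hypothesis gp_cont : {in om, continuous gp}.
Hypothesis c0 : 0 < c.
Hypothesis gc : forall x, om x -> c <= g x.
Hypothesis G0 : 0 < G.
Hypothesis gG : forall x, om x -> g x <= G.
Hypothesis Z0 : 0 <= Z.
Hypothesis gmZ : forall x, om x -> `|gm x| <= Z.
Hypothesis gpZ : forall x, om x -> `|gp x| <= Z.
Hypothesis e0 : 0 < e.
Hypothesis p1 : 1 <= p.
Let thin := thin_domain om gm gp e.
Let Av (F : 'rV[R]_n.+1 -> R) : 'rV[R]_n -> R := @thin_average R n om gm gp e F.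
Variables (u : 'rV[R]_n.+1 -> R) (w : 'rV[R]_n.+1 -> 'rV[R]_n.+1).
Hypothesis Lu : Lp thin p u.
Hypothesis uw : weak_gradient thin p u w.
Variable i : 'I_n.

Let om_meas : measurable om. Proof. exact: open_measurable_rV. Qed.
Let g0 x : om x -> 0 < g x. Proof. by move=> /gc; exact: lt_le_trans. Qed.
Let thin_meas : measurable thin. Proof. exact: thin_measurable. Qed.
Let thin_finite : (mu1 thin < +oo)%E.
Proof. exact: (thin_fin om_open om_fin gm_cont gp_cont c0 gc gG e0). Qed.
Let thin_open' : open thin. Proof. exact: thin_open. Qed.
Let thin_om z : thin z -> om (col' ord_max z). Proof. by case. Qed.

Let t (z : 'rV[R]_n.+1) := z ord0 ord_max.
Let wi z := w z ord0 (lift ord_max i).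
Let wn z := w z ord0 ord_max.
Let k0 x := (g x)^-1.
Let a0 x := - gm x / g x.

Let p0 : 0 < p. Proof. by apply: lt_le_trans p1. Qed.
Let iu : mu1.-integrable thin (EFin \o u). Proof. exact: (Lp_integrable _ _ p1 Lu). Qed.
Let iw j : mu1.-integrable thin (EFin \o (fun z => w z ord0 j)).
Proof. by have [Lw _] := uw j; exact: (Lp_integrable _ _ p1 Lw). Qed.

Lemma thin_last_bound z : thin z -> `|z ord0 ord_max| <= e * Z.
Proof.
move=> tz; have oz := thin_om tz; have [_ /andP[h1 h2]] := tz.
have := gmZ oz; have := gpZ oz; rewrite !ler_norml => /andP[a1 a2] /andP[b1 b2].
have e1 := ler_wpM2l (ltW e0) a2; have e2 := ler_wpM2l (ltW e0) b1; rewrite mulrN in e2.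
by apply/andP; split; lra.
Qed.

Let integrand (phi dphi : 'rV[R]_n -> R) (k dk da th : 'rV[R]_n.+1 -> R) z :=
  (u z * (k z * dphi (col' ord_max z)) + (wi z * k z - wn z * (t z * dk z + e * da z)) * phi (col' ord_max z)) * th z.

(** The preimage of a null set under the projection is null, by Fubini. *)
Lemma ae_thin (Q : 'rV[R]_n -> Prop) : {ae mu, forall x, om x -> Q x} ->
  {ae mu1, forall z, thin z -> Q (col' ord_max z)}.
Proof.
move=> [N [mN N0 subN]].
pose N' := thin `&` (fun z => col' ord_max z : 'rV[R]_n) @^-1` N.
have mN' : measurable N'.
  have mc := measurable_funTS (D := thin) (@measurable_col' R n).
  exact: mc.
exists N'; split => //; last first.
  move=> z /= nz; apply: contrapT => nN'; apply: nz => tz; apply: contrapT => nQ; apply: nN'.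
  by split => //; apply: subN => /(_ (thin_om tz)).
have mI : measurable_fun om (fun x => (\1_N x)%:E : \bar R).
  by apply/measurable_EFinP; exact: measurable_indic.
have <- : (\int[mu1]_(z in thin) (\1_N (col' ord_max z))%:E)%E = mu1 N'.
  transitivity (\int[mu1]_(z in thin) (\1_N' z)%:E)%E.
    apply: eq_integral => z; rewrite inE => tz; rewrite !indicE; congr ((_ : bool)%:R%:E).
    by apply/idP/idP; rewrite !inE; [move=> zN; split|case].
  by rewrite integral_indic// setIidl// => z [].
rewrite (ext_tonelli om_open gm_cont gp_cont c0 gc e0 mI); last by move=> x _; rewrite lee_fin.
have mg : measurable_fun om g.
  by apply: open_continuous_measurable_rV => // x ox; apply: continuousB; [exact: gp_cont|exact: gm_cont].
rewrite (@ae_eq_integral _ _ _ mu om (cst 0%E))//.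
- by rewrite integral0.
- by apply: emeasurable_funM => //; apply/measurable_EFinP; apply: measurable_funM.
- exists N; split => // x /= nx; apply: contrapT => xN; apply: nx => _.
  by rewrite indicE memNset// mul0e.
Qed.

(** Everything that enters the identity is bounded except [u] and its gradient,
    which are integrable; both limits below are instances. *)
Lemma shear_identity_limit (phi dphi : 'rV[R]_n -> R) (M C : R) (k dk da th : nat -> 'rV[R]_n.+1 -> R)
    (k' dk' da' th' : 'rV[R]_n.+1 -> R) : 0 <= M -> 0 <= C ->
  measurable_fun thin (fun z => phi (col' ord_max z)) -> measurable_fun thin (fun z => dphi (col' ord_max z)) ->
  (forall x, `|phi x| <= M) -> (forall x, `|dphi x| <= M) ->
  (forall m, [/\ measurable_fun thin (k m), measurable_fun thin (dk m), measurable_fun thin (da m) & measurable_fun thin (th m)]) ->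
  [/\ measurable_fun thin k', measurable_fun thin dk', measurable_fun thin da' & measurable_fun thin th'] ->
  (forall m z, thin z -> [/\ `|k m z| <= C, `|dk m z| <= C, `|da m z| <= C & `|th m z| <= 1]) ->
  {ae mu1, forall z, thin z -> k m z @[m --> \oo] --> k' z} ->
  {ae mu1, forall z, thin z -> dk m z @[m --> \oo] --> dk' z} ->
  {ae mu1, forall z, thin z -> da m z @[m --> \oo] --> da' z} ->
  {ae mu1, forall z, thin z -> th m z @[m --> \oo] --> th' z} ->
  (forall m, \int[mu1]_(z in thin) integrand phi dphi (k m) (dk m) (da m) (th m) z = 0) ->
  \int[mu1]_(z in thin) integrand phi dphi k' dk' da' th' z = 0.
Proof.
move=> M0 C0 mphi mdphi phiM dphiM mm [mk' mdk' mda' mth'] bd ck cdk cda cth int0.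
have mu_ : measurable_fun thin u by have /(LpP _ thin_meas p0)[] := Lu.
have mw j : measurable_fun thin (fun z => w z ord0 j).
  by have [/(LpP _ thin_meas p0)[]] := uw j.
have mt : measurable_fun thin t.
  by apply: measurable_funTS; exact: (measurable_rV_coord ord_max).
have mI (k1 dk1 da1 th1 : 'rV[R]_n.+1 -> R) : measurable_fun thin k1 -> measurable_fun thin dk1 ->
    measurable_fun thin da1 -> measurable_fun thin th1 -> measurable_fun thin (integrand phi dphi k1 dk1 da1 th1).
  move=> h1 h2 h3 h4; apply: measurable_funM => //; apply: measurable_funD.
    by apply: measurable_funM => //; exact: measurable_funM.
  apply: measurable_funM => //; apply: measurable_funB; first by apply: measurable_funM => //; exact: mw.
  apply: measurable_funM; first exact: mw.
  by apply: measurable_funD; apply: measurable_funM.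
(* The dominating function; the height is at most [e * Z]. *)
pose D z := (C * M) * `|u z| + ((C * M) * `|wi z| + (M * (e * Z * C + e * C)) * `|wn z|).
have iD : mu1.-integrable thin (EFin \o D).
  have ia f : mu1.-integrable thin (EFin \o f) -> mu1.-integrable thin (EFin \o (fun z => `|f z|)).
    by move=> h; exact: (integrable_abse h).
  have i1 := @integrable_scale _ _ R mu1 thin (C * M) _ thin_meas (ia _ iu).
  have i2 := @integrable_scale _ _ R mu1 thin (C * M) _ thin_meas (ia _ (iw (lift ord_max i))).
  have i3 := @integrable_scale _ _ R mu1 thin (M * (e * Z * C + e * C)) _ thin_meas (ia _ (iw ord_max)).
  exact: (integrableD thin_meas i1 (integrableD thin_meas i2 i3)).
have cvI : (\int[mu1]_(z in thin) integrand phi dphi (k m) (dk m) (da m) (th m) z) @[m --> \oo] -->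
    \int[mu1]_(z in thin) integrand phi dphi k' dk' da' th' z.
  apply: (@dominated_Rintegral _ _ R mu1 thin _ _ D) => //.
  - by move=> m; have [? ? ? ?] := mm m; exact: mI.
  - exact: mI.
  - apply: filterS2 (filterI ck cdk) (filterI cda cth) => z [h1 h2] [h3 h4] tz.
    apply: cvgM; last exact: h4.
    apply: cvgD; first by apply: cvgM; [exact: cvg_cst|apply: cvgM; [exact: h1|exact: cvg_cst]].
    apply: cvgM; last exact: cvg_cst.
    apply: cvgB; first by apply: cvgM; [exact: cvg_cst|exact: h1].
    apply: cvgM; first exact: cvg_cst.
    by apply: cvgD; apply: cvgM; [exact: cvg_cst|exact: h2|exact: cvg_cst|exact: h3].
  - move=> m z tz; have [b1 b2 b3 b4] := bd m z tz; have tZ := thin_last_bound tz.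
    rewrite /integrand normrM -[leRHS]mulr1; apply: ler_pM => //.
    apply: le_trans (ler_normD _ _) _; apply: lerD.
      by rewrite !normrM mulrC ler_wpM2r//; apply: ler_pM.
    rewrite normrM; apply: (@le_trans _ _ ((`|wi z| * C + `|wn z| * (e * Z * C + e * C)) * M)); last first.
      by rewrite le_eqVlt; apply/orP; left; apply/eqP; ring.
    apply: ler_pM => //; apply: le_trans (ler_normB _ _) _; apply: lerD; rewrite normrM; apply: ler_wpM2l => //.
    apply: le_trans (ler_normD _ _) _; rewrite !normrM (gtr0_norm e0); apply: lerD; first exact: ler_pM.
    by apply: ler_wpM2l => //; exact: ltW.
move: cvI; rewrite (_ : (fun m => _) = fun=> 0); last by apply/funext => m; exact: int0.
by move=> /(cvg_lim (@Rhausdorff R)) <-; rewrite lim_cst.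
Qed.

(** The test functions [F1] and [F2] are the components of the tangent field,
    and the sum of their integrations by parts is the integral of the
    divergence. *)
Lemma shear_identity_smooth phi j : test_function om phi -> exists2 d, 0 < d & forall k a : 'rV[R]_n -> R,
  smooth k -> smooth a ->
  (forall x, om x -> `|k x - k0 x| <= d) -> (forall x, om x -> `|a x - a0 x| <= d) ->
  \int[mu1]_(z in thin) integrand phi ('D_(delta_mx ord0 i) phi) (fun z => k (col' ord_max z))
    (fun z => 'D_(delta_mx ord0 i) k (col' ord_max z)) (fun z => 'D_(delta_mx ord0 i) a (col' ord_max z))
    (fun z => ibump 0 1 j (tilt e k a z)) z = 0.
Proof.
move=> [sphi [K [cK Kom Kphi]]].
have [d d0 Hd] := tilt_support (gp := gp) omB c0 gc G0 gG gmZ e0 j.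
exists d => // k a sk sa hk ha.
have [K' [cK' K'thin HK']] := Hd k a K cK Kom sk sa hk ha.
pose v : 'rV[R]_n.+1 := delta_mx ord0 (lift ord_max i).
pose v' : 'rV[R]_n.+1 := delta_mx ord0 ord_max.
pose k1 (z : 'rV[R]_n.+1) := k (col' ord_max z).
pose a1 (z : 'rV[R]_n.+1) := a (col' ord_max z).
pose P1 (z : 'rV[R]_n.+1) := phi (col' ord_max z).
pose chi := ibump 0 1 j : R -> R.
have sk1 : smooth k1 by exact: smooth_col' sk.
have sa1 : smooth a1 by exact: smooth_col' sa.
have sP1 : smooth P1 by exact: smooth_col' sphi.
have st : smooth t by exact: smooth_coord.
have sc : smooth chi by exact: smooth_ibump.
have sti : smooth (fun z => chi (tilt e k a z)) by apply: smooth_comp; [exact: sc|exact: smooth_tilt].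
have Dv (f : 'rV[R]_n -> R) z : 'D_v (fun y : 'rV[R]_n.+1 => f (col' ord_max y)) z = 'D_(delta_mx ord0 i) f (col' ord_max z).
  by rewrite derive_col' col'_delta_lift.
have Dv' (f : 'rV[R]_n -> R) z : 'D_v' (fun y : 'rV[R]_n.+1 => f (col' ord_max y)) z = 0.
  by rewrite derive_col' col'_delta_last derive_dir0.
have DDv' (f : 'rV[R]_n -> R) z : 'D_v' ('D_v (fun y : 'rV[R]_n.+1 => f (col' ord_max y))) z = 0.
  rewrite (_ : 'D_v _ = fun z => 'D_(delta_mx ord0 i) f (col' ord_max z)); last by apply/funext => y; exact: Dv.
  exact: (Dv' (fun x => 'D_(delta_mx ord0 i) f x)).
have tv z : 'D_v t z = 0 by rewrite derive_coord /v mxE eqxx/= (negbTE (neq_lift _ _)).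
have tv' z : 'D_v' t z = 1 by rewrite derive_coord /v' mxE !eqxx.
pose F1 z := k1 z * P1 z * chi (tilt e k a z).
pose F2 z := - ((t z * 'D_v k1 z + e * 'D_v a1 z) * P1 z * chi (tilt e k a z)).
have skv : smooth ('D_v k1) by apply: smooth_derive; exact: sk1.
have sav : smooth ('D_v a1) by apply: smooth_derive; exact: sa1.
have zero z : ~ K' z -> P1 z * chi (tilt e k a z) = 0.
  by move=> /HK'[nK|h]; [rewrite /P1 Kphi// mul0r|rewrite /chi h mulr0].
have T1 : test_function thin F1.
  split; first by exact: (smoothM (smoothM sk1 sP1) sti).
  by exists K'; split => // z /zero; rewrite /F1 -mulrA => ->; rewrite mulr0.
have T2 : test_function thin F2.
  split.
    apply: smoothN; apply: smoothM; last exact: sti.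
    apply: smoothM; last exact: sP1.
    apply: smoothD; first by apply: smoothM; [exact: st|exact: skv].
    by apply: smoothM; [exact: smooth_cst|exact: sav].
  by exists K'; split => // z /zero; rewrite /F2 -mulrA => ->; rewrite mulr0 oppr0.
have T1' := test_derive v T1; have T2' := test_derive v' T2.
have i1 := integrable_test thin_open' iu T1'.
have i2 := integrable_test thin_open' (iw (lift ord_max i)) T1.
have i3 := integrable_test thin_open' iu T2'.
have i4 := integrable_test thin_open' (iw ord_max) T2.
have E1 := (uw (lift ord_max i)).2 _ T1; have E2 := (uw ord_max).2 _ T2.
have i12 := integrableD thin_meas i1 i2; have i34 := integrableD thin_meas i3 i4.
transitivity (\int[mu1]_(z in thin) ((u z * 'D_v F1 z + w z ord0 (lift ord_max i) * F1 z) + (u z * 'D_v' F2 z + w z ord0 ord_max * F2 z))).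
  apply: eq_Rintegral => z _.
  have := shear_divergence z (v:=v) (w:=v') sk1 sa1 st sP1 sc (lt0r_neq0 e0) tv tv' (Dv' k) (Dv' a) (Dv' phi) (DDv' k) (DDv' a).
  move=> /= H; rewrite addrACA -mulrDr.
  have -> : 'D_v F1 z + 'D_v' F2 z = k1 z * 'D_v P1 z * chi (tilt e k a z) by exact: H.
  by rewrite /integrand /F1 /F2 /wi /wn !Dv /k1 /P1 /chi; ring.
rewrite (@RintegralD _ _ _ mu1 thin _ _ thin_meas i12 i34).
rewrite (@RintegralD _ _ _ mu1 thin _ _ thin_meas i1 i2) (@RintegralD _ _ _ mu1 thin _ _ thin_meas i3 i4).
by move: E1 E2; rewrite -/v -/v' => -> ->; rewrite !addNr addr0.
Qed.

Variables (kk ak : nat -> 'rV[R]_n -> R) (Ki Ai : 'rV[R]_n -> R) (C : R).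
Hypothesis Hk : forall m, [/\ smooth (kk m), forall x, om x -> `|kk m x - k0 x| <= m.+1%:R^-1 &
  forall x, om x -> `|'D_(delta_mx ord0 i) (kk m) x| <= C].
Hypothesis Ha : forall m, [/\ smooth (ak m), forall x, om x -> `|ak m x - a0 x| <= m.+1%:R^-1 &
  forall x, om x -> `|'D_(delta_mx ord0 i) (ak m) x| <= C].
Hypothesis mKi : measurable_fun om Ki.
Hypothesis mAi : measurable_fun om Ai.
Hypothesis KiC : forall x, om x -> `|Ki x| <= C.
Hypothesis AiC : forall x, om x -> `|Ai x| <= C.
Hypothesis ck : {ae mu, forall x, om x -> 'D_(delta_mx ord0 i) (kk m) x @[m --> \oo] --> Ki x}.
Hypothesis ca : {ae mu, forall x, om x -> 'D_(delta_mx ord0 i) (ak m) x @[m --> \oo] --> Ai x}.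
Hypothesis C0 : 0 <= C.

Let approx_cvg (f : nat -> 'rV[R]_n -> R) (f0 : 'rV[R]_n -> R) x : (forall m, `|f m x - f0 x| <= m.+1%:R^-1) ->
  f m x @[m --> \oo] --> f0 x.
Proof.
move=> H; apply/cvgrPdist_lt => d d0; have := near_inv d0.
by apply: filterS => m; apply: le_lt_trans; rewrite distrC.
Qed.

Let mg : measurable_fun om g.
Proof. by apply: open_continuous_measurable_rV => // x ox; apply: continuousB; [exact: gp_cont|exact: gm_cont]. Qed.

Let mk0 : measurable_fun om k0.
Proof.
apply: open_continuous_measurable_rV => // x ox; apply: continuousV.
  by rewrite gt_eqF// g0//; rewrite inE in ox.
by apply: continuousB; [exact: gp_cont|exact: gm_cont].
Qed.

Let ma0 : measurable_fun om a0.
Proof.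
apply: measurable_funM; last exact: mk0.
by apply: measurable_funN; exact: open_continuous_measurable_rV.
Qed.

Let mt : measurable_fun thin t.
Proof. by apply: measurable_funTS; exact: (measurable_rV_coord ord_max). Qed.

Let mext (f : 'rV[R]_n -> R) : measurable_fun om f -> measurable_fun thin (fun z => f (col' ord_max z)).
Proof. by move=> mf; exact: (ext_measurable om_open mf). Qed.

Let msmooth (f : 'rV[R]_n.+1 -> R) : smooth f -> measurable_fun thin f.
Proof. by move=> sf; apply: measurable_funTS; apply: continuous_measurable_rV; exact: smooth_continuous sf. Qed.

Let chi j : R -> R := ibump 0 1 j.

Let mchi j : measurable_fun thin (fun z => chi j (tilt e k0 a0 z)).
Proof.
have mtl : measurable_fun thin (tilt e k0 a0).
  apply: measurable_funD; last exact: mext.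
  apply: measurable_funM => //; apply: measurable_funM => //; exact: mext.
have cc : continuous (chi j) by apply: smooth_continuous; exact: smooth_ibump.
exact: (measurableT_comp (continuous_measurable_fun cc) mtl).
Qed.

Let chi_bound j (s : R) : `|chi j s| <= 1.
Proof. by rewrite ger0_norm ?ibump_ge0// ibump_le1. Qed.

Let k0_bound x : om x -> `|k0 x| <= c^-1.
Proof.
move=> ox; rewrite /k0 ger0_norm ?invr_ge0 ?(ltW (g0 ox))//.
by rewrite lef_pV2 ?posrE//; [exact: gc|exact: g0].
Qed.

Let C' := C + c^-1 + 1.
Let C'0 : 0 <= C'. Proof. by rewrite !addr_ge0// invr_ge0 ltW. Qed.
Let CC' : C <= C'. Proof. by rewrite /C' -addrA lerDl addr_ge0// invr_ge0 ltW. Qed.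
Let kC' : c^-1 + 1 <= C'. Proof. by rewrite /C' -addrA lerDr. Qed.

Let test_measurable phi : smooth phi -> measurable_fun thin (fun z : 'rV[R]_n.+1 => phi (col' ord_max z : 'rV[R]_n)).
Proof. by move=> sphi; apply: msmooth; exact: smooth_col' sphi. Qed.

(** The approximations of [1 / g] and [- gm / g] converge, with a fixed cutoff.
    The shift by [m0] makes them close enough for the supports to be compact.
    *)
Lemma shear_identity_cutoff phi j : test_function om phi ->
  \int[mu1]_(z in thin) integrand phi ('D_(delta_mx ord0 i) phi) (fun z => k0 (col' ord_max z))
    (fun z => Ki (col' ord_max z)) (fun z => Ai (col' ord_max z)) (fun z => chi j (tilt e k0 a0 z)) z = 0.
Proof.
move=> tphi; have tdphi := test_derive (delta_mx ord0 i) tphi.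
have [M1 HM1] := test_bounded tphi; have [M2 HM2] := test_bounded tdphi.
have [d d0 Hd] := shear_identity_smooth j tphi.
have [m0 _ Hm0] := near_inv d0.
have M10 : 0 <= M1 := le_trans (normr_ge0 _) (HM1 0).
have M20 : 0 <= M2 := le_trans (normr_ge0 _) (HM2 0).
have small m : (m + m0).+1%:R^-1 <= d by apply: ltW; apply: Hm0; exact: leq_addl.
have small1 m : (m.+1%:R^-1 : R) <= 1 by rewrite invf_le1 ?ltr0n// ler1n.
have sdk (f : 'rV[R]_n -> R) : smooth f -> smooth ('D_(delta_mx ord0 i) f) by move=> sf; apply: smooth_derive; exact: sf.
apply: (@shear_identity_limit phi ('D_(delta_mx ord0 i) phi) (M1 + M2) C'
   (fun m z => kk (m + m0)%N (col' ord_max z)) (fun m z => 'D_(delta_mx ord0 i) (kk (m + m0)%N) (col' ord_max z))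
   (fun m z => 'D_(delta_mx ord0 i) (ak (m + m0)%N) (col' ord_max z))
   (fun m z => chi j (tilt e (kk (m + m0)%N) (ak (m + m0)%N) z))).
- exact: addr_ge0.
- exact: C'0.
- exact: test_measurable tphi.1.
- exact: test_measurable tdphi.1.
- by move=> x; apply: le_trans (HM1 x) _; rewrite lerDl.
- by move=> x; apply: le_trans (HM2 x) _; rewrite lerDr.
- move=> m; have [sk _ _] := Hk (m + m0)%N; have [sa _ _] := Ha (m + m0)%N; split.
  + exact: test_measurable sk.
  + exact: test_measurable (sdk _ sk).
  + exact: test_measurable (sdk _ sa).
  + by apply: msmooth; apply: smooth_comp; [exact: smooth_ibump|exact: smooth_tilt].
- by split; [exact: mext|exact: mext|exact: mext|exact: mchi].
- move=> m z tz; have ox := thin_om tz; have [_ k1 k2] := Hk (m + m0)%N; have [_ a1 a2] := Ha (m + m0)%N; split.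
  + apply: le_trans kC'; rewrite -(subrK (k0 (col' ord_max z)) (kk _ _)) addrC.
    apply: le_trans (ler_normD _ _) _; apply: lerD; first exact: k0_bound.
    exact: le_trans (k1 _ ox) (small1 _).
  + exact: le_trans (k2 _ ox) CC'.
  + exact: le_trans (a2 _ ox) CC'.
  + exact: chi_bound.
- apply: aeW => z tz; apply: (@approx_cvg (fun m => kk (m + m0)%N) k0) => m.
  have [_ k1 _] := Hk (m + m0)%N; apply: le_trans (k1 _ (thin_om tz)) _.
  by rewrite lef_pV2 ?posrE// ler_nat ltnS leq_addr.
- move: (ae_thin ck); apply: filterS => z H tz.
  by have := H tz; rewrite -(cvg_shiftn m0).
- move: (ae_thin ca); apply: filterS => z H tz.
  by have := H tz; rewrite -(cvg_shiftn m0).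
- apply: aeW => z tz.
  have cc : continuous (chi j) by apply: smooth_continuous; exact: smooth_ibump.
  apply: (continuous_cvg _ (cc _)); rewrite /tilt.
  apply: cvgD; last first.
    apply: (@approx_cvg (fun m => ak (m + m0)%N) a0) => m.
    have [_ k1 _] := Ha (m + m0)%N; apply: le_trans (k1 _ (thin_om tz)) _.
    by rewrite lef_pV2 ?posrE// ler_nat ltnS leq_addr.
  apply: cvgM; last exact: cvg_cst.
  apply: cvgM; first exact: cvg_cst.
  apply: (@approx_cvg (fun m => kk (m + m0)%N) k0) => m.
  have [_ k1 _] := Hk (m + m0)%N; apply: le_trans (k1 _ (thin_om tz)) _.
  by rewrite lef_pV2 ?posrE// ler_nat ltnS leq_addr.
- move=> m; have [sk k1 _] := Hk (m + m0)%N; have [sa a1 _] := Ha (m + m0)%N.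
  by apply: Hd => // x ox; [exact: le_trans (k1 _ ox) (small m)|exact: le_trans (a1 _ ox) (small m)].
Qed.

(** The cutoff tends to 1 at every point of the thin domain. *)
Lemma shear_identity phi : test_function om phi ->
  \int[mu1]_(z in thin) integrand phi ('D_(delta_mx ord0 i) phi) (fun z => k0 (col' ord_max z))
    (fun z => Ki (col' ord_max z)) (fun z => Ai (col' ord_max z)) (fun=> 1) z = 0.
Proof.
move=> tphi; have tdphi := test_derive (delta_mx ord0 i) tphi.
have [M1 HM1] := test_bounded tphi; have [M2 HM2] := test_bounded tdphi.
have M10 : 0 <= M1 := le_trans (normr_ge0 _) (HM1 0).
have M20 : 0 <= M2 := le_trans (normr_ge0 _) (HM2 0).
apply: (@shear_identity_limit phi ('D_(delta_mx ord0 i) phi) (M1 + M2) C'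
   (fun _ z => k0 (col' ord_max z)) (fun _ z => Ki (col' ord_max z)) (fun _ z => Ai (col' ord_max z))
   (fun j z => chi j (tilt e k0 a0 z))).
- exact: addr_ge0.
- exact: C'0.
- exact: test_measurable tphi.1.
- exact: test_measurable tdphi.1.
- by move=> x; apply: le_trans (HM1 x) _; rewrite lerDl.
- by move=> x; apply: le_trans (HM2 x) _; rewrite lerDr.
- by move=> j; split; [exact: mext|exact: mext|exact: mext|exact: mchi].
- by split; [exact: mext|exact: mext|exact: mext|exact: measurable_cst].
- move=> j z tz; have ox := thin_om tz; split.
  + by apply: le_trans (k0_bound ox) (le_trans _ kC'); rewrite lerDl.
  + exact: le_trans (KiC ox) CC'.
  + exact: le_trans (AiC ox) CC'.
  + exact: chi_bound.
- by apply: aeW => z _; exact: cvg_cst.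
- by apply: aeW => z _; exact: cvg_cst.
- by apply: aeW => z _; exact: cvg_cst.
- apply: aeW => z tz; have s01 := (tilt_thin c0 gc e0 (thin_om tz)).1 tz.
  apply: cvg_near_cst; apply: ibump_eventually1; exact: s01.
- by move=> j; exact: shear_identity_cutoff.
Qed.

(** The weak derivative of the average is the average of this function: the
    derivative along the field that is tangent to the graphs. *)
Definition sheared_gradient z := wi z - g (col' ord_max z) * (wn z * (t z * Ki (col' ord_max z) + e * Ai (col' ord_max z))).

Lemma sheared_gradient_Lp : Lp thin p sheared_gradient.
Proof.
have [Lwi _] := uw (lift ord_max i); have [Lwn _] := uw ord_max.
have /(LpP _ thin_meas p0)[mwi _] := Lwi; have /(LpP _ thin_meas p0)[mwn _] := Lwn.
apply: (@Lp_dominated _ _ thin p wi wn _ (G * (e * Z * C + e * C)) thin_meas p0 _ Lwi Lwn).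
- by rewrite mulr_ge0 ?(ltW G0)// addr_ge0// !mulr_ge0// ltW.
- apply: measurable_funB => //; apply: measurable_funM; first exact: mext.
  apply: measurable_funM => //; apply: measurable_funD; apply: measurable_funM => //; exact: mext.
- move=> z tz; have ox := thin_om tz; apply: le_trans (ler_normB _ _) _; rewrite lerD2l !normrM.
  rewrite -mulrA; apply: ler_pM => //; first by rewrite ger0_norm ?gG// ltW// g0.
  rewrite mulrC; apply: ler_wpM2r => //.
  apply: le_trans (ler_normD _ _) _; rewrite !normrM (gtr0_norm e0).
  apply: lerD; first by apply: ler_pM => //; [exact: thin_last_bound|exact: KiC].
  by apply: ler_wpM2l; [exact: ltW|exact: AiC].
Qed.

(** The test function in the identity is multiplied by [1 / g], which cancels
    the length of the fibres. *)
Lemma average_weak_derivative phi : test_function om phi ->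
  \int[mu]_(x in om) (Av u x * 'D_(delta_mx ord0 i) phi x) = - \int[mu]_(x in om) (Av sheared_gradient x * phi x).
Proof.
move=> tphi; have tdphi := test_derive (delta_mx ord0 i) tphi.
have H0 := shear_identity tphi.
have iS := Lp_integrable thin_meas thin_finite p1 sheared_gradient_Lp.
pose h1 x := k0 x * 'D_(delta_mx ord0 i) phi x; pose h2 x := k0 x * phi x.
have mphi : measurable_fun om phi.
  by apply: measurable_funTS; apply: continuous_measurable_rV; exact: smooth_continuous tphi.1.
have mdphi : measurable_fun om ('D_(delta_mx ord0 i) phi : 'rV[R]_n -> R).
  by apply: measurable_funTS; apply: continuous_measurable_rV; exact: smooth_continuous tdphi.1.
have mh1 : measurable_fun om h1 by exact: measurable_funM.
have mh2 : measurable_fun om h2 by exact: measurable_funM.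
have bnd (f : 'rV[R]_n -> R) : test_function om f -> exists M, forall z, thin z -> `|k0 (col' ord_max z) * f (col' ord_max z)| <= M.
  move=> tf; have [M HM] := test_bounded tf; exists (c^-1 * M) => z tz.
  by rewrite normrM; apply: ler_pM => //; exact: k0_bound (thin_om tz).
have [M1 HM1] := bnd _ tdphi; have [M2 HM2] := bnd _ tphi.
have i1 : mu1.-integrable thin (EFin \o (fun z => u z * h1 (col' ord_max z))).
  exact: (@integrable_mulr_bounded _ _ R mu1 thin u _ M1 thin_meas iu (mext mh1) HM1).
have i2 : mu1.-integrable thin (EFin \o (fun z => sheared_gradient z * h2 (col' ord_max z))).
  exact: (@integrable_mulr_bounded _ _ R mu1 thin sheared_gradient _ M2 thin_meas iS (mext mh2) HM2).
have E1 := av_mul_integral om_open gm_cont gp_cont c0 gc e0 iu i1 mh1.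
have E2 := av_mul_integral om_open gm_cont gp_cont c0 gc e0 iS i2 mh2.
have E : \int[mu1]_(z in thin) (u z * h1 (col' ord_max z) + sheared_gradient z * h2 (col' ord_max z)) = 0.
  rewrite -[RHS]H0; apply: eq_Rintegral => z; rewrite inE => tz.
  have gz : g (col' ord_max z) != 0 by rewrite gt_eqF// g0//; exact: thin_om.
  by rewrite /integrand /h1 /h2 /sheared_gradient /k0; field.
move: E; rewrite (@RintegralD _ _ _ mu1 thin _ _ thin_meas i1 i2) E1 E2 -mulrDr => /eqP.
rewrite mulf_eq0 gt_eqF//= addr_eq0 => /eqP.
have cancel (F : 'rV[R]_n.+1 -> R) (f : 'rV[R]_n -> R) : \int[mu]_(x in om) (Av F x * f x) = \int[mu]_(x in om) (g x * Av F x * (k0 x * f x)).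
  apply: eq_Rintegral => x; rewrite inE => ox; rewrite /k0; field; rewrite gt_eqF//; exact: g0.
by move=> H; rewrite !cancel; exact: H.
Qed.

End average_derivative.

(** * Energy of an average *)

Lemma enorm_powR (R : realType) n (x : 'rV[R]_n) p : enorm x `^ p = (\sum_j x ord0 j ^+ 2) `^ (p / 2).
Proof.
rewrite /enorm -powR12_sqrt; last by apply: sumr_ge0 => j _; exact: sqr_ge0.
by rewrite -powRrM mulrC.
Qed.

Lemma enorm_le_sum (R : realType) n (x : 'rV[R]_n) : enorm x <= \sum_j `|x ord0 j|.
Proof.
have H (s : seq 'I_n) : 0 <= \sum_(j <- s) `|x ord0 j| /\ \sum_(j <- s) x ord0 j ^+ 2 <= (\sum_(j <- s) `|x ord0 j|) ^+ 2.
  elim: s => [|j s [IH0 IH]]; first by rewrite !big_nil expr0n.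
  rewrite !big_cons; split; first by rewrite addr_ge0.
  have h : 0 <= `|x ord0 j| by [].
  rewrite sqrrD real_normK ?num_real// -addrA lerD2l; apply: le_trans IH _.
  by rewrite lerDr mulrn_wge0// mulr_ge0.
have [h0 h1] := H (index_enum 'I_n).
by rewrite /enorm -[leRHS](ger0_norm h0) -sqrtr_sqr ler_wsqrtr.
Qed.

Lemma enorm_Lp (R : realType) n m (Om : set 'rV[R]_n) p (w : 'rV[R]_n -> 'rV[R]_m) : measurable Om -> (lebesgue_rV Om < +oo)%E ->
  0 < p -> (forall j, Lp Om p (fun x => w x ord0 j)) -> Lp Om p (fun x => enorm (w x)).
Proof.
move=> mO fO p0 Lw.
have mw j : measurable_fun Om (fun x => w x ord0 j) by have /(LpP _ mO p0)[] := Lw j.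
have L0 : Lp Om p (fun=> 0) by apply: (@bounded_Lp _ _ Om p (fun=> 0) 0) => // x _; rewrite normr0.
have LS : Lp Om p (fun x => \sum_j `|w x ord0 j|).
  elim: (index_enum _) => [|j s IH]; first by under eq_fun do rewrite big_nil.
  apply: (@Lp_dominated _ _ Om p _ _ _ 1 mO p0 ler01 (Lw j) IH).
    under eq_fun do rewrite big_cons.
    by apply: measurable_funD; [exact: measurableT_comp|have /(LpP _ mO p0)[] := IH].
  by move=> x _; rewrite big_cons mul1r; apply: le_trans (ler_normD _ _) _; rewrite normr_id.
apply: (@Lp_dominated _ _ Om p _ _ _ 1 mO p0 ler01 L0 LS); first exact: enorm_measurable.
move=> x _; rewrite normr0 add0r mul1r ger0_norm ?enorm_ge0//.
by apply: le_trans (enorm_le_sum _) _; exact: ler_norm.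
Qed.

(** The exact defect is the square of [e * a + b * q] divided by [e]. *)
Lemma shear_sqr (R : realType) (a b q e D : R) : 0 < e -> e <= 1 -> `|q| <= e * D ->
  (a - b * q) ^+ 2 <= (1 + e) * a ^+ 2 + 2 * e * D ^+ 2 * b ^+ 2.
Proof.
move=> e0 e1 qD; have D0 : 0 <= D.
  by have := le_trans (normr_ge0 _) qD; rewrite pmulr_rge0.
have q2 : q ^+ 2 <= e ^+ 2 * D ^+ 2.
  by rewrite -exprMn -(real_normK (num_real q)) lerXn2r ?nnegrE ?mulr_ge0// ltW.
have s0 : 0 <= (e * a + b * q) ^+ 2 / e by rewrite divr_ge0 ?sqr_ge0// ltW.
have E : (a - b * q) ^+ 2 = (1 + e) * a ^+ 2 + (1 + e^-1) * (b ^+ 2 * q ^+ 2) - (e * a + b * q) ^+ 2 / e.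
  by field; rewrite gt_eqF.
rewrite E; have b0 := sqr_ge0 b.
have h1 : (1 + e^-1) * (b ^+ 2 * q ^+ 2) <= (1 + e^-1) * (b ^+ 2 * (e ^+ 2 * D ^+ 2)).
  by rewrite ler_wpM2l ?ler_wpM2l// addr_ge0// invr_ge0 ltW.
have h2 : (1 + e^-1) * (b ^+ 2 * (e ^+ 2 * D ^+ 2)) = (e + e ^+ 2) * (D ^+ 2 * b ^+ 2).
  by field; rewrite gt_eqF.
have h3 : (e + e ^+ 2) * (D ^+ 2 * b ^+ 2) <= (2 * e) * (D ^+ 2 * b ^+ 2).
  have e2 : e ^+ 2 <= e by rewrite expr2 ler_piMl// ltW.
  apply: ler_wpM2r; first by rewrite mulr_ge0 ?sqr_ge0.
  by rewrite mulr2n mulrDl mul1r lerD2l.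
by lra.
Qed.

Lemma shear_sum (R : realType) n (w : 'rV[R]_n.+1) (q : 'I_n -> R) e D : 0 < e -> e <= 1 -> (forall i, `|q i| <= e * D) ->
  \sum_i (\row_i (w ord0 (lift ord_max i) - w ord0 ord_max * q i)) ord0 i ^+ 2 <=
  (1 + (1 + 2 * n%:R * D ^+ 2) * e) * \sum_j w ord0 j ^+ 2.
Proof.
move=> e0 e1 qD; set b := w ord0 ord_max.
have -> : \sum_j w ord0 j ^+ 2 = \sum_(i < n) w ord0 (lift ord_max i) ^+ 2 + b ^+ 2.
  rewrite big_ord_recr/=; congr (_ + _); apply: eq_bigr => l _; congr (w _ _ ^+ 2).
  by apply: val_inj; rewrite /= /bump leqNgt ltn_ord.
set S := \sum_(i < n) w ord0 (lift ord_max i) ^+ 2.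
have S0 : 0 <= S by apply: sumr_ge0 => i _; exact: sqr_ge0.
apply: (@le_trans _ _ (\sum_(i < n) ((1 + e) * w ord0 (lift ord_max i) ^+ 2 + 2 * e * D ^+ 2 * b ^+ 2))).
  by apply: ler_sum => i _; rewrite mxE; exact: shear_sqr.
rewrite big_split/= -mulr_sumr -/S sumr_const card_ord -[_ *+ n]mulr_natl.
have b0 := sqr_ge0 b; have D0 := sqr_ge0 D; have n0 : 0 <= n%:R :> R by [].
have h : 0 <= n%:R * D ^+ 2 * e * S by rewrite mulr_ge0// mulr_ge0 ?(ltW e0)// mulr_ge0.
have h' : 0 <= (1 + e) * b ^+ 2 by rewrite mulr_ge0// addr_ge0 ?(ltW e0).
rewrite -subr_ge0 (_ : _ - _ = 2 * (n%:R * D ^+ 2 * e * S) + (1 + e) * b ^+ 2); last by ring.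
by rewrite addr_ge0// mulr_ge0.
Qed.

Section average_energy.
Context {R : realType} {n : nat} (om : set 'rV[R]_n) (gm gp : 'rV[R]_n -> R) (c G B Z K p : R).
Let g x := gp x - gm x.
Let mu := @lebesgue_rV R n.
Let mu1 := @lebesgue_rV R n.+1.
Hypothesis om_open : open om.
Hypothesis om_fin : (mu om < +oo)%E.
Hypothesis omB : forall x, om x -> forall j, `|x ord0 j| <= B.
Hypothesis gm_cont : {in om, continuous gm}.
Hypothesis gp_cont : {in om, continuous gp}.
Hypothesis c0 : 0 < c.
Hypothesis gc : forall x, om x -> c <= g x.
Hypothesis G0 : 0 < G.
Hypothesis gG : forall x, om x -> g x <= G.
Hypothesis Z0 : 0 <= Z.
Hypothesis gmZ : forall x, om x -> `|gm x| <= Z.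
Hypothesis gpZ : forall x, om x -> `|gp x| <= Z.
Hypothesis K0 : 0 <= K.
Hypothesis gmK : forall x y, om x -> om y -> `|gm x - gm y| <= K * `|x - y|.
Hypothesis gpK : forall x y, om x -> om y -> `|gp x - gp y| <= K * `|x - y|.
Hypothesis p1 : 1 <= p.
Hypothesis HX : is_hilbert (limit_space om gm gp).

Local Notation leb := (@lebesgue_measure R).
Let om_meas : measurable om. Proof. exact: open_measurable_rV. Qed.
Let g0 x : om x -> 0 < g x. Proof. by move=> /gc; exact: lt_le_trans. Qed.
Let g_cont : {in om, continuous g}.
Proof. by move=> x ox; apply: continuousB; [exact: gp_cont|exact: gm_cont]. Qed.
Let p0 : 0 < p. Proof. by apply: lt_le_trans p1. Qed.

Let k0 x := (g x)^-1.
Let a0 x := - gm x / g x.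

Let gK x y : om x -> om y -> `|g x - g y| <= 2 * K * `|x - y|.
Proof.
move=> ox oy; have -> : g x - g y = (gp x - gp y) - (gm x - gm y) by rewrite /g; ring.
apply: le_trans (ler_normB _ _) _; have -> : 2 * K * `|x - y| = K * `|x - y| + K * `|x - y| by ring.
by apply: lerD; [exact: gpK|exact: gmK].
Qed.

Let gg x y : om x -> om y -> c ^+ 2 <= g x * g y.
Proof. by move=> ox oy; rewrite expr2; apply: ler_pM; rewrite ?(ltW c0)//; exact: gc. Qed.

Let k0_lip x y : om x -> om y -> `|k0 x - k0 y| <= (2 * K / c ^+ 2) * `|x - y|.
Proof.
move=> ox oy; have gx := g0 ox; have gy := g0 oy.
have -> : k0 x - k0 y = (g y - g x) / (g x * g y) by rewrite /k0; field; rewrite !gt_eqF.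
have gxy : 0 < g x * g y by rewrite mulr_gt0.
rewrite normrM [X in _ * X]gtr0_norm ?invr_gt0// distrC mulrAC; apply: ler_pM => //.
- by rewrite invr_ge0 ltW.
- exact: gK.
- by rewrite lef_pV2 ?posrE ?exprn_gt0//; exact: gg.
Qed.

Let a0_lip x y : om x -> om y -> `|a0 x - a0 y| <= ((Z * (2 * K) + G * K) / c ^+ 2) * `|x - y|.
Proof.
move=> ox oy; have gx := g0 ox; have gy := g0 oy.
have -> : a0 x - a0 y = (gm y * (g x - g y) + g y * (gm y - gm x)) / (g x * g y).
  by rewrite /a0; field; rewrite !gt_eqF.
have gxy : 0 < g x * g y by rewrite mulr_gt0.
rewrite normrM [X in _ * X]gtr0_norm ?invr_gt0// mulrAC; apply: ler_pM => //.
- by rewrite invr_ge0 ltW.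
- have b1 : `|gm y * (g x - g y)| <= Z * (2 * K * `|x - y|).
    by rewrite normrM; apply: ler_pM => //; [exact: gmZ|exact: gK].
  have b2 : `|g y * (gm y - gm x)| <= G * (K * `|x - y|).
    by rewrite normrM; apply: ler_pM => //; [rewrite gtr0_norm// gG|rewrite distrC; exact: gmK].
  apply: le_trans (ler_normD _ _) _.
  rewrite (_ : (Z * (2 * K) + G * K) * `|x - y| = Z * (2 * K * `|x - y|) + G * (K * `|x - y|)); last by ring.
  exact: lerD.
- by rewrite lef_pV2 ?posrE ?exprn_gt0//; exact: gg.
Qed.

Let approx (f : 'rV[R]_n -> R) L (i : 'I_n) : 0 <= L -> (forall x y, om x -> om y -> `|f x - f y| <= L * `|x - y|) ->
  exists C (h : nat -> 'rV[R]_n -> R) (F : 'rV[R]_n -> R), 0 <= C /\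
  [/\ forall m, [/\ smooth (h m), forall x, om x -> `|h m x - f x| <= m.+1%:R^-1 &
         forall x, om x -> `|'D_(delta_mx ord0 i) (h m) x| <= C],
      measurable_fun om F, forall x, om x -> `|F x| <= C &
      {ae mu, forall x, om x -> 'D_(delta_mx ord0 i) (h m) x @[m --> \oo] --> F x}].
Proof.
move=> L0 fL; have [C C0 H] := lipschitz_smooth_approx i om_open omB L0 fL.
have [h [F HF]] := smooth_approx_derivative_ae om_open om_fin g_cont c0 gc gG HX H.
by exists C, h, F.
Qed.

(** The functions [Ki] and [Ai] play the role of the derivatives of [1 / g] and
    [- gm / g]. They depend neither on [e] nor on [u], hence the uniform
    constant in [average_energy]. *)
Lemma average_gradient : exists (C : R) (Ki Ai : 'I_n -> 'rV[R]_n -> R),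
  [/\ 0 <= C, forall i, measurable_fun om (Ki i), forall i, measurable_fun om (Ai i),
      forall i x, om x -> `|Ki i x| <= C /\ `|Ai i x| <= C &
  forall e u w, 0 < e -> Lp (thin_domain om gm gp e) p u -> weak_gradient (thin_domain om gm gp e) p u w ->
    (forall i, Lp (thin_domain om gm gp e) p (sheared_gradient gm gp e w i (Ki i) (Ai i))) /\
    weak_gradient om p (@thin_average R n om gm gp e u)
      (fun x => \row_i @thin_average R n om gm gp e (sheared_gradient gm gp e w i (Ki i) (Ai i)) x)].
Proof.
have kL : 0 <= 2 * K / c ^+ 2 by rewrite divr_ge0 ?mulr_ge0 ?exprn_ge0// ltW.
have aL : 0 <= (Z * (2 * K) + G * K) / c ^+ 2 by rewrite divr_ge0 ?addr_ge0 ?mulr_ge0 ?exprn_ge0// ltW.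
have /choice[Ck /choice[kk /choice[Ki Hk]]] i := approx i kL k0_lip.
have /choice[Ca /choice[ak /choice[Ai Ha]]] i := approx i aL a0_lip.
pose C := \sum_i (Ck i + Ca i).
have Ck0 i : 0 <= Ck i by have [] := Hk i.
have Ca0 i : 0 <= Ca i by have [] := Ha i.
have CC i : Ck i + Ca i <= C.
  by rewrite /C (bigD1 i)//= lerDl sumr_ge0// => l _; rewrite addr_ge0.
have CkC i : Ck i <= C by apply: le_trans (CC i); rewrite lerDl.
have CaC i : Ca i <= C by apply: le_trans (CC i); rewrite lerDr.
have C0 : 0 <= C by rewrite sumr_ge0// => i _; rewrite addr_ge0.
have mKi i : measurable_fun om (Ki i) by have [_ []] := Hk i.
have mAi i : measurable_fun om (Ai i) by have [_ []] := Ha i.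
have KiC i x : om x -> `|Ki i x| <= C by have [_ [_ _ H _]] := Hk i => ox; exact: le_trans (H x ox) (CkC i).
have AiC i x : om x -> `|Ai i x| <= C by have [_ [_ _ H _]] := Ha i => ox; exact: le_trans (H x ox) (CaC i).
have Hk' i m : [/\ smooth (kk i m), forall x, om x -> `|kk i m x - k0 x| <= m.+1%:R^-1 &
    forall x, om x -> `|'D_(delta_mx ord0 i) (kk i m) x| <= C].
  have [_ [/(_ m)[h1 h2 h3] _ _ _]] := Hk i; split => // x ox; exact: le_trans (h3 x ox) (CkC i).
have Ha' i m : [/\ smooth (ak i m), forall x, om x -> `|ak i m x - a0 x| <= m.+1%:R^-1 &
    forall x, om x -> `|'D_(delta_mx ord0 i) (ak i m) x| <= C].
  have [_ [/(_ m)[h1 h2 h3] _ _ _]] := Ha i; split => // x ox; exact: le_trans (h3 x ox) (CaC i).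
exists C, Ki, Ai; split => //.
  by move=> i x ox; split; [exact: KiC|exact: AiC].
move=> e u w e0 Lu uw.
have LS i : Lp (thin_domain om gm gp e) p (sheared_gradient gm gp e w i (Ki i) (Ai i)).
  exact: (sheared_gradient_Lp om_open gm_cont gp_cont c0 gc G0 gG Z0 gmZ gpZ e0 p1 uw i (mKi i) (mAi i) (@KiC i) (@AiC i) C0).
split => // i; split.
  rewrite (_ : (fun x => _) = @thin_average R n om gm gp e (sheared_gradient gm gp e w i (Ki i) (Ai i))).
    exact: (av_Lp om_open om_fin gm_cont gp_cont c0 gc gG e0 p1 (LS i)).
  by apply/funext => x; rewrite mxE.
move=> phi tphi; under [in RHS]eq_Rintegral do rewrite mxE.
have [_ [_ _ _ ck]] := Hk i; have [_ [_ _ _ ca]] := Ha i.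
exact: (average_weak_derivative om_open om_fin omB gm_cont gp_cont c0 gc G0 gG Z0 gmZ gpZ e0 p1 Lu uw
  (Hk' i) (Ha' i) (mKi i) (mAi i) (@KiC i) (@AiC i) ck ca C0 tphi).
Qed.

Lemma average_energy : exists2 C, 0 <= C & forall e (u : thin_space om gm gp e), 0 < e -> e <= 1 ->
  (limit_energy p (thin_average u) <= ((1 + C * e) `^ (p / 2))%:E * thin_energy p u)%E.
Proof.
have [C [Ki [Ai [C0 mKi mAi KAC Hav]]]] := average_gradient.
pose D := G * (Z * C + C).
have D0 : 0 <= D by rewrite mulr_ge0 ?addr_ge0 ?mulr_ge0// ltW.
exists (1 + 2 * n%:R * D ^+ 2); first by rewrite addr_ge0// mulr_ge0 ?sqr_ge0// mulr_ge0.
set C2 := 1 + _; have C20 : 0 <= C2 by rewrite addr_ge0// mulr_ge0 ?sqr_ge0// mulr_ge0.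
move=> e u e0 e1; set la := _ `^ _.
have la0 : 0 < la by rewrite powR_gt0// ltr_pwDl// mulr_ge0// ltW.
rewrite /thin_energy; case: ifPn => [|_]; last by rewrite mulry gtr0_sg// mul1e leey.
rewrite inE => Wu; have uw := grad_spec Wu; have [Lu _] := Wu.
set thin := thin_domain om gm gp e in Wu uw Lu *.
have thin_meas : measurable thin by exact: thin_measurable.
have thin_fin' : (mu1 thin < +oo)%E := thin_fin om_open om_fin gm_cont gp_cont c0 gc gG e0.
set w := grad thin p u in uw *.
have [LS WL] := Hav e u w e0 Lu uw.
pose sg i := sheared_gradient gm gp e w i (Ki i) (Ai i).
pose sh z := \row_i sg i z : 'rV[R]_n.
set Av := @thin_average R n om gm gp e in WL.
pose W x := \row_i Av (sg i) x : 'rV[R]_n.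
have LAu : Lp om p (Av u) by exact: (av_Lp om_open om_fin gm_cont gp_cont c0 gc gG e0 p1 Lu).
have WAu : W1p om p (Av u) by split => //; exists W.
rewrite /limit_energy mem_set//.
have Lsh j : Lp thin p (fun z => sh z ord0 j).
  by rewrite (_ : (fun z => _) = sg j); [exact: LS|apply/funext => z; rewrite mxE].
have LE : Lp thin p (fun z => enorm (sh z)) by exact: enorm_Lp.
have iE := Lp_integrable thin_meas thin_fin' p1 LE.
have /(Lp_powR_integrable _ thin_meas p0)[mE iEp] := LE.
have ish j := Lp_integrable thin_meas thin_fin' p1 (Lsh j).
have mw j : measurable_fun thin (fun x => w x ord0 j) by have [/(LpP _ thin_meas p0)[]] := uw j.
have mgr j : measurable_fun om (fun x => grad om p (Av u) x ord0 j) by have [/(LpP _ om_meas p0)[]] := grad_spec WAu j.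
have mg : measurable_fun om g by exact: open_continuous_measurable_rV.
have mAE := av_measurable om_open gm_cont gp_cont c0 gc e0 iE.
have ae := weak_gradient_unique om_open om_fin p1 (grad_spec WAu) WL.
have step1 : (\int[mu]_(x in om) (g x * enorm (grad om p (Av u) x) `^ p)%:E <=
    \int[mu]_(x in om) (g x * `|Av (fun z => enorm (sh z)) x| `^ p)%:E)%E.
  apply: ae_ge0_le_integral => //.
  - by move=> x ox; rewrite lee_fin mulr_ge0 ?powR_ge0// ltW// g0.
  - apply/measurable_EFinP; apply: measurable_funM => //; apply: (measurableT_comp (measurable_powR p)).
    exact: enorm_measurable.
  - by move=> x ox; rewrite lee_fin mulr_ge0 ?powR_ge0// ltW// g0.
  - apply/measurable_EFinP; apply: measurable_funM => //; apply: (measurableT_comp (measurable_powR p)).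
    exact: measurableT_comp.
  have ae1 : {ae mu, forall x, forall j, om x -> leb.-integrable `]e * gm x, e * gp x[ (EFin \o (fun t => sh (rV_rcons x t) ord0 j))}.
    apply: filter_forall => j; exact: (slice_integrable om_open gm_cont gp_cont (ish j)).
  have ae2 := slice_integrable om_open gm_cont gp_cont iE.
  apply: filterS3 ae ae1 ae2 => x h1 h2 h3 ox.
  rewrite h1// lee_fin ler_wpM2l ?(ltW (g0 ox))// ge0_ler_powR ?(ltW p0) ?nnegrE ?enorm_ge0//.
  apply: le_trans _ (ler_norm _).
  have eg : 0 < e * g x by rewrite mulr_gt0// g0.
  have := @mean_enorm _ _ _ leb `]e * gm x, e * gp x[%classic _ (measurable_itv _) eg _ (fun t => sh (rV_rcons x t)) (fun j => h2 j ox) (h3 ox).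
  apply: le_trans; rewrite le_eqVlt; apply/orP; left; apply/eqP; congr enorm.
  apply/rowP => j; rewrite !mxE; congr (_ * _); apply: eq_Rintegral => t _.
  by rewrite mxE.
have step2 := av_powR om_open gm_cont gp_cont c0 gc e0 p1 iE iEp.
have step3 : (\int[mu1]_(z in thin) (`|enorm (sh z)| `^ p)%:E <= la%:E * \int[mu1]_(z in thin) (enorm (w z) `^ p)%:E)%E.
  have mwp : measurable_fun thin (fun z => (enorm (w z) `^ p)%:E).
    by apply/measurable_EFinP; apply: (measurableT_comp (measurable_powR p)); exact: enorm_measurable.
  rewrite -ge0_integralZl_EFin ?(ltW la0)//; last by move=> z _; rewrite lee_fin powR_ge0.
  apply: ge0_le_integral => //.
  - by move/integrableP : iEp => [].
  - exact: measurable_funeM.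
  move=> z tz; have [oz zn] := tz.
  rewrite lee_fin ger0_norm ?enorm_ge0// !enorm_powR /la -powRM; last 2 first.
  - by rewrite addr_ge0// mulr_ge0// ltW.
  - by apply: sumr_ge0 => j _; exact: sqr_ge0.
  rewrite ge0_ler_powR ?divr_ge0 ?(ltW p0) ?nnegrE//.
  - by apply: sumr_ge0 => j _; exact: sqr_ge0.
  - by rewrite mulr_ge0 ?addr_ge0 ?mulr_ge0 ?(ltW e0)//; apply: sumr_ge0 => j _; exact: sqr_ge0.
  (* The shear is of size [e], because the height is. *)
  pose q i := g (col' ord_max z) * (z ord0 ord_max * Ki i (col' ord_max z) + e * Ai i (col' ord_max z)).
  have qD i : `|q i| <= e * D.
    have [k1 k2] := KAC i _ oz.
    have tZ := thin_last_bound gmZ gpZ e0 tz.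
    rewrite (_ : e * D = G * (e * Z * C + e * C)); last by rewrite /D; ring.
    rewrite normrM; apply: ler_pM => //; first by rewrite gtr0_norm ?gG// g0.
    apply: le_trans (ler_normD _ _) _; rewrite !normrM (gtr0_norm e0).
    by apply: lerD; [apply: ler_pM|apply: ler_wpM2l => //; exact: ltW].
  apply: le_trans _ (shear_sum (w z) e0 e1 qD).
  rewrite le_eqVlt; apply/orP; left; apply/eqP; apply: eq_bigr => j _; congr (_ ^+ 2).
  by rewrite !mxE /sg /sheared_gradient /q mulrCA.
apply: (@le_trans _ _ (p^-1%:E * (e^-1%:E * (la%:E * \int[mu1]_(z in thin) (enorm (w z) `^ p)%:E)))%E).
  rewrite lee_wpmul2l ?lee_fin ?invr_ge0 ?(ltW p0)//.
  apply: le_trans step1 _; apply: le_trans step2 _.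
  by rewrite lee_wpmul2l ?lee_fin ?invr_ge0 ?(ltW e0).
by rewrite !muleA -!EFinM le_eqVlt; apply/orP; left; apply/eqP; congr (_%:E * _)%E; field; rewrite !gt_eqF.
Qed.
End average_energy.

(** * Convergence of the flows *)

Lemma dissip_combine (R : realType) (C eu ev a b d : R) : 0 <= C ->
  eu - a <= ev -> ev - b <= (1 + C) * eu -> eu + d <= 0 -> - a - b + C * d <= 0.
Proof. by move=> C0 h1 h2 h3; have := ler_wpM2l C0 h3; lra. Qed.

Section comparison.
Context {R : realType} (X X0 : ipSpace R) (HX : is_hilbert X) (HX0 : is_hilbert X0).
Context (lift : X0 -> X) (L : X -> X0).
Hypothesis lift_mem : forall x, ip_mem X0 x -> ip_mem X (lift x).
Hypothesis L_mem : forall x, ip_mem X x -> ip_mem X0 (L x).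
Hypothesis liftB : forall x y, lift (x - y) = lift x - lift y.
Hypothesis adj : forall x z, ip_mem X0 x -> ip_mem X z -> ip X (lift x) z = ip X0 x (L z).
Hypothesis isom : forall x y, ip_mem X0 x -> ip_mem X0 y -> ip X (lift x) (lift y) = ip X0 x y.
Context (E : X -> \bar R) (E0 : X0 -> \bar R) (C : R).
Hypothesis C0 : 0 <= C.
Hypothesis E_ge0 : forall x, (0 <= E x)%E.
Hypothesis E0_ge0 : forall x, (0 <= E0 x)%E.
Hypothesis E_zero : (E 0 <= 0)%E.
Hypothesis E0_zero : (E0 0 <= 0)%E.
Hypothesis E_lift : forall x, ip_mem X0 x -> (E (lift x) <= E0 x)%E.
Hypothesis E0_L : forall x, ip_mem X x -> (E0 (L x) <= (1 + C)%:E * E x)%E.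

Lemma subdiff_fin (Y : ipSpace R) (HY : is_hilbert Y) (F : Y -> \bar R) f y : (forall x, 0 <= F x)%E -> (F (0%R : Y) <= 0)%E ->
  subdiff F y f -> F y \is a fin_num.
Proof.
move=> F0 Fz [my mf H]; have := H 0 (mem0 HY).
move: (F0 y); case: (F y) => [r| |]//= _ /le_trans/(_ Fz).
by rewrite leye_eq.
Qed.

(** The three test vectors are [lift v] for [u], [L u] for [v] and [0] for [u];
    the last one, weighted by [C], absorbs the excess of energy of [L u]. *)
Lemma subdiff_dissip u v f h : subdiff E u (- f) -> subdiff E0 v (- h) ->
  ip X (f - lift h) (u - lift v) + C * ip X f u <= 0.
Proof.
move=> Su Sv; have fu := subdiff_fin HX E_ge0 E_zero Su; have fv := subdiff_fin HX0 E0_ge0 E0_zero Sv.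
have [mu mf' Hu] := Su; have [mv mh' Hv] := Sv.
have mf : ip_mem X f by rewrite -(opprK f); exact: memN.
have mh : ip_mem X0 h by rewrite -(opprK h); exact: memN.
have mlv := lift_mem mv; have mlh := lift_mem mh; have mLu := L_mem mu.
pose eu := fine (E u); pose ev := fine (E0 v).
have Eu : E u = eu%:E by rewrite fineK.
have Ev : E0 v = ev%:E by rewrite fineK.
have h1 : eu - ip X f (lift v - u) <= ev.
  have := le_trans (Hu _ mlv) (E_lift mv); rewrite Eu Ev (ipNl HX mf (memB HX mlv mu)).
  by rewrite -EFinD lee_fin.
have h2 : ev - ip X0 h (L u - v) <= (1 + C) * eu.
  have := le_trans (Hv _ mLu) (E0_L mu); rewrite Eu Ev (ipNl HX0 mh (memB HX0 mLu mv)).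
  by rewrite -EFinD -EFinM lee_fin.
have h3 : eu + ip X f u <= 0.
  have := le_trans (Hu _ (mem0 HX)) E_zero; rewrite Eu sub0r (ipNl HX mf (memN HX mu)) (ipNr HX mu mf).
  by rewrite opprK -EFinD lee_fin.
have := dissip_combine C0 h1 h2 h3; apply: le_trans; rewrite lerD2r.
have mw := memB HX mu mlv.
rewrite ipBl// (ipBr HX mu mlv mlh) adj// isom//.
rewrite (ipBr HX0 mLu mv mh) (ipBr HX mu mlv mf) (ipBr HX mlv mu mf).
by rewrite le_eqVlt; apply/orP; left; apply/eqP; ring.
Qed.

Lemma flows_close T (ue : X) (u0 : X0) (u : R -> X) (v : R -> X0) : 0 < T -> ip_mem X ue -> ip_mem X0 u0 ->
  flow_solution E T ue u -> flow_solution E0 T u0 v ->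
  forall t, 0 <= t <= T ->
    ipnorm (u t - lift (v t)) ^+ 2 <= ipnorm (ue - lift u0) ^+ 2 + C * ipnorm ue ^+ 2.
Proof.
move=> T0 mue mu0 [mu cu iu [du Wu su]] [mv cv iv [dv Wv sv]] t tT.
have dissip : {ae lebesgue_measure, forall q : R, 0 < q < T ->
    ip X (du q - lift (dv q)) (u q - lift (v q)) + C * ip X (du q) (u q) <= 0}.
  apply: (@filterS2 _ _ (ae_filter_ringOfSetsType (@lebesgue_measure R)) _ _ _ _ su sv).
  by move=> q H1 H2 qT; apply: subdiff_dissip; [exact: H1|exact: H2].
have Q := energyQ_le0 HX HX0 lift_mem L_mem liftB adj isom T0 C0 mu cu Wu mv cv Wv dissip tT.
have z0T : 0 <= (0 : R) <= T by rewrite lexx ltW.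
have ut := mu t tT; have vt := mv t tT; have mu00 := mu 0 z0T; have mv00 := mv 0 z0T.
rewrite (ipnorm_sqr HX (memB HX ut (lift_mem vt))).
apply: (@le_trans _ _ (energyQ lift u v C t)).
  by rewrite /energyQ lerDl mulr_ge0// ip_ge0.
apply: le_trans Q _; rewrite /energyQ -(ipnorm_sqr HX (memB HX mu00 (lift_mem mv00))) -(ipnorm_sqr HX mu00).
have mlu0 := lift_mem mu0; have mlv0 := lift_mem mv00.
apply: lerD.
  rewrite lerXn2r ?nnegrE ?ipnorm_ge0//.
  have -> : u 0 - lift (v 0) = (u 0 - ue) + ((ue - lift u0) + (lift u0 - lift (v 0))) by rewrite [ue - _ + _]addrA subrK addrA subrK.
  apply: le_trans (ipnormD HX (memB HX mu00 mue) (memD HX (memB HX mue mlu0) (memB HX mlu0 mlv0))) _.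
  rewrite iu add0r; apply: le_trans (ipnormD HX (memB HX mue mlu0) (memB HX mlu0 mlv0)) _.
  by rewrite -liftB (ipnorm_lift isom (memB HX0 mu0 mv00)) (ipnormC HX0 mu0 mv00) iv addr0.
rewrite ler_wpM2l// lerXn2r ?nnegrE ?ipnorm_ge0//.
rewrite -(subrK ue (u 0)); apply: le_trans (ipnormD HX (memB HX mu00 mue) mue) _.
by rewrite iu add0r.
Qed.

Lemma ipnorm_L_sub u v : ip_mem X u -> ip_mem X0 v -> ipnorm (L u - v) <= ipnorm (u - lift v).
Proof.
move=> mu mv; have mLu := L_mem mu; have mlv := lift_mem mv.
have my := memB HX0 mLu mv; set y := L u - v in my *.
have [->|y0] := eqVneq (ipnorm y) 0; first exact: ipnorm_ge0.
have {}y0 : 0 < ipnorm y by rewrite lt_neqAle eq_sym y0 ipnorm_ge0.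
have mly := lift_mem my.
rewrite -(ler_pM2l y0) -expr2 ipnorm_sqr//.
have -> : ip X0 y y = ip X (lift y) (u - lift v).
  by rewrite ipBr// adj// isom// -ipBr.
apply: le_trans (ler_norm _) _; apply: le_trans (cauchy_schwarz HX mly (memB HX mu mlv)) _.
by rewrite (ipnorm_lift isom my).
Qed.

(** By adjointness the distance is expressed by the two quantities of strong
    convergence. *)
Lemma lift_dist_sqr_le u v : ip_mem X u -> ip_mem X0 v ->
  ipnorm (u - lift v) ^+ 2 <=
  ipnorm u ^+ 2 - ipnorm v ^+ 2 + 2 * (ipnorm v * ipnorm (L u - v)).
Proof.
move=> mu mv; have mLu := L_mem mu; have mlv := lift_mem mv; have my := memB HX0 mLu mv.
rewrite (ipnorm_sqr HX (memB HX mu mlv)) (ip_sqrB HX mu mlv) (ipC HX mu mlv) adj// isom//.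
have -> : ip X0 v (L u) = ip X0 v (L u - v) + ip X0 v v by rewrite (ipBr HX0 mLu mv mv) subrK.
rewrite (ipnorm_sqr HX mu) (ipnorm_sqr HX0 mv).
have := le_trans (ler_norm _) (le_trans _ (cauchy_schwarz HX0 mv my)).
move=> /(_ (- ip X0 v (L u - v))); rewrite normrN => /(_ (lexx _)).
by set a := ip X0 v _; set b := _ * _; lra.
Qed.

Lemma flows_dist T (ue : X) (u0 : X0) (u : R -> X) (v : R -> X0) : 0 < T -> ip_mem X ue -> ip_mem X0 u0 ->
  flow_solution E T ue u -> flow_solution E0 T u0 v ->
  let d := Num.sqrt (ipnorm ue ^+ 2 - ipnorm u0 ^+ 2 +
    2 * (ipnorm u0 * ipnorm (L ue - u0)) + C * ipnorm ue ^+ 2) in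
  forall t, 0 <= t <= T ->
    ipnorm (L (u t) - v t) <= d /\ `|ipnorm (v t) - ipnorm (u t)| <= d.
Proof.
move=> T0 mue mu0 Su Sv d t tT.
have mu : ip_mem X (u t) by case: Su => H _ _ _; exact: H.
have mv : ip_mem X0 (v t) by case: Sv => H _ _ _; exact: H.
have mlv := lift_mem mv.
have H : ipnorm (u t - lift (v t)) <= d.
  rewrite -[leLHS]ger0_norm ?ipnorm_ge0// -sqrtr_sqr; apply: ler_wsqrtr.
  apply: le_trans (flows_close T0 mue mu0 Su Sv tT) _; rewrite lerD2r.
  exact: lift_dist_sqr_le.
split; first exact: le_trans (ipnorm_L_sub mu mv) H.
apply: le_trans H; rewrite -(ipnorm_lift isom mv) (ipnormC HX mu mlv).
exact: ipnorm_dist.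
Qed.
End comparison.

Lemma uniform_dist_cvg (R : realType) (T : R) (F : R -> R -> R) (f d : R -> R) :
  d e @[e --> 0^'+] --> 0 ->
  (\forall e \near 0^'+, forall t, 0 <= t <= T -> `|f t - F e t| <= d e) ->
  {uniform `[0, T], F @ 0^'+ --> f}.
Proof.
move=> cd H P /uniform_nbhs[A [entA AP]].
move: entA; rewrite -entourage_ballE => -[eps /= eps0 epsA].
have /cvgrPdist_lt/(_ _ eps0) de := cd.
near=> e; apply: AP => t; rewrite /= in_itv/= => tT; apply: epsA => /=.
rewrite /ball/=; have Fe : `|f t - F e t| <= d e.
  by move: t tT; near: e.
apply: le_lt_trans Fe _; apply: le_lt_trans (ler_norm _) _.
suff : `|0 - d e| < eps by rewrite sub0r normrN.
by near: e.
Unshelve. all: by end_near.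
Qed.

(** Bounded by the exponential, since [ln (1 + x) <= x]. *)
Lemma powR_sub1_cvg (R : realType) (C r : R) : 0 <= C -> 0 <= r ->
  (1 + C * e) `^ r - 1 @[e --> 0^'+] --> (0 : R).
Proof.
move=> C0 r0.
have H : expR (r * (C * e)) - 1 @[e --> 0^'+] --> (0 : R).
  have ce : (fun e : R => e) @ 0^'+ --> (0 : R) by apply: cvg_at_right_filter; exact: cvg_id.
  have : expR (r * (C * e)) - 1 @[e --> 0^'+] --> expR (r * (C * 0)) - 1.
    apply: cvgB; last exact: cvg_cst.
    apply: continuous_cvg; first exact: continuous_expR.
    apply: cvgM; first exact: cvg_cst.
    apply: cvgM; first exact: cvg_cst.
    exact: ce.
  by rewrite !mulr0 expR0 subrr.
apply: (squeeze_cvgr _ (cvg_cst 0) H); near=> e.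
have e0 : 0 < e by near: e; exact: nbhs_right_gt.
have Ce : 0 <= C * e by rewrite mulr_ge0// ltW.
apply/andP; split.
  have one : (1 : R) `^ r = 1 by rewrite powR1.
  rewrite subr_ge0 -[leLHS]one ge0_ler_powR ?nnegrE//; first by rewrite addr_ge0.
  by rewrite lerDl.
rewrite lerD2r /powR gt_eqF; last by rewrite ltr_pwDl.
by rewrite ler_expR ler_wpM2l// le_ln1Dx// (lt_le_trans _ Ce)// ltrN10.
Unshelve. all: by end_near.
Qed.

Lemma W1p_zero (R : realType) n (Om : set 'rV[R]_n) p : open Om -> (lebesgue_rV Om < +oo)%E -> 1 <= p ->
  W1p Om p (fun=> 0) /\ ae_eq lebesgue_rV Om (grad Om p (fun=> 0)) (fun=> 0).
Proof.
move=> oO fO p1; have mO := open_measurable_rV oO; have p0 : 0 < p by apply: lt_le_trans p1.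
have L0 : Lp Om p (fun=> 0) by apply: (@bounded_Lp _ _ Om p (fun=> 0) 0) => // x _; rewrite normr0.
have w0 : weak_gradient Om p (fun=> 0) (fun=> 0).
  move=> i; split; first by rewrite (_ : (fun _ => _) = fun=> 0)//; apply/funext => x; rewrite mxE.
  move=> phi _; under eq_Rintegral do rewrite mul0r; under [in RHS]eq_Rintegral do rewrite mxE mul0r.
  by rewrite Rintegral_cst// mul0r oppr0.
have W : W1p Om p (fun=> 0) by split => //; exists (fun=> 0).
by split => //; exact: (weak_gradient_unique oO fO p1 (grad_spec W) w0).
Qed.

Lemma lipschitz_in (R : realType) n (om : set 'rV[R]_n) (f : 'rV[R]_n -> R) : [lipschitz f x | x in om] ->
  exists2 K, 0 <= K & forall x y, om x -> om y -> `|f x - f y| <= K * `|x - y|.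
Proof.
move=> lf; near (pinfty_nbhs R) => K; exists K => //.
have HK : K.-lipschitz_om f by near: K.
by move=> x y ox oy; exact: (HK (x, y)).
Unshelve. all: by end_near.
Qed.

Lemma lipschitz_in_continuous (R : realType) n (om : set 'rV[R]_n) (f : 'rV[R]_n -> R) K : open om -> 0 <= K ->
  (forall x y, om x -> om y -> `|f x - f y| <= K * `|x - y|) -> {in om, continuous f}.
Proof.
move=> oom K0 fK x; rewrite inE => ox; suff H : f y @[y --> x] --> f x by exact: H.
apply/(@cvgrPdist_lt _ _ _ (nbhs x) _ f (f x)) => d d0.
have d'0 : 0 < d / (K + 1) by rewrite divr_gt0// ltr_wpDl.
have n1 : \forall y \near x, om y by exact: open_nbhs_nbhs.
have n2 : \forall y \near x, `|x - y| < d / (K + 1).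
  by have := nbhsx_ballx x _ d'0; rewrite -ball_normE.
apply: filterS2 n1 n2 => y oy xy; apply: le_lt_trans (fK _ _ ox oy) _.
apply: (@le_lt_trans _ _ ((K + 1) * `|x - y|)); first by rewrite ler_wpM2r// lerDl.
by rewrite mulrC -ltr_pdivlMr// ltr_wpDl.
Qed.

Lemma thin_energy_ge0 (R : realType) n (om : set 'rV[R]_n) gm gp p e (u : thin_space om gm gp e) : 0 < e -> 0 < p ->
  (0 <= thin_energy p u)%E.
Proof.
move=> e0 p0; rewrite /thin_energy; case: ifP => _; last exact: leey.
apply: mule_ge0; first by rewrite lee_fin invr_ge0 mulr_ge0 ?ltW.
by apply: integral_ge0 => x _; rewrite lee_fin powR_ge0.
Qed.

Lemma limit_energy_ge0 (R : realType) n (om : set 'rV[R]_n) gm gp p (v : limit_space om gm gp) : 0 < p ->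
  (forall x, om x -> 0 < gp x - gm x) -> (0 <= limit_energy p v)%E.
Proof.
move=> p0 g0; rewrite /limit_energy; case: ifP => _; last exact: leey.
apply: mule_ge0; first by rewrite lee_fin invr_ge0 ltW.
apply: integral_ge0 => x ox.
by rewrite lee_fin mulr_ge0 ?powR_ge0// ltW// g0.
Qed.

(** With [h = 1] and [h = g] this covers both functionals. *)
Lemma energy_integral_zero (R : realType) n (Om : set 'rV[R]_n) p (h : 'rV[R]_n -> R) : open Om -> (lebesgue_rV Om < +oo)%E -> 1 <= p ->
  measurable_fun Om h ->
  (\int[lebesgue_rV]_(x in Om) (h x * enorm (grad Om p (fun=> 0) x) `^ p)%:E)%E = 0%E.
Proof.
move=> oO fO p1 mh; have mO := open_measurable_rV oO; have p0 : 0 < p by apply: lt_le_trans p1.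
have [W ae] := W1p_zero oO fO p1.
have mg j : measurable_fun Om (fun x => grad Om p (fun=> 0) x ord0 j) by have [/(LpP _ mO p0)[]] := grad_spec W j.
rewrite (@ae_eq_integral _ _ _ lebesgue_rV Om (cst 0%E)) ?integral0//.
  apply/measurable_EFinP; apply: measurable_funM => //; apply: (measurableT_comp (measurable_powR p)).
  exact: enorm_measurable.
move: ae; apply: filterS => x H Ox; rewrite H//.
rewrite /enorm big1 => [|j _]; last by rewrite mxE expr0n.
by rewrite sqrtr0 powR0 ?mulr0// gt_eqF.
Qed.

(* [n.+2] is the dimension of the thin domains, [n.+1] that of [om]. *)
Theorem theorem4p3 (R : realType) (n : nat) (p : R) (om : set 'rV[R]_n.+1)
    (gm gp : 'rV[R]_n.+1 -> R) (T : R)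
    (S : forall e : R, thin_space om gm gp e -> R -> thin_space om gm gp e)
    (S0 : limit_space om gm gp -> R -> limit_space om gm gp) :
  1 < p ->
  lipschitz_domain om ->
  [lipschitz gm x | x in om] ->
  [lipschitz gp x | x in om] ->
  (forall x, om x -> gm x < gp x) ->
  0 < T ->
  (forall e, 0 < e -> gradient_flow (@thin_energy R n.+1 om gm gp p e) T (S e)) ->
  gradient_flow (@limit_energy R n.+1 om gm gp p) T S0 ->
  flows_uniformly_cvg (@thin_average R n.+1 om gm gp)
    (@limit_energy R n.+1 om gm gp p) (@thin_energy R n.+1 om gm gp p) T S0 S.
Proof.
move=> p1' [om_open _ om0 om_bd _] lgm lgp gmp T0 Sflow [HX0 S0flow].
have p1 : 1 <= p by exact: ltW.
have p0 : 0 < p by apply: lt_trans p1'.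
have [Km Km0 gmK'] := lipschitz_in lgm; have [Kp Kp0 gpK'] := lipschitz_in lgp.
pose K := Km + Kp; have K0 : 0 <= K by rewrite addr_ge0.
have gmK x y : om x -> om y -> `|gm x - gm y| <= K * `|x - y|.
  by move=> ox oy; apply: le_trans (gmK' _ _ ox oy) _; rewrite ler_wpM2r// lerDl.
have gpK x y : om x -> om y -> `|gp x - gp y| <= K * `|x - y|.
  by move=> ox oy; apply: le_trans (gpK' _ _ ox oy) _; rewrite ler_wpM2r// lerDr.
have gm_cont := lipschitz_in_continuous om_open K0 gmK.
have gp_cont := lipschitz_in_continuous om_open K0 gpK.
have [B B0 normB] : exists2 B, 0 <= B & forall x, om x -> `|x| <= B.
  near (pinfty_nbhs R) => B; exists B => //.
  by near: B.
have omB x : om x -> forall j, `|x ord0 j| <= B + 1.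
  move=> ox j; have : ball (0 : 'rV[R]_n.+1) (B + 1) x.
    by rewrite -ball_normE /ball_/= sub0r normrN ltr_pwDr// normB.
  by move=> /rV_ballP[_ /(_ j)]; rewrite mxE sub0r normrN => /ltW.
have om_meas : measurable om by exact: open_measurable_rV.
have om_fin : (lebesgue_rV om < +oo)%E := lebesgue_rV_bounded om_meas omB.
have [x0 ox0] := om0.
pose Z := `|gm x0| + `|gp x0| + K * (2 * B).
have Z0 : 0 <= Z by rewrite !addr_ge0// mulr_ge0// mulr_ge0.
have dist x : om x -> K * `|x - x0| <= K * (2 * B).
  move=> ox; rewrite ler_wpM2l//; apply: le_trans (ler_normB _ _) _.
  by rewrite mulr2n mulrDl mul1r; apply: lerD; exact: normB.
have gmZ x : om x -> `|gm x| <= Z.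
  move=> ox; rewrite -(subrK (gm x0) (gm x)); apply: le_trans (ler_normD _ _) _.
  have := le_trans (gmK _ _ ox ox0) (dist x ox); have := normr_ge0 (gp x0); rewrite /Z; lra.
have gpZ x : om x -> `|gp x| <= Z.
  move=> ox; rewrite -(subrK (gp x0) (gp x)); apply: le_trans (ler_normD _ _) _.
  have := le_trans (gpK _ _ ox ox0) (dist x ox); have := normr_ge0 (gm x0); rewrite /Z; lra.
pose G := 2 * Z + 1; have G0 : 0 < G by rewrite /G; lra.
have gG x : om x -> gp x - gm x <= G.
  move=> ox; apply: le_trans (ler_norm _) _; apply: le_trans (ler_normB _ _) _.
  have := gmZ x ox; have := gpZ x ox; rewrite /G; lra.
have g_gt0 x : om x -> 0 < gp x - gm x by move=> ox; rewrite subr_gt0 gmp.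
have g_cont : {in om, continuous (fun x => gp x - gm x)}.
  by move=> x ox; apply: continuousB; [exact: gp_cont|exact: gm_cont].
(* The completeness of the limit space is part of the hypothesis on its flow.
   *)
have [c c0 gc] := weight_bounded_below om_open om_fin g_cont g_gt0 HX0 om0.
have [C C0 HC] := average_energy om_open om_fin omB gm_cont gp_cont c0 gc G0 gG Z0 gmZ gpZ K0 gmK gpK p1 HX0.
move=> u0 ue du0 due [nue Lue].
pose la e := (1 + C * e) `^ (p / 2) - 1.
pose lift e : limit_space om gm gp -> thin_space om gm gp e := fun v z => v (col' ord_max z).
have [mu0 _] := du0.
pose d e := Num.sqrt (ipnorm (ue e) ^+ 2 - ipnorm u0 ^+ 2 +
  2 * (ipnorm u0 * ipnorm (thin_average (ue e) - u0)) + la e * ipnorm (ue e) ^+ 2).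
have close e : 0 < e -> e <= 1 -> forall t, 0 <= t <= T ->
    ipnorm (thin_average (S e (ue e) t) - S0 u0 t) <= d e /\
    `|ipnorm (S0 u0 t) - ipnorm (S e (ue e) t)| <= d e.
  move=> e0 e1; have [HXe Seflow] := Sflow e e0.
  have la1 : 1 + la e = (1 + C * e) `^ (p / 2) by rewrite /la addrC subrK.
  have la0 : 0 <= la e.
    rewrite /la subr_ge0 -[leLHS](@powRr0 _ (1 + C * e)).
    by apply: ler_powR; [rewrite lerDl mulr_ge0// ltW|rewrite divr_ge0// ltW].
  have oO := @thin_open _ _ om gm gp e om_open gm_cont gp_cont.
  have fO := thin_fin om_open om_fin gm_cont gp_cont c0 gc gG e0.
  have zeroE : (thin_energy p (0%R : thin_space om gm gp e) <= 0)%E.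
    rewrite /thin_energy ifT; last by rewrite inE; have [] := W1p_zero oO fO p1.
    have := energy_integral_zero oO fO p1 (measurable_cst (1 : R)).
    under eq_integral do rewrite mul1r.
    by move=> ->; rewrite mule0.
  have zeroE0 : (limit_energy p (0%R : limit_space om gm gp) <= 0)%E.
    rewrite /limit_energy ifT; last by rewrite inE; have [] := W1p_zero om_open om_fin p1.
    rewrite energy_integral_zero//; first by rewrite mule0.
    exact: open_continuous_measurable_rV.
  have two : (1 : R) <= 2 by rewrite ler1n.
  apply: (@flows_dist R (thin_space om gm gp e) (limit_space om gm gp) HXe HX0
    (lift e) (fun u => thin_average u) _ _ _ _ _ (thin_energy p (e := e)) (limit_energy p) (la e)).
  - move=> x; exact: (ext_Lp om_open gm_cont gp_cont c0 gc gG e0).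
  - move=> x; exact: (av_Lp om_open om_fin gm_cont gp_cont c0 gc gG e0).
  - by [].
  - by move=> x z mx mz; exact: (av_adjoint om_open om_fin gm_cont gp_cont c0 gc gG e0).
  - by move=> x y mx my; exact: (ext_isometry om_open om_fin gm_cont gp_cont c0 gc gG e0).
  - exact: la0.
  - by move=> x; exact: thin_energy_ge0.
  - by move=> x; exact: limit_energy_ge0.
  - exact: zeroE.
  - exact: zeroE0.
  - by move=> x _; exact: (ext_energy om_open om_fin gm_cont gp_cont c0 gc gG e0).
  - by move=> x _; rewrite la1; exact: HC.
  - exact: T0.
  - by have [] := due e e0.
  - exact: mu0.
  - exact: Seflow (due e e0).
  - exact: S0flow.
have dcvg : d e @[e --> 0^'+] --> 0.
  have H : (fun e => ipnorm (ue e) ^+ 2 - ipnorm u0 ^+ 2 +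
      2 * (ipnorm u0 * ipnorm (thin_average (ue e) - u0)) + la e * ipnorm (ue e) ^+ 2) @ 0^'+ -->
      ipnorm u0 * ipnorm u0 - ipnorm u0 ^+ 2 + 2 * (ipnorm u0 * 0) + 0 * (ipnorm u0 * ipnorm u0).
    have sq : (fun e => ipnorm (ue e) ^+ 2) @ 0^'+ --> ipnorm u0 * ipnorm u0.
      by under eq_fun do rewrite expr2; exact: cvgM.
    apply: cvgD; last first.
      apply: cvgM sq; apply: powR_sub1_cvg => //; by rewrite divr_ge0// ltW.
    apply: cvgD; first by apply: cvgB sq _; exact: cvg_cst.
    apply: cvgM; first exact: cvg_cst.
    apply: cvgM; first exact: cvg_cst.
    exact: Lue.
  rewrite -[X in _ --> X]sqrtr0; rewrite expr2 subrr !(mulr0, mul0r, addr0) in H.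
  apply: continuous_cvg; [exact: sqrt_continuous|exact: H].
have lpos : \forall e \near (0 : R)^'+, 0 < e <= 1.
  near=> e; apply/andP; split; near: e; [exact: nbhs_right_gt|exact: nbhs_right_le].
split; apply: (uniform_dist_cvg dcvg); apply: filterS lpos => e /andP[e0 e1] t tT.
- by rewrite /cst sub0r normrN ger0_norm ?ipnorm_ge0//; have [] := close e e0 e1 t tT.
- by have [] := close e e0 e1 t tT.
Unshelve. all: by end_near.
Qed.
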